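(* The maximal relation $T_{\max}$ is a closed linear relation in $H^1(a,b)$, and its adjoint is \[ T_{\max}^\ast=\{f\in T_{\max} \,:\, V(f,g)(a)=V(f,g)(b)=0 \text{ for all } g\in T_{\max}\}. \]
   Context: Let $-\infty\le a<b\le\infty$ and let $\varrho,\varsigma,\chi$ be complex Borel measures on $(a,b)$, finite on compact subintervals, such that $\varrho$ is real-valued, $\varsigma$ is positive with support all of $(a,b)$, $\chi$ is positive and not identically zero, and $\varsigma(\{x\})\chi(\{x\})=\varsigma(\{x\})\varrho(\{x\})=0$ for all $x\in(a,b)$. For such a measure $\mu$ and $c,x\in(a,b)$ write $\int_c^x h\,d\mu=\int_{[c,x)}h\,d\mu$ if $x>c$, $0$ if $x=c$, and $-\int_{[x,c)}h\,d\mu$ if $x<c$. $AC_{\mathrm{loc}}((a,b);\mu)$ is the set of functions $f(x)=f(c)+\int_c^x h\,d\mu$ with $h\in L^1_{\mathrm{loc}}((a,b);\mu)$, and $df/d\mu:=h$. Let $\mathfrak D_\tau$ be the set of $f\in AC_{\mathrm{loc}}((a,b);\varsigma)$ such that the function $x\mapsto -\frac{df}{d\varsigma}(x)+\int_c^x f\,d\chi$ has a (necessarily unique) representative in $AC_{\mathrm{loc}}((a,b);\varrho)$. For such $f$, $\tau f\in L^1_{\mathrm{loc}}((a,b);\varrho)$ is the Radon–Nikodym derivative of that representative with respect to $\varrho$, and $f^{[1]}:=df/d\varsigma$. $T_{\mathrm{loc}}$ is the set of pairs $(f,f_\tau)\in AC_{\mathrm{loc}}((a,b);\varsigma)^2$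 with $f\in\mathfrak D_\tau$ and $\tau f=f_\tau$ in $L^1_{\mathrm{loc}}((a,b);\varrho)$. For $f,g\in T_{\mathrm{loc}}$ set $V(f,g)(x)=f_\tau(x)g^{[1]}(x)-f^{[1]}(x)g_\tau(x)$. $H^1(a,b)$ is the Hilbert space of all $f\in AC_{\mathrm{loc}}((a,b);\varsigma)$ with $\int_a^b|f|^2d\chi<\infty$ and $\int_a^b|f^{[1]}|^2d\varsigma<\infty$, with inner product $\langle f,g\rangle=\int_a^b f g^\ast d\chi+\int_a^b f^{[1]}(g^{[1]})^\ast d\varsigma$. $T_{\max}=\{(f,f_\tau)\in T_{\mathrm{loc}}: f,f_\tau\in H^1(a,b)\}$, regarded as a linear relation in $H^1(a,b)$. For $f,g\in T_{\max}$ the limits $V(f,g)(a):=\lim_{x\to a}V(f,g)(x)$ and $V(f,g)(b):=\lim_{x\to b}V(f,g)(x)$ exist and are finite. *)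

(* Defs.v *)
From HB Require Import structures.
From mathcomp Require Import all_boot all_order all_algebra.
From mathcomp Require Import all_classical all_reals all_analysis.
From mathcomp Require Import complex.

Set Implicit Arguments.
Unset Strict Implicit.
Unset Printing Implicit Defensive.

Import Order.TTheory GRing.Theory Num.Theory.
Local Open Scope ring_scope.
Local Open Scope classical_set_scope.

Section SL_defs.
Context {R : realType}.
Local Notation C := (R[i]).
Implicit Types (a b : \bar R) (mu : {measure set R -> \bar R}).

Definition Iab a b : set R := [set x | (a < x%:E)%E /\ (x%:E < b)%E].

Definition cre (z : C) : R := complex.Re z.
Definition cim (z : C) : R := complex.Im z.
Definition csq (z : C) : R := cre z ^+ 2 + cim z ^+ 2.
Definition cconj (z : C) : C := complex.conjc z.

Definition Cint mu (D : set R) (h : R -> C) : C :=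
  ((\int[mu]_(x in D) cre (h x))%:C + 'i * (\int[mu]_(x in D) cim (h x))%:C)%C.

Definition Sint (rp rn : {measure set R -> \bar R}) (D : set R) (h : R -> C) : C :=
  Cint rp D h - Cint rn D h.

Definition dint (I : set R -> C) (c x : R) : C :=
  if c < x then I `[c, x[ else if x < c then - I `[x, c[ else 0.

Definition locint a b mu (h : R -> C) : Prop :=
  forall c d, Iab a b c -> Iab a b d ->
    mu.-integrable `[c, d] (EFin \o (fun x => cre (h x))) /\
    mu.-integrable `[c, d] (EFin \o (fun x => cim (h x))).

Definition is_deriv a b mu (f h : R -> C) : Prop :=
  locint a b mu h /\
  forall c x, Iab a b c -> Iab a b x -> f x = f c + dint (fun D => Cint mu D h) c x.

Definition ACloc a b mu (f : R -> C) : Prop := exists h, is_deriv a b mu f h.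

(* the real measure varrho is rp - rn, where (rp, rn) is its Jordan
   decomposition (mutually singular), so |varrho| = rp + rn *)
Definition locint_s a b (rp rn : {measure set R -> \bar R}) (h : R -> C) : Prop :=
  locint a b rp h /\ locint a b rn h.

Definition is_deriv_s a b (rp rn : {measure set R -> \bar R}) (f h : R -> C) : Prop :=
  locint_s a b rp rn h /\
  forall c x, Iab a b c -> Iab a b x -> f x = f c + dint (fun D => Sint rp rn D h) c x.

Definition ae_eq_s a b (rp rn : {measure set R -> \bar R}) (f g : R -> C) : Prop :=
  {ae rp, forall x, Iab a b x -> f x = g x} /\
  {ae rn, forall x, Iab a b x -> f x = g x}.

(* [QD f f1 tf]: f in D_tau with (canonical, pointwise) quasi-derivative
   f^[1] = f1 = df/dsigma, and tau f = tf: the function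
   x |-> - f1 x + \int_c^x f dchi  lies in AC_loc((a,b);varrho) with
   Radon-Nikodym derivative tf. *)
Definition QD a b (rp rn sg chi : {measure set R -> \bar R}) (f f1 tf : R -> C) : Prop :=
  is_deriv a b sg f f1 /\
  exists c, Iab a b c /\
    is_deriv_s a b rp rn (fun x => - f1 x + dint (fun D => Cint chi D f) c x) tf.

Definition Tloc a b (rp rn sg chi : {measure set R -> \bar R}) (f ft : R -> C) : Prop :=
  ACloc a b sg f /\ ACloc a b sg ft /\
  exists f1 tf, QD a b rp rn sg chi f f1 tf /\
    locint_s a b rp rn ft /\ ae_eq_s a b rp rn tf ft.

Definition inH1 a b (sg chi : {measure set R -> \bar R}) (f : R -> C) : Prop :=
  exists f1, is_deriv a b sg f f1 /\
    (\int[chi]_(x in Iab a b) (csq (f x))%:E < +oo)%E /\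
    (\int[sg]_(x in Iab a b) (csq (f1 x))%:E < +oo)%E.

(* inner product <f,g> of H^1(a,b), given f^[1] = f1, g^[1] = g1 *)
Definition ipH1 a b (sg chi : {measure set R -> \bar R}) (f f1 g g1 : R -> C) : C :=
  Cint chi (Iab a b) (fun x => f x * cconj (g x)) +
  Cint sg (Iab a b) (fun x => f1 x * cconj (g1 x)).

Definition dist2H1 a b (sg chi : {measure set R -> \bar R}) (f f1 g g1 : R -> C) : \bar R :=
  (\int[chi]_(x in Iab a b) (csq (f x - g x))%:E +
   \int[sg]_(x in Iab a b) (csq (f1 x - g1 x))%:E)%E.

Definition cvgH1 a b (sg chi : {measure set R -> \bar R}) (fn : nat -> R -> C) (f : R -> C) : Prop :=
  forall (f1n : nat -> R -> C) (f1 : R -> C),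
    (forall n, is_deriv a b sg (fn n) (f1n n)) -> is_deriv a b sg f f1 ->
    dist2H1 a b sg chi (fn n) (f1n n) f f1 @[n --> \oo] --> 0%E.

Definition Tmax a b (rp rn sg chi : {measure set R -> \bar R}) (f ft : R -> C) : Prop :=
  Tloc a b rp rn sg chi f ft /\ inH1 a b sg chi f /\ inH1 a b sg chi ft.

Definition Tmax_adj a b (rp rn sg chi : {measure set R -> \bar R}) (g gt : R -> C) : Prop :=
  inH1 a b sg chi g /\ inH1 a b sg chi gt /\
  forall f ft, Tmax a b rp rn sg chi f ft ->
    forall f1 ft1 g1 gt1,
      is_deriv a b sg f f1 -> is_deriv a b sg ft ft1 ->
      is_deriv a b sg g g1 -> is_deriv a b sg gt gt1 ->
      ipH1 a b sg chi ft ft1 g g1 = ipH1 a b sg chi f f1 gt gt1.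

(* V(f,g)(x) = f_tau(x) g^[1](x) - f^[1](x) g_tau(x) *)
Definition Vw (f ft f1 g gt g1 : R -> C) (x : R) : C := ft x * g1 x - f1 x * gt x.

Definition lim_at_left_end (a : \bar R) (F : R -> C) (l : C) : Prop :=
  match a with
  | EFin r => ((fun x => cre (F x)) @ r^'+ --> (cre l : R^o)) /\ ((fun x => cim (F x)) @ r^'+ --> (cim l : R^o))
  | -oo%E => ((fun x => cre (F x)) @ -oo --> (cre l : R^o)) /\ ((fun x => cim (F x)) @ -oo --> (cim l : R^o))
  | +oo%E => False
  end.

Definition lim_at_right_end (b : \bar R) (F : R -> C) (l : C) : Prop :=
  match b with
  | EFin r => ((fun x => cre (F x)) @ r^'- --> (cre l : R^o)) /\ ((fun x => cim (F x)) @ r^'- --> (cim l : R^o))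
  | +oo%E => ((fun x => cre (F x)) @ +oo --> (cre l : R^o)) /\ ((fun x => cim (F x)) @ +oo --> (cim l : R^o))
  | -oo%E => False
  end.

Definition loc_finite a b mu : Prop :=
  forall c d, Iab a b c -> Iab a b d -> (mu `[c, d] < +oo)%E.

End SL_defs.

(* Main.v *)
Require Import Defs.
From HB Require Import structures.
From mathcomp Require Import all_boot all_order all_algebra.
From mathcomp Require Import all_classical all_reals all_analysis.
From mathcomp Require Import complex finmap measurable_realfun ring lra.
Import Order.TTheory GRing.Theory Num.Theory.
Import numFieldNormedType.Exports.
Set Implicit Arguments.
Unset Strict Implicit.
Unset Printing Implicit Defensive.
Local Open Scope ring_scope.
Local Open Scope classical_set_scope.

(** Membership of (f, ft) in the relation is equivalent to the weak equation
    <f, h> = int ft h d rho for test functions h of compact support; both sides are continuous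
    in H^1, hence T_max is closed. For a test function h, Riesz' theorem applied to
    u |-> int h u d rho gives w with (w, h) in T_max, and pairing an element of the adjoint with
    (w, h) shows that it satisfies the weak equation, so T_max^* is contained in T_max. By
    Lagrange's identity V(f, g)(b) - V(f, g)(a) = <ft, g> - <f, gt>, so T_max^* consists of the g
    with V(f, g)(a) = V(f, g)(b) for all f. To separate the two end points, f is replaced by an
    element of T_max that agrees with f near b as far as V(., g) is concerned but whose V with g
    vanishes at a: it is again obtained from Riesz' theorem, which imposes the natural boundary
    condition at a. *)

(** The main obstacle is that a derivative with respect to [sg] is determined only almost
    everywhere, while V is evaluated at points. The equation for the quasi-derivative involves
    integrals over [c, x[, so a solution is left continuous; as [sg] charges every open interval, it
    is then unique at each point. Functions are therefore carried together with an explicit version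
    of their derivative, and versions are exchanged where only inner products matter. For a general
    [sg] there are no smooth functions to test with or to multiply by: test functions and cut-offs
    are built by prescribing a step function as derivative. Point evaluations are bounded on H^1,
    because some compact interval has positive [chi]-mass and the derivative controls the
    oscillation. This makes functionals of compact support bounded and norm convergence pointwise.
    All measures are real, so the arguments are carried out for real functions, and the complex
    statement is recovered from real and imaginary parts. *)

(** * Atoms of measures *)

Lemma atoms_countable (R : realType) (mu : {measure set R -> \bar R}) (D : set R) :
  measurable D -> (mu D < +oo)%E ->
  countable [set x | D x /\ mu [set x] <> 0%E].
Proof.
move=> mD muD.
have -> : [set x | D x /\ mu [set x] <> 0%E] =
  \bigcup_n [set x | D x /\ (n.+1%:R^-1%:E <= mu [set x])%E].
  apply/seteqP; split=> [x [Dx mx]|x [n _ [Dx nx]]]; last first.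
    split=> // mx0; move: nx; rewrite mx0 lee_fin.
    by rewrite leNgt invr_gt0 ltr0n.
  have mxoo : (mu [set x] < +oo)%E.
    apply: le_lt_trans muD; apply: le_measure; [exact/mem_set|exact/mem_set|].
    by move=> y ->.
  have mxE : mu [set x] = (fine (mu [set x]))%:E.
    by rewrite fineK// ge0_fin_numE.
  have r0 : 0 < fine (mu [set x]).
    rewrite lt_neqAle fine_ge0// andbT; apply/eqP => e.
    by apply: mx; rewrite mxE -e.
  exists (Num.trunc (fine (mu [set x]))^-1) => //; split => //; rewrite mxE lee_fin.
  by rewrite invf_ple ?posrE ?ltr0n// ltW// truncnS_gt.
apply: bigcup_countable => // n _; apply: finite_set_countable.
apply: contrapT => infA.
(* More than K points of mass at least 1/(n+1) would together outweigh D. *)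
pose K := (fine (mu D) * n.+1%:R).
have [B BA cB] := infinite_set_fset (Num.trunc K).+1 infA.
have mDE : mu D = (fine (mu D))%:E by rewrite fineK// ge0_fin_numE.
have : (mu (\bigcup_(i in [set` B]) [set i]) <= mu D)%E.
  apply: le_measure; [|exact/mem_set|].
    by apply/mem_set/fin_bigcup_measurable.
  by move=> x [y /BA[Dy _] ->].
rewrite measure_fin_bigcup//; last by move=> x y _ _ [z [-> ->]].
rewrite leNgt => /negP; apply.
rewrite -fsbig_seq//=.
apply: (@lt_le_trans _ _ (\sum_(i <- B) n.+1%:R^-1%:E)%E); last first.
  rewrite !big_seq; apply: lee_sum => i iB.
  by have [] := BA _ iB.
rewrite sumEFin mDE lte_fin.
rewrite big_const_seq count_predT iter_addr addr0 -[X in _ < X]mulr_natl.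
rewrite ltr_pdivlMr ?ltr0n//.
apply: lt_le_trans (truncnS_gt _) _.
by rewrite ler_nat.
Qed.

(** N is the set of [nu]-atoms in D: it is countable and each of its points has [mu]-mass 0. This is
    what makes the diagonal of D x D negligible for the product measure. *)
Lemma no_common_atoms (R : realType) (mu nu : {measure set R -> \bar R}) (D : set R) :
  measurable D -> (nu D < +oo)%E ->
  (forall x, D x -> (mu [set x] * nu [set x] = 0)%E) ->
  exists N, [/\ measurable N, mu N = 0%E & forall x, D x -> ~ N x -> nu [set x] = 0%E].
Proof.
move=> mD nuD mn.
have cN := @atoms_countable _ nu D mD nuD.
exists [set x | D x /\ nu [set x] <> 0%E]; split.
- exact: countable_measurable.
(* The fibres of an injection into the integers cover N by countably many sets with at most one
   point. *)
- move/countable_injP : (cN) => [f inj_f].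
  apply/negligibleP; first exact: countable_measurable.
  apply: (@negligibleS _ _ _ mu
    (\bigcup_k [set x | (D x /\ nu [set x] <> 0%E) /\ f x = k])).
    by move=> x Dx; exists (f x).
  apply: negligible_bigcup => k.
  have [[x0 [[Dx0 nx0] fx0]]|nex] :=
    pselect (exists x, (D x /\ nu [set x] <> 0%E) /\ f x = k); last first.
    apply: (@negligibleS _ _ _ mu set0); last exact: negligible_set0.
    by move=> x xk; apply: nex; exists x.
  apply: (@negligibleS _ _ _ mu [set x0]).
    by move=> x /= [Dx fx]; apply: inj_f; [exact/mem_set|exact/mem_set|rewrite fx fx0].
  apply/negligibleP => //.
  by have /eqP := mn _ Dx0; rewrite mule_eq0 => /orP[/eqP//|/eqP].
- by move=> x Dx; apply: contra_notP => n0.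
Qed.

(** * Fubini's theorem for products p(x) q(y) over a measurable set *)

Section tensor.
Context d1 d2 (T1 : measurableType d1) (T2 : measurableType d2) (R : realType).
Variables (m1 : {sigma_finite_measure set T1 -> \bar R}).
Variables (m2 : {sigma_finite_measure set T2 -> \bar R}).
Variables (p : T1 -> R) (q : T2 -> R).
Hypothesis ip : m1.-integrable setT (EFin \o p).
Hypothesis iq : m2.-integrable setT (EFin \o q).

Let ptens (z : T1 * T2) : \bar R := (p z.1 * q z.2)%:E.

Let mptens : measurable_fun setT ptens.
Proof.
apply/measurable_EFinP; apply: measurable_funM.
- by apply: measurableT_comp => //; exact/measurable_EFinP/(measurable_int m1).
- by apply: measurableT_comp => //; exact/measurable_EFinP/(measurable_int m2).
Qed.

Lemma integrable_tensor : (m1 \x m2)%E.-integrable setT ptens.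
Proof.
apply: (integrable12ltyP _ _ mptens).2.
have jq : (\int[m2]_y `|q y|%:E)%E \is a fin_num.
  by apply: integrable_fin_num => //; exact: integrable_norm.
have -> : (fun x => \int[m2]_y `|ptens (x, y)|)%E =
  (fun x => (fine (\int[m2]_y `|q y|%:E)%E)%:E * `|p x|%:E)%E.
  apply/funext => x; under eq_integral => y _ do rewrite /ptens /= normrM EFinM.
  rewrite integralZl//; last exact: integrable_norm.
  by rewrite fineK// muleC.
apply: integrable_lty => //; apply: integrableZl => //.
exact: integrable_norm.
Qed.

Let integrable_on A : measurable A ->
  (m1 \x m2)%E.-integrable setT (ptens \_ A).
Proof.
move=> mA; apply: (integrable_mkcond _ mA).1.
exact: (integrableS measurableT mA (@subsetT _ A) integrable_tensor).
Qed.

Let tensor_F A x : measurable A -> (fubini_F m2 (ptens \_ A) x =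
  (p x)%:E * \int[m2]_(y in xsection A x) (q y)%:E)%E.
Proof.
move=> mA; rewrite /fubini_F -integralZl//; last 2 first.
- exact: measurable_xsection.
- by apply: integrableS iq => //; exact: measurable_xsection.
rewrite [RHS]integral_mkcond; apply: eq_integral => y _.
by rewrite !patchE mem_xsection.
Qed.

Let tensor_G A y : measurable A -> (fubini_G m1 (ptens \_ A) y =
  (q y)%:E * \int[m1]_(x in ysection A y) (p x)%:E)%E.
Proof.
move=> mA; rewrite /fubini_G -integralZl//; last 2 first.
- exact: measurable_ysection.
- by apply: integrableS ip => //; exact: measurable_ysection.
rewrite [RHS]integral_mkcond; apply: eq_integral => x _.
by rewrite !patchE mem_ysection /ptens EFinM muleC.
Qed.

Lemma tensor_integral1 A : measurable A ->
  (\int[(m1 \x m2)%E]_(z in A) (p z.1 * q z.2)%:E =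
   \int[m1]_x ((p x)%:E * \int[m2]_(y in xsection A x) (q y)%:E))%E.
Proof.
move=> mA; rewrite integral_mkcond -integral12_prod_meas1; last exact: integrable_on.
by apply: eq_integral => x _; exact: tensor_F.
Qed.

Lemma tensor_integral2 A : measurable A ->
  (\int[(m1 \x m2)%E]_(z in A) (p z.1 * q z.2)%:E =
   \int[m2]_y ((q y)%:E * \int[m1]_(x in ysection A y) (p x)%:E))%E.
Proof.
move=> mA; rewrite integral_mkcond -integral21_prod_meas1; last exact: integrable_on.
by apply: eq_integral => y _; exact: tensor_G.
Qed.

Lemma tensor_integrable1 A : measurable A ->
  m1.-integrable setT (fun x => (p x)%:E * \int[m2]_(y in xsection A x) (q y)%:E)%E.
Proof.
move=> mA; apply: eq_integrable (integrable_fubini_F (integrable_on mA)) => //.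
by move=> x _; exact: tensor_F.
Qed.

End tensor.

(** * Integration by parts for two measures *)

Section integration_by_parts.
Variables (R : realType) (mu nu : {measure set R -> \bar R}) (c d : R).
Variables (p q : R -> R).
Local Notation D := (`[c, d[ : set R).
Hypothesis muD : (mu D < +oo)%E.
Hypothesis nuD : (nu D < +oo)%E.
Hypothesis ip : mu.-integrable D (EFin \o p).
Hypothesis iq : nu.-integrable D (EFin \o q).
Hypothesis mn : forall x, D x -> (mu [set x] * nu [set x] = 0)%E.

Let mD : measurable D. Proof. exact: measurable_itv. Qed.
(** Fubini asks for sigma-finite measures, which [mu] and [nu] need not be on the whole line; their
    restrictions to D are finite, and p, q are extended by 0. *)
Let m1 : {finite_measure set R -> \bar R} := mfrestr mD muD.
Let m2 : {finite_measure set R -> \bar R} := mfrestr mD nuD.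
Let p' := p \_ D.
Let q' := q \_ D.

Let m1E (A : set R) (f : R -> \bar R) : A `<=` D ->
  (\int[m1]_(x in A) f x = \int[mu]_(x in A) f x)%E.
Proof.
move=> AD; apply: eq_measure_integral => B mB BA /=.
by rewrite /mfrestr /mrestr setIidl//; apply: subset_trans AD.
Qed.

Let m2E (A : set R) (f : R -> \bar R) : A `<=` D ->
  (\int[m2]_(x in A) f x = \int[nu]_(x in A) f x)%E.
Proof.
move=> AD; apply: eq_measure_integral => B mB BA /=.
by rewrite /mfrestr /mrestr setIidl//; apply: subset_trans AD.
Qed.

Let ip' : m1.-integrable setT (EFin \o p').
Proof.
rewrite /p' -restrict_EFin; apply: (integrable_mkcond _ mD).1.
move/integrableP : ip => [mp fp]; apply/integrableP; split => //.
by rewrite m1E.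
Qed.

Let iq' : m2.-integrable setT (EFin \o q').
Proof.
rewrite /q' -restrict_EFin; apply: (integrable_mkcond _ mD).1.
move/integrableP : iq => [mp fp]; apply/integrableP; split => //.
by rewrite m2E.
Qed.

Let p'E (A : set R) : (\int[m1]_(x in A) (p' x)%:E =
  \int[mu]_(x in A `&` D) (p x)%:E)%E.
Proof.
rewrite -[RHS]m1E; last by move=> x [].
rewrite [RHS]integral_mkcondr; apply: eq_integral => x _.
by rewrite /p' !patchE; case: ifP.
Qed.

Let q'E (A : set R) : (\int[m2]_(x in A) (q' x)%:E =
  \int[nu]_(x in A `&` D) (q x)%:E)%E.
Proof.
rewrite -[RHS]m2E; last by move=> x [].
rewrite [RHS]integral_mkcondr; apply: eq_integral => x _.
by rewrite /q' !patchE; case: ifP.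
Qed.

Let J A : \bar R := (\int[(m1 \x m2)%E]_(z in A) (p' z.1 * q' z.2)%:E)%E.
Let Lt := [set z : R * R | z.1 < z.2].
Let Gt := [set z : R * R | z.2 < z.1].
Let Eq := [set z : R * R | z.1 = z.2].

Let mLt : measurable Lt.
Proof.
have := @measurable_fun_ltr _ (R * R)%type R setT fst snd measurable_fst measurable_snd.
move=> /(_ measurableT [set true] I); rewrite setTI.
by congr measurable; apply/seteqP; split => [z /= ->//|z /=].
Qed.

Let mGt : measurable Gt.
Proof.
have := @measurable_fun_ltr _ (R * R)%type R setT snd fst measurable_snd measurable_fst.
move=> /(_ measurableT [set true] I); rewrite setTI.
by congr measurable; apply/seteqP; split => [z /= ->//|z /=].
Qed.

Let mEq : measurable Eq.
Proof.
have -> : Eq = ~` (Lt `|` Gt).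
  apply/seteqP; split=> [z|z /= zz].
    by rewrite /Eq /Lt /Gt /= => e; rewrite e ltxx; case.
  case: (ltgtP z.1 z.2) => // h; exfalso; apply: zz; by [left|right].
by apply: measurableC; exact: measurableU.
Qed.

Let intJ A : measurable A ->
  (m1 \x m2)%E.-integrable A (fun z => (p' z.1 * q' z.2)%:E).
Proof.
move=> mA; exact: (integrableS measurableT mA (@subsetT _ A) (integrable_tensor ip' iq')).
Qed.

Let JT : (J setT = J Lt + (J Gt + J Eq))%E.
Proof.
have -> : [set: R * R] = Lt `|` (Gt `|` Eq).
  apply/seteqP; split=> // z _; rewrite /Lt /Gt /Eq /=.
  by case: (ltgtP z.1 z.2); [left|right;left|right;right].
have mGE := measurableU _ _ mGt mEq.
have mLGE := measurableU _ _ mLt mGE.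
rewrite /J !integral_setU//.
- exact: (measurable_int _ (intJ mGE)).
- by apply/disj_setPS => z []; rewrite /Gt /Eq /= => h e; move: h; rewrite e ltxx.
- exact: (measurable_int _ (intJ mLGE)).
- apply/disj_setPS => z []; rewrite /Lt /Gt /Eq /= => h [|e]; last by move: h; rewrite e ltxx.
  by move=> /(lt_trans h); rewrite ltxx.
Qed.

(** The section of the diagonal at x is the point x, which is [nu]-null unless x lies in the
    [mu]-null set of [nu]-atoms. *)
Let JEq : J Eq = 0%E.
Proof.
have [N [mN muN Nq]] := no_common_atoms mD nuD mn.
have m1N : m1 N = 0%E.
  apply/eqP; rewrite -measure_le0 /= /mfrestr /mrestr -muN.
  by apply: le_measure; [apply/mem_set/measurableI|exact/mem_set|move=> ? []].
apply: null_set_integral => //.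
  exact: (measurable_int _ (intJ mEq)).
rewrite /= /product_measure1.
rewrite (ae_eq_integral (cst 0%E))//; first exact: integral0.
  exact: measurable_fun_xsection.
exists N; split => //= x /= h; apply: contrapT => Nx; apply: h => _.
have -> : xsection Eq x = [set x].
  by apply/seteqP; split => y; [move/xsectionP; rewrite /Eq /= => ->|move=> ->; apply/xsectionP].
rewrite /mfrestr /mrestr.
have [Dx|Dx] := pselect (D x).
  apply: subset_measure0 (Nq _ Dx Nx) => //; first exact: measurableI.
suff -> : [set x] `&` D = set0 by rewrite measure0.
by apply/seteqP; split => y //= [-> ].
Qed.

Let JT_E : J setT = ((\int[mu]_(x in D) p x) * (\int[nu]_(y in D) q y))%:E.
Proof.
have fp : (\int[mu]_(x in D) (p x)%:E)%E \is a fin_num.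
  exact: integrable_fin_num.
have fq : (\int[nu]_(x in D) (q x)%:E)%E \is a fin_num.
  exact: integrable_fin_num.
rewrite /J tensor_integral1//.
rewrite (eq_integral (fun x => (\int[nu]_(y in D) q y)%:E * (p' x)%:E)%E); last first.
  move=> x _; rewrite muleC; congr (_ * _)%E.
  by rewrite q'E xsectionE preimage_setT setTI fineK.
rewrite integralZl// (p'E setT) setTI EFinM muleC /Rintegral.
by congr (_ * _)%E; rewrite fineK.
Qed.

Let JLt_E : J Lt = (\int[nu]_(y in D) ((\int[mu]_(x in `[c, y[) p x) * q y))%:E.
Proof.
rewrite /J tensor_integral2//.
pose G : R -> \bar R := ((EFin \o (fun y => (\int[mu]_(x in `[c, y[) p x) * q y)) \_ D).
have E y : y \in [set: R] -> (((q' y)%:E * \int[m1]_(x in ysection Lt y) (p' x)%:E)%E =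
   G y).
  move=> _; rewrite /G patchE /q' patchE; case: ifPn => [|_]; last by rewrite mul0e.
  move/set_mem; rewrite /= in_itv /= => /andP[cy yd]; rewrite p'E.
  have -> : ysection Lt y `&` D = `[c, y[.
    apply/seteqP; split => x; rewrite /= !in_itv /=.
      by move=> [/ysectionP xy /andP[-> _]].
    move=> /andP[cx xy]; split; first exact/ysectionP.
    by rewrite cx (lt_trans xy).
  rewrite muleC EFinM /Rintegral fineK//; apply: integrable_fin_num => //.
  apply: integrableS ip => //; apply: subset_itvl.
  by rewrite bnd_simp ltW.
have iG : m2.-integrable setT G.
  rewrite (_ : G = (fun y => (q' y)%:E * \int[m1]_(x in xsection Gt y) (p' x)%:E)%E).
    exact: tensor_integrable1.
  apply/funext => y; rewrite -E; last exact: mem_setT.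
  congr (_ * integral _ _ _)%E.
rewrite (eq_integral _ _ E) -integral_mkcond m2E// /Rintegral fineK//.
rewrite -m2E// integral_mkcond; exact: integrable_fin_num.
Qed.

Let JGt_E : J Gt = (\int[mu]_(y in D) ((\int[nu]_(x in `[c, y[) q x) * p y))%:E.
Proof.
rewrite /J tensor_integral1//.
pose G : R -> \bar R := ((EFin \o (fun y => (\int[nu]_(x in `[c, y[) q x) * p y)) \_ D).
have E y : y \in [set: R] -> (((p' y)%:E * \int[m2]_(x in xsection Gt y) (q' x)%:E)%E =
   G y).
  move=> _; rewrite /G patchE /p' patchE; case: ifPn => [|_]; last by rewrite mul0e.
  move/set_mem; rewrite /= in_itv /= => /andP[cy yd]; rewrite q'E.
  have -> : xsection Gt y `&` D = `[c, y[.
    apply/seteqP; split => x; rewrite /= !in_itv /=.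
      by move=> [/xsectionP xy /andP[-> _]].
    move=> /andP[cx xy]; split; first exact/xsectionP.
    by rewrite cx (lt_trans xy).
  rewrite muleC EFinM /Rintegral fineK//; apply: integrable_fin_num => //.
  apply: integrableS iq => //; apply: subset_itvl.
  by rewrite bnd_simp ltW.
have iG : m1.-integrable setT G.
  rewrite (_ : G = (fun x => (p' x)%:E * \int[m2]_(y in xsection Gt x) (q' y)%:E)%E).
    exact: tensor_integrable1.
  by apply/funext => y; rewrite -E//; exact: mem_setT.
rewrite (eq_integral _ _ E) -integral_mkcond m1E// /Rintegral fineK//.
rewrite -m1E// integral_mkcond; exact: integrable_fin_num.
Qed.

(* Fubini over the square [c, d[ ^ 2, whose diagonal is negligible for lack of common atoms. *)
Lemma integration_by_parts : (\int[mu]_(x in D) p x) * (\int[nu]_(y in D) q y) =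
  \int[nu]_(y in D) ((\int[mu]_(x in `[c, y[) p x) * q y) +
  \int[mu]_(x in D) ((\int[nu]_(y in `[c, x[) q y) * p x).
Proof.
by have := JT; rewrite JT_E JLt_E JGt_E JEq adde0 -EFinD => -[].
Qed.
End integration_by_parts.

(** * Square integrable functions *)

Section L2.
Context d (T : measurableType d) (R : realType) (mu : {measure set T -> \bar R}).
Implicit Types (D : set T) (f g : T -> R).

Definition intg D f := mu.-integrable D (EFin \o f).

Lemma intgD D f g : measurable D -> intg D f -> intg D g -> intg D (fun x => f x + g x).
Proof. by move=> mD fi gi; exact: (integrableD mD fi gi). Qed.

Lemma intgZ D k f : measurable D -> intg D f -> intg D (fun x => k * f x).
Proof. by move=> mD fi; exact: (integrableZl mD k fi). Qed.

Lemma intgB D f g : measurable D -> intg D f -> intg D g -> intg D (fun x => f x - g x).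
Proof. by move=> mD fi gi; exact: (integrableB mD fi gi). Qed.

Lemma intgS D E f : measurable D -> measurable E -> E `<=` D -> intg D f -> intg E f.
Proof. by move=> mD mE ED; exact: integrableS. Qed.

Lemma intg_meas D f : intg D f -> measurable_fun D f.
Proof. by move/measurable_int/measurable_EFinP. Qed.

Lemma intg_le D f g : measurable D -> measurable_fun D f ->
  (forall x, D x -> `|f x| <= `|g x|) -> intg D g -> intg D f.
Proof.
move=> mD mf fg; apply: le_integrable => //; exact/measurable_EFinP.
Qed.

Lemma intg_eq D f g : measurable D -> (forall x, D x -> f x = g x) -> intg D f -> intg D g.
Proof.
move=> mD fg; apply: eq_integrable => // x /set_mem Dx /=.
by rewrite fg.
Qed.

Lemma eq_Rint D f g : (forall x, D x -> f x = g x) ->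
  \int[mu]_(x in D) f x = \int[mu]_(x in D) g x.
Proof. by move=> fg; apply: eq_Rintegral => x /set_mem; exact: fg. Qed.

Lemma Rint_ae_eq D f g : measurable D -> measurable_fun D f -> measurable_fun D g ->
  {ae mu, forall x, D x -> f x = g x} ->
  \int[mu]_(x in D) f x = \int[mu]_(x in D) g x.
Proof.
move=> mD mf mg fg; congr fine; apply: ae_eq_integral => //; try exact/measurable_EFinP.
by apply: filterS fg => x h Dx /=; rewrite h.
Qed.

Lemma intg_ae_eq D f g : measurable D -> measurable_fun D g ->
  {ae mu, forall x, D x -> f x = g x} -> intg D f -> intg D g.
Proof.
move=> mD mg fg /integrableP[mf fi]; apply/integrableP; split.
  exact/measurable_EFinP.
apply: le_lt_trans fi; rewrite le_eqVlt; apply/orP; left; apply/eqP.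
apply: ae_eq_integral => //.
- by apply: measurableT_comp => //; exact/measurable_EFinP.
- exact: measurableT_comp.
- by apply: filterS fg => x h Dx /=; rewrite h.
Qed.

Lemma intg_fin D f : measurable D -> (forall x, D x -> 0 <= f x) -> measurable_fun D f ->
  (\int[mu]_(x in D) (f x)%:E < +oo)%E -> intg D f.
Proof.
move=> mD f0 mf fi; apply/integrableP; split; first exact/measurable_EFinP.
apply: le_lt_trans fi; rewrite le_eqVlt; apply/orP; left; apply/eqP.
by apply: eq_integral => x /set_mem Dx /=; rewrite ger0_norm// f0.
Qed.

Lemma EFin_Rint D f : measurable D -> intg D f ->
  (\int[mu]_(x in D) f x)%:E = (\int[mu]_(x in D) (f x)%:E)%E.
Proof. by move=> mD fi; rewrite /Rintegral fineK//; exact: integrable_fin_num. Qed.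

Lemma Rint0_setS D E f : measurable D -> measurable E -> E `<=` D -> intg D f ->
  (forall x, D x -> 0 <= f x) -> \int[mu]_(x in E) f x <= \int[mu]_(x in D) f x.
Proof.
move=> mD mE ED fi f0.
rewrite -lee_fin !EFin_Rint//; last exact: intgS fi.
apply: ge0_subset_integral => //; exact: (measurable_int mu).
Qed.

(** Functions, not classes: elements of H^1 are evaluated at points, and passing to another version
    of a derivative is made explicit by [L2_ae]. *)
Definition L2 D f := measurable_fun D f /\ intg D (fun x => f x ^+ 2).

Lemma L2_prod D f g : measurable D -> L2 D f -> L2 D g -> intg D (fun x => f x * g x).
Proof.
move=> mD [mf fi] [mg gi].
apply: (@intg_le _ _ (fun x => f x ^+ 2 + g x ^+ 2)) => //.
- exact: measurable_funM.
- move=> x Dx; rewrite [leRHS]ger0_norm ?addr_ge0 ?sqr_ge0//.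
  rewrite ler_norml; apply/andP; split; nra.
- exact: intgD.
Qed.

Lemma L2D D f g : measurable D -> L2 D f -> L2 D g -> L2 D (fun x => f x + g x).
Proof.
move=> mD [mf fi] [mg gi]; have mfg : measurable_fun D (fun x => f x + g x).
  exact: measurable_funD.
split => //.
apply: (@intg_le _ _ (fun x => 2 * (f x ^+ 2 + g x ^+ 2))) => //.
- exact: measurable_funX.
- move=> x Dx; rewrite ger0_norm ?sqr_ge0// ger0_norm ?mulr_ge0 ?addr_ge0 ?sqr_ge0//.
  by have := sqr_ge0 (f x - g x); nra.
- by apply: intgZ => //; exact: intgD.
Qed.

Lemma L2Z D k f : measurable D -> L2 D f -> L2 D (fun x => k * f x).
Proof.
move=> mD [mf fi]; split; first exact: measurable_funM.
apply: (@intg_eq _ (fun x => k ^+2 * f x ^+ 2)) => //.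
  by move=> x _; rewrite exprMn.
exact: intgZ.
Qed.

Lemma L2B D f g : measurable D -> L2 D f -> L2 D g -> L2 D (fun x => f x - g x).
Proof.
move=> mD fi gi; have -> : (fun x => f x - g x) = (fun x => f x + (-1) * g x).
  by apply/funext => x; rewrite mulN1r.
by apply: L2D => //; exact: L2Z.
Qed.

Lemma L2S D E f : measurable D -> measurable E -> E `<=` D -> L2 D f -> L2 E f.
Proof.
move=> mD mE ED [mf fi]; split; first exact: measurable_funS mf.
exact: intgS fi.
Qed.

Lemma L2_ae D f g : measurable D -> measurable_fun D g ->
  {ae mu, forall x, D x -> f x = g x} -> L2 D f -> L2 D g.
Proof.
move=> mD mg fg [mf fi]; split => //.
apply: intg_ae_eq fi => //; first exact: measurable_funX.
by apply: filterS fg => x h Dx /=; rewrite h.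
Qed.

Lemma L2_bounded D f (M : R) : measurable D -> (mu D < +oo)%E -> measurable_fun D f ->
  (forall x, D x -> `|f x| <= M) -> L2 D f.
Proof.
move=> mD muD mf fM; split => //.
apply: measurable_bounded_integrable => //; first exact: measurable_funX.
exists (M ^+ 2); split; first exact: num_real.
move=> y yM x Dx /=; rewrite normrX (le_trans _ (ltW yM))//.
by rewrite lerXn2r ?nnegrE// (le_trans _ (fM _ Dx)).
Qed.

Lemma L2_intg D f : measurable D -> (mu D < +oo)%E -> L2 D f -> intg D f.
Proof.
move=> mD muD fi; have f1 : L2 D (cst 1) by apply: (@L2_bounded _ _ 1) => // x _; rewrite normr1.
by apply: intg_eq (L2_prod mD fi f1) => // x _ /=; rewrite mulr1.
Qed.

Lemma L2_sqr_ge0 D f : 0 <= \int[mu]_(x in D) (f x ^+ 2).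
Proof. by apply: Rintegral_ge0 => x _; exact: sqr_ge0. Qed.

Lemma L2_quadratic D f g (t : R) : measurable D -> L2 D f -> L2 D g ->
  \int[mu]_(x in D) ((f x + t * g x) ^+ 2) =
  \int[mu]_(x in D) (f x ^+ 2) + 2 * t * \int[mu]_(x in D) (f x * g x) +
  t ^+ 2 * \int[mu]_(x in D) (g x ^+ 2).
Proof.
move=> mD fi gi; have fg := L2_prod mD fi gi.
rewrite -!RintegralZl//; last by case: gi.
rewrite -!RintegralD//; last 4 first.
- by apply: intgD => //; [case: fi|exact: intgZ].
- by apply: intgZ => //; case: gi.
- by case: fi.
- exact: intgZ.
by apply: eq_Rint => x _; ring.
Qed.

End L2.

(** The minimum is attained at t = -B/C. The lemma yields both Cauchy-Schwarz inequalities, and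
    later the fact that a near-minimiser is nearly critical. *)
Lemma quadratic_discr (R : realFieldType) (A B C : R) : 0 <= A -> 0 <= C ->
  (forall t : R, 0 <= A + 2 * t * B + t ^+ 2 * C) -> B ^+ 2 <= A * C.
Proof.
move=> A0 C0 h; have [C1|C1] := eqVneq C 0.
  subst C; have [->|B0] := eqVneq B 0; first by rewrite expr0n mulr0.
  (* For C = 0 the polynomial is affine, and this t gives it the value -1. *)
  have := h (- (A + 1) / (2 * B)).
  have -> : A + 2 * (- (A + 1) / (2 * B)) * B + (- (A + 1) / (2 * B)) ^+ 2 * 0 = - 1.
    by field.
  by rewrite ler0N1.
have := h (- B / C).
have -> : A + 2 * (- B / C) * B + (- B / C) ^+ 2 * C = (A * C - B ^+ 2) / C by field.
by rewrite pmulr_lge0 ?invr_gt0 ?lt_def ?C1// subr_ge0.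
Qed.

Lemma cauchy_schwarz d (T : measurableType d) (R : realType) (mu : {measure set T -> \bar R})
  (D : set T) (f g : T -> R) : measurable D -> L2 mu D f -> L2 mu D g ->
  (\int[mu]_(x in D) (f x * g x)) ^+ 2 <=
  \int[mu]_(x in D) (f x ^+ 2) * \int[mu]_(x in D) (g x ^+ 2).
Proof.
move=> mD fi gi; apply: quadratic_discr; try exact: L2_sqr_ge0.
by move=> t; rewrite -L2_quadratic//; exact: L2_sqr_ge0.
Qed.

(** The increments are at most sqrt(K) 2^-n, so the telescoping series converges absolutely. *)
Lemma fast_cvg (R : realType) (u : nat -> R) (K : R) : 0 <= K ->
  (forall n, 4 ^+ n * (u n.+1 - u n) ^+ 2 <= K) -> cvgn u.
Proof.
move=> K0 SK.
have dK n : `|u n.+1 - u n| <= Num.sqrt K * 2^-1 ^+ n.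
  rewrite -[leRHS]ger0_norm ?mulr_ge0 ?sqrtr_ge0 ?exprn_ge0// -ler_sqr ?nnegrE//.
  rewrite -!normrX exprMn sqr_sqrtr// ger0_norm ?sqr_ge0// ger0_norm ?mulr_ge0 ?exprn_ge0//.
  rewrite -exprM mulnC exprM (_ : 2^-1 ^+ 2 = 4^-1); last by field.
  by rewrite exprVn ler_pdivlMr ?exprn_gt0// mulrC.
have : cvgn (series (telescope u)).
  apply: normed_cvg.
  apply: (@series_le_cvg _ _ (geometric (Num.sqrt K) 2^-1)) => //.
  - by move=> n /=; exact: normr_ge0.
  - by move=> n /=; rewrite mulr_ge0 ?sqrtr_ge0 ?exprn_ge0.
  - apply: is_cvg_geometric_series.
    by rewrite ger0_norm ?invf_lt1 ?invr_ge0// ltr1n.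
rewrite telescopeK => c.
have -> : u = (fun k => (u k - u 0%N) + u 0%N).
  by apply/funext => k; rewrite subrK.
by apply: is_cvgD => //; exact: is_cvg_cst.
Qed.

(** * Completeness of L^2 along rapidly Cauchy sequences *)

Section riesz_fischer.
Context d (T : measurableType d) (R : realType) (mu : {measure set T -> \bar R}).
Variables (D : set T) (v : nat -> T -> R).
Hypothesis mD : measurable D.
Hypothesis v2 : forall n, L2 mu D (v n).

(** Fatou's lemma carries the uniform bound on v m - v n over to the almost everywhere limit in m;
    finiteness of the integral then gives membership in L^2. *)
Lemma fatou_L2 (w : T -> R) (e : R) (n : nat) : measurable_fun D w ->
  {ae mu, forall x, D x -> v k x @[k --> \oo] --> w x} ->
  (forall m, (n <= m)%N -> \int[mu]_(x in D) ((v m x - v n x) ^+ 2) <= e) ->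
  L2 mu D (fun x => w x - v n x) /\ \int[mu]_(x in D) ((w x - v n x) ^+ 2) <= e.
Proof.
move=> mw vw ve.
have mvn k : measurable_fun D (v k) by have [] := v2 k.
have mwn : measurable_fun D (fun x => w x - v n x) by exact: measurable_funB.
(* The shift by n makes the bound available for every index k. *)
pose F k x : \bar R := ((v (k + n)%N x - v n x) ^+ 2)%:E.
have mF k : measurable_fun D (F k).
  by apply/measurable_EFinP/measurable_funX; exact: measurable_funB.
have key : (\int[mu]_(x in D) ((w x - v n x) ^+ 2)%:E <= e%:E)%E.
  apply: (@le_trans _ _ (\int[mu]_(x in D) limn_einf (F ^~ x))%E).
    rewrite le_eqVlt; apply/orP; left; apply/eqP; apply: ae_eq_integral => //.
    - exact/measurable_EFinP/measurable_funX.
    - apply: (@emeasurable_fun_cvg _ _ _ _ (fun n x => einfs (F ^~ x) n)).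
      + exact: measurable_fun_einfs.
      + by move=> x _; rewrite limn_einf_lim; exact: is_cvg_einfs.
    - apply: filterS vw => x /= h Dx.
      rewrite (@cvg_limn_einf_sup _ (F ^~ x) ((w x - v n x) ^+ 2)%:E _).1//.
      apply: cvg_EFin; first exact: nearW.
      apply: (@cvg_comp _ _ _ (fun k => v (k + n)%N x) (fun r => (r - v n x) ^+ 2) _ (nbhs (w x))).
        have := h Dx; rewrite -(cvg_shiftn n); exact.
      apply: (@continuous_comp _ _ _ (fun r => r - v n x) (fun r => r ^+ 2)).
        by apply: cvgB; [exact: cvg_id|exact: cvg_cst].
      exact: exprn_continuous.
  apply: le_trans (fatou mu mD mF _) _; first by move=> k x _; rewrite lee_fin sqr_ge0.
  apply: le_trans (limn_einf_sup _) _.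
  rewrite limn_esup_lim; apply: lime_le; first exact: is_cvg_esups.
  apply: nearW => k; apply: ub_ereal_sup => _ [m /= km <-].
  rewrite -EFin_Rint//; last by case: (L2B mD (v2 (m + n)) (v2 n)).
  by rewrite lee_fin ve// leq_addl.
have wi : intg mu D (fun x => (w x - v n x) ^+ 2).
  apply: intg_fin => //; first by move=> x _; exact: sqr_ge0.
    exact: measurable_funX.
  exact: le_lt_trans key (ltry _).
by split=> //; rewrite -lee_fin EFin_Rint.
Qed.

Hypothesis vc : forall n, \int[mu]_(x in D) ((v n.+1 x - v n x) ^+ 2) <= 8^-1 ^+ n.

(** The weights 4^n reduce the bounds 8^-n to the summable 2^-n, so the weighted series of squared
    increments has a finite integral. At almost every x its sum K is finite and bounds each term, as
    [fast_cvg] requires. *)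
Lemma fast_cauchy_ae_cvg :
  {ae mu, forall x, D x -> cvgn (fun k => v k x)}.
Proof.
pose S n x : \bar R := (4 ^+ n * (v n.+1 x - v n x) ^+ 2)%:E.
have dv2 n := L2B mD (v2 n.+1) (v2 n).
have mS n : measurable_fun D (S n).
  apply/measurable_EFinP; apply: measurable_funM => //.
  by apply: measurable_funX; case: (dv2 n).
have S0 n x : (0 <= S n x)%E by rewrite lee_fin mulr_ge0 ?sqr_ge0 ?exprn_ge0.
have iS : mu.-integrable D (fun x => \sum_(n <oo) S n x)%E.
  apply/integrableP; split.
    by apply: ge0_emeasurable_sum => // n x _ _.
  under eq_integral => x _ do rewrite gee0_abs ?nneseries_ge0//.
  rewrite integral_nneseries//.
  apply: (@le_lt_trans _ _ (\sum_(n <oo) (2^-1 ^+ n)%:E)%E).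
    apply: lee_nneseries => [n _ _|n _]; first exact: integral_ge0.
    rewrite /S -EFin_Rint//; last by apply: intgZ => //; case: (dv2 n).
    rewrite lee_fin RintegralZl//; last by case: (dv2 n).
    apply: (@le_trans _ _ (4 ^+ n * 8^-1 ^+ n)).
      by apply: ler_wpM2l; [exact: exprn_ge0|exact: vc].
    by rewrite -exprMn (_ : 4 * 8^-1 = 2^-1)//; field.
  apply: (@le_lt_trans _ _ 2%:E); last exact: ltry.
  apply: lime_le; first by apply: is_cvg_nneseries => n _ _; rewrite lee_fin exprn_ge0.
  apply: nearW => n; rewrite sumEFin lee_fin.
  suff -> : \sum_(0 <= i < n) 2^-1 ^+ i = 2 - 2 * 2^-1 ^+ n :> R.
    by rewrite gerBl mulr_ge0// exprn_ge0.
  elim: n => [|n IH]; first by rewrite big_geq// expr0; ring.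
  by rewrite big_nat_recr//= IH exprS; field.
have := integrable_ae mD iS; apply: filterS => x h Dx.
have {}h := h Dx.
pose K := fine (\sum_(n <oo) S n x)%E.
have SK n : 4 ^+ n * (v n.+1 x - v n x) ^+ 2 <= K.
  rewrite -lee_fin /K fineK// -[leLHS]/(S n x).
  apply: le_trans (nneseries_lim_ge n.+1 _); last by [].
  by rewrite big_nat_recr//= leeDr// sume_ge0.
have K0 : 0 <= K by rewrite /K fine_ge0// nneseries_ge0.
exact: (fast_cvg K0 SK).
Qed.

Lemma riesz_fischer_ae : exists2 w : T -> R, measurable_fun D w &
  {ae mu, forall x, D x -> v k x @[k --> \oo] --> w x}.
Proof.
(* An upper limit in the extended reals is measurable and defined everywhere; it equals the limit
   wherever that exists. *)
pose W x := limn_esup (fun k => (v k x)%:E).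
exists (fun x => fine (W x)).
  apply: measurableT_comp => //.
  by apply: measurable_fun_limn_esup => n; apply/measurable_EFinP; case: (v2 n).
apply: filterS fast_cauchy_ae_cvg => x h Dx.
have /cvg_ex[l vl] := h Dx.
have e : (v k x)%:E @[k --> \oo] --> l%:E by apply: cvg_EFin => //; exact: nearW.
by rewrite /W (cvg_limn_einf_sup e).2.
Qed.
End riesz_fischer.

(** Dominated convergence with majorant |h|: every point of D eventually leaves [A n], so the
    restrictions of |h| to [A n] tend to 0 pointwise. *)
Lemma vanishing_tail d (T : measurableType d) (R : realType) (mu : {measure set T -> \bar R})
  (D : set T) (h : T -> R) (A : nat -> set T) (e : R) : measurable D -> intg mu D h ->
  (forall n, measurable (A n)) -> (forall n, A n `<=` D) ->
  (forall x, D x -> exists N, forall n, (N <= n)%N -> ~ A n x) -> 0 < e ->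
  exists n, \int[mu]_(x in A n) `|h x| <= e.
Proof.
move=> mD hi mA AD Ax e0.
pose f n x : \bar R := ((EFin \o (fun x => `|h x|)) \_ (A n)) x.
have ih : mu.-integrable D (EFin \o (fun x => `|h x|)) by exact: integrable_norm.
have mf n : measurable_fun D (f n).
  apply/(measurable_restrict _ (mA n) mD) => //.
  by apply: measurable_funS (measurable_int _ ih) => //; move=> x [].
have cf : {ae mu, forall x, D x -> f n x @[n --> \oo] --> (cst 0%E x : \bar R)}.
  apply: aeW => x Dx; have [N AN] := Ax _ Dx.
  apply: cvg_near_cst; exists N => // n /= Nn.
  by rewrite /f patchE memNset//; exact: AN.
have bf : {ae mu, forall x n, D x -> (`|f n x| <= (`|h x|%R)%:E)%E}.
  apply: aeW => x n Dx; rewrite /f patchE; case: ifP => _; rewrite ?abse0 ?lee_fin//=.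
  by rewrite normr_id.
have [_ _] := dominated_convergence mD mf (measurable_cst _) cf ih bf.
rewrite integral0 => /fine_cvgP [_ /cvgrPdist_le /(_ _ e0) [N _ /(_ N (leqnn N))]] /=.
rewrite sub0r normrN /f -integral_mkcondr (setIidr (AD N)).
move=> H; exists N; apply: le_trans H.
exact: ler_norm.
Qed.

(** * Primitives with respect to a measure *)

Section primitive.
Variables (R : realType) (mu : {measure set R -> \bar R}) (c d : R) (h : R -> R).
Local Notation D := (`[c, d[ : set R).
Hypothesis muD : (mu D < +oo)%E.
Hypothesis ih : intg mu D h.

Lemma measurable_primitive :
  measurable_fun setT (fun x : R => \int[mu]_(y in (`]-oo, x[ : set R) `&` D) h y).
Proof.
have mD : measurable D by exact: measurable_itv.
pose m2 : {finite_measure set R -> \bar R} := mfrestr mD muD.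
(* Fubini gives measurability in x of an integral over the sections of a half-plane. The measure in
   x does not affect this conclusion, so a Dirac mass serves. *)
pose m1 : {finite_measure set R -> \bar R} := \d_(0 : R).
pose Gt := [set z : R * R | z.2 < z.1].
have mGt : measurable Gt.
  have := @measurable_fun_ltr _ (R * R)%type R setT snd fst measurable_snd measurable_fst.
  move=> /(_ measurableT [set true] I); rewrite setTI.
  by congr measurable; apply/seteqP; split => [z /= ->//|z /=].
have m2E (A : set R) (f : R -> \bar R) : A `<=` D ->
    (\int[m2]_(x in A) f x = \int[mu]_(x in A) f x)%E.
  move=> AD; apply: eq_measure_integral => B mB BA /=.
  by rewrite /mfrestr /mrestr setIidl//; apply: subset_trans AD.
have i1 : m1.-integrable setT (EFin \o cst (1 : R)).
  exact: finite_measure_integrable_cst.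
have i2 : m2.-integrable setT (EFin \o (h \_ D)).
  rewrite -restrict_EFin; apply: (integrable_mkcond _ mD).1.
  by move/integrableP : ih => [mp fp]; apply/integrableP; split => //; rewrite m2E.
have := measurable_int _ (tensor_integrable1 i1 i2 mGt).
move=> mF; apply/measurable_EFinP; apply: eq_measurable_fun mF => x _.
rewrite mul1e /= /Rintegral.
rewrite -(m2E (_ `&` D)); last by move=> y [].
rewrite [in RHS]integral_mkcondr.
have -> : xsection Gt x = `]-oo, x[.
  apply/seteqP; split=> y; rewrite /= in_itv /=; first by move/xsectionP.
  by move=> yx; apply/xsectionP.
rewrite fineK; last first.
  rewrite restrict_EFin; apply: integrable_fin_num => //.
  exact: integrableS i2.
by rewrite restrict_EFin.
Qed.
End primitive.

(** The sets on which h has integral 0 form a Dynkin system containing the open left half-lines,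
    which are stable under intersection and generate the Borel sets. A function whose integral
    vanishes on every Borel set is 0 almost everywhere. *)
Lemma primitive_unique (R : realType) (mu : {measure set R -> \bar R}) (c d : R) (h : R -> R) :
  intg mu `[c, d[ h ->
  (forall x, c <= x <= d -> \int[mu]_(y in `[c, x[) h y = 0) ->
  {ae mu, forall x, `[c, d[ x -> h x = 0}.
Proof.
move=> ih h0.
have [cd|dc] := leP c d; last first.
  apply: aeW => x; rewrite /= in_itv /= => /andP[cx xd].
  by move: dc; rewrite ltNge (ltW (le_lt_trans cx xd)).
pose D := (`[c, d[ : set R); have mD : measurable D by exact: measurable_itv.
have hD : \int[mu]_(y in D) h y = 0 by apply: h0; rewrite cd lexx.
pose P := [set A : set R | \int[mu]_(y in A `&` D) h y = 0].
have ihS A : measurable A -> intg mu (A `&` D) h.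
  by move=> mA; apply: intgS ih => //; exact: measurableI.
have HP A : measurable A -> P A.
  have mE : @measurable _ R = <<s RGenInftyO.G (R:=R) >> := @RGenInftyO.measurableE R.
  rewrite mE; move: A; apply: dynkin_induction.
  - exact: mE.
  - move=> _ _ [x ->] [y ->]; exists (Num.min x y).
    by apply/seteqP; split => z; rewrite /= !in_itv /= lt_min => /andP.
  - by rewrite /P /= setTI.
  - move=> _ [x ->]; rewrite /P /=.
    have [xc|cx] := leP x c.
      rewrite (_ : _ `&` _ = set0) ?Rintegral_set0//.
      apply/seteqP; split=> y //; rewrite /D /= !in_itv /= => -[yx /andP[cy _]].
      by have := lt_le_trans (le_lt_trans cy yx) xc; rewrite ltxx.
    have [xd|dx] := leP x d.
      rewrite (_ : _ `&` _ = `[c, x[) ?h0 ?(ltW cx)//.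
      apply/seteqP; split=> y; rewrite /D /= !in_itv /=; first by move=> [-> /andP[-> _]].
      move=> /andP[cy yx].
      by rewrite yx cy (lt_le_trans yx).
    rewrite (_ : _ `&` _ = D) ?hD//.
    apply/seteqP; split=> y; rewrite /D /= !in_itv /=; first by case.
    move=> /andP[cy yd].
    by rewrite cy yd (lt_trans yd).
  - move=> S mS; rewrite /P /= => PS.
    have := hD; rewrite -{1}(setTI D) -(setUv S) setIUl Rintegral_setU//; last first.
    + by apply/disj_setPS => y [[Sy _] [nSy _]].
    + by rewrite -setIUl setUv setTI.
    + by apply: measurableI => //; exact: measurableC.
    + exact: measurableI.
    by rewrite PS add0r.
  - move=> F mF tF PF; rewrite /P /= setI_bigcupl.
    have := @integral_bigcup _ _ R mu (fun n => F n `&` D) (EFin \o h) _ _ _.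
    rewrite /Rintegral => ->//; last 3 first.
    + by apply: trivIset_setIr.
    + by move=> k; exact: measurableI.
    + by rewrite -setI_bigcupl; apply: ihS; exact: bigcupT_measurable.
    rewrite eseries0// => n _ _.
    by rewrite -EFin_Rint ?PF//; [exact: measurableI|exact: ihS].
have := @integral_ae_eq _ _ _ mu D mD (cst 0%E) (EFin \o h) ih (measurable_cst _) _.
have H0 (S : set R) : S `<=` D -> measurable S ->
    (\int[mu]_(x in S) (EFin \o h) x = \int[mu]_(x in S) cst 0 x)%E.
  move=> SD mS; rewrite integral0 -(setIidl SD) -[LHS]EFin_Rint ?HP//.
    exact: measurableI.
  exact: ihS.
by move=> /(_ H0); apply: filterS => x /= h1 Dx; have := h1 Dx => -[].
Qed.

(** * Exhaustion of (a, b) and locally absolutely continuous functions *)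

Section RD.
Variables (R : realType) (a b : \bar R).
Local Notation E := (Iab a b).

Definition loci (mu : {measure set R -> \bar R}) (h : R -> R) :=
  forall c d, E c -> E d -> intg mu `[c, d] h.

(** Real counterpart of [is_deriv]. Only c <= x is demanded, so that integrals over [c, x[ suffice;
    the other order follows by exchanging c and x. *)
Definition RD mu (f h : R -> R) := loci mu h /\
  forall c x, E c -> E x -> c <= x -> f x = f c + \int[mu]_(y in `[c, x[) h y.

Lemma Iab_conv c d x : E c -> E d -> c <= x <= d -> E x.
Proof.
move=> [ac _] [_ db] /andP[cx xd]; split.
  by apply: lt_le_trans ac _; rewrite lee_fin.
by apply: le_lt_trans db; rewrite lee_fin.
Qed.

Lemma measurable_Iab : measurable E.
Proof.
have mi : measurable_fun setT (EFin \o @idfun R) by apply/measurable_EFinP; exact: measurable_id.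
have := mi measurableT _ (emeasurable_itv (Interval (BRight a) (BLeft b))).
rewrite setTI; congr measurable; apply/seteqP; split => x; rewrite /= in_itv /=.
  by move/andP.
by move=> [-> ->].
Qed.

Lemma Iab_mid : (a < b)%E -> exists m, E m.
Proof.
rewrite /Iab; case: a b => [r||] [s||] //= ab.
- exists ((r + s) / 2); rewrite !lte_fin in ab *; split; lra.
- exists (r + 1); rewrite lte_fin ltry; split => //; lra.
- exists (s - 1); rewrite lte_fin ltNyr; split => //; lra.
- by exists 0; rewrite ltry ltNyr.
Qed.

(** The denominator n+2 keeps already the first point strictly on its side of m. The [else] branch
    is meant for an infinite end point, approached by unit steps. *)
Let lo (m : R) (n : nat) : R :=
  if a is EFin r then r + (m - r) / n.+2%:R else m - n.+1%:R.
Let hi (m : R) (n : nat) : R :=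
  if b is EFin r then r - (r - m) / n.+2%:R else m + n.+1%:R.

Lemma Iab_exhaust : (a < b)%E -> exists c d : nat -> R,
  (forall n, [/\ E (c n), E (d n) & c n < d n]) /\
  (forall x, E x -> exists N, forall n, (N <= n)%N -> c n < x < d n).
Proof.
move=> ab; have [m [am mb]] := Iab_mid ab.
have lom n : (a < (lo m n)%:E)%E /\ lo m n < m.
  rewrite /lo; case: a am => [r||]//; rewrite ?lte_fin ?ltNyr => rm; last first.
    by split => //; rewrite gtrBl.
  have q0 : 0 < (m - r) / n.+2%:R by rewrite divr_gt0 ?subr_gt0.
  have q1 : (m - r) / n.+2%:R < m - r.
    by rewrite ltr_pdivrMr// ltr_pMr ?subr_gt0// ltr1n.
  by move: q0 q1; set q := _ / _ => q0 q1; split; lra.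
have him n : ((hi m n)%:E < b)%E /\ m < hi m n.
  rewrite /hi; case: b mb => [r||]//; rewrite ?lte_fin ?ltry => rm; last first.
    by split => //; rewrite ltrDl.
  have q0 : 0 < (r - m) / n.+2%:R by rewrite divr_gt0 ?subr_gt0.
  have q1 : (r - m) / n.+2%:R < r - m.
    by rewrite ltr_pdivrMr// ltr_pMr ?subr_gt0// ltr1n.
  by move: q0 q1; set q := _ / _ => q0 q1; split; lra.
have lox x : E x -> exists N, forall n, (N <= n)%N -> lo m n < x.
  rewrite /lo /Iab /=; case: a am => [r||]//; rewrite ?lte_fin => rm [ax _]; last first.
    exists (Num.trunc (m - x)) => n Nn.
    have : m - x < n.+1%:R by apply: lt_le_trans (truncnS_gt _) _; rewrite ler_nat.
    lra.
  exists (Num.trunc ((m - r) / (x - r))) => n Nn.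
  have : (m - r) / (x - r) < n.+2%:R.
    by apply: lt_le_trans (truncnS_gt _) _; rewrite ler_nat ltnS leqW.
  rewrite ltr_pdivrMr ?subr_gt0// mulrC -ltr_pdivrMr//.
  by set q := _ / _; move=> qx; lra.
have hix x : E x -> exists N, forall n, (N <= n)%N -> x < hi m n.
  rewrite /hi /Iab /=; case: b mb => [r||]//; rewrite ?lte_fin => rm [_ ax]; last first.
    exists (Num.trunc (x - m)) => n Nn.
    have : x - m < n.+1%:R by apply: lt_le_trans (truncnS_gt _) _; rewrite ler_nat.
    lra.
  exists (Num.trunc ((r - m) / (r - x))) => n Nn.
  have : (r - m) / (r - x) < n.+2%:R.
    by apply: lt_le_trans (truncnS_gt _) _; rewrite ler_nat ltnS leqW.
  rewrite ltr_pdivrMr ?subr_gt0// mulrC -ltr_pdivrMr//.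
  by set q := _ / _; move=> qx; lra.
exists (lo m), (hi m); split=> [n|x Ex].
  have [l1 l2] := lom n; have [h1 h2] := him n; split.
  - by split => //; apply: lt_trans mb; rewrite lte_fin.
  - by split => //; apply: lt_trans am _; rewrite lte_fin.
  - exact: lt_trans h2.
have [N1 H1] := lox _ Ex; have [N2 H2] := hix _ Ex.
exists (maxn N1 N2) => n; rewrite geq_max => /andP[n1 n2].
by rewrite H1// H2.
Qed.

Lemma Iab_sub c d : E c -> E d -> `[c, d] `<=` E.
Proof. by move=> Ec Ed x; rewrite /= in_itv /=; exact: Iab_conv. Qed.

Lemma measurable_on_Iab (f : R -> R) :
  (forall c d, E c -> E d -> measurable_fun `[c, d] f) -> measurable_fun E f.
Proof.
move=> mf; have [ab|ba] := boolP (a < b)%E; last first.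
  rewrite (_ : E = set0); first exact: measurable_fun_set0.
  apply/seteqP; split => x // [ax xb]; move/negP: ba; apply.
  exact: lt_trans xb.
have [c [d [cdE cdx]]] := Iab_exhaust ab.
have -> : E = \bigcup_n `[c n, d n].
  apply/seteqP; split=> [x Ex|x [n _]].
    have [N /(_ N (leqnn N))/andP[h1 h2]] := cdx _ Ex.
    by exists N => //; rewrite /= in_itv /= !ltW.
  by have [? ? _] := cdE n; exact: Iab_sub.
apply/measurable_fun_bigcup => // n; have [? ? _] := cdE n; exact: mf.
Qed.

Lemma ae_on_Iab (mu : {measure set R -> \bar R}) (P : R -> Prop) :
  (forall c d, E c -> E d -> {ae mu, forall x, `[c, d[ x -> P x}) ->
  {ae mu, forall x, E x -> P x}.
Proof.
move=> h; have [ab|ba] := boolP (a < b)%E; last first.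
  apply: aeW => x [ax xb]; exfalso; move/negP: ba; apply; exact: lt_trans xb.
have [c [d [cdE cdx]]] := Iab_exhaust ab.
have : {ae mu, forall x n, `[c n, d n[ x -> P x}.
  by apply/ae_foralln => n; have [? ? _] := cdE n; exact: h.
apply: filterS => x h1 Ex.
have [N /(_ N (leqnn N))/andP[h2 h3]] := cdx _ Ex.
by apply: (h1 N); rewrite /= in_itv /= h3 ltW.
Qed.

Variable mu : {measure set R -> \bar R}.
Implicit Types f g h k : R -> R.

Lemma loci_co h c d : loci mu h -> E c -> E d -> intg mu `[c, d[ h.
Proof.
move=> lh Ec Ed; apply: intgS (lh _ _ Ec Ed) => //.
by apply: subset_itvl; rewrite bnd_simp.
Qed.

Lemma loci_meas h : loci mu h -> measurable_fun E h.
Proof. by move=> lh; apply: measurable_on_Iab => c d Ec Ed; apply: intg_meas (lh _ _ Ec Ed). Qed.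

Lemma Rint_split h c x d : loci mu h -> E c -> E d -> c <= x <= d ->
  \int[mu]_(y in `[c, d[) h y = \int[mu]_(y in `[c, x[) h y + \int[mu]_(y in `[x, d[) h y.
Proof.
move=> lh Ec Ed /andP[cx xd].
have e : `[c, d[ = `[c, x[ `|` `[x, d[ :> set R by apply: itv_bndbnd_setU; rewrite bnd_simp.
rewrite [in LHS]e Rintegral_setU//.
  by rewrite -e; exact: loci_co.
apply/disj_setPS => y [] /=; rewrite !in_itv /= => /andP[_ h1] /andP[h2 _].
by have := lt_le_trans h1 h2; rewrite ltxx.
Qed.

Lemma loci_lin h k t : loci mu h -> loci mu k -> loci mu (fun x => h x + t * k x).
Proof. by move=> lh lk c d Ec Ed; apply: intgD => //; [exact: lh|apply: intgZ => //; exact: lk]. Qed.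

Lemma Rint_lin D h k t : measurable D -> intg mu D h -> intg mu D k ->
  \int[mu]_(y in D) (h y + t * k y) = \int[mu]_(y in D) h y + t * \int[mu]_(y in D) k y.
Proof. by move=> mD ih ik; rewrite RintegralD ?RintegralZl//; exact: intgZ. Qed.

Lemma RD_lin f h g k t : RD mu f h -> RD mu g k ->
  RD mu (fun x => f x + t * g x) (fun x => h x + t * k x).
Proof.
move=> [lh fh] [lk gk]; split; first exact: loci_lin.
move=> c x Ec Ex cx; rewrite (fh c x)// (gk c x)// Rint_lin//; try exact: loci_co.
by ring.
Qed.

Lemma RD_unique f h k : RD mu f h -> RD mu f k -> {ae mu, forall x, E x -> h x = k x}.
Proof.
move=> [lh fh] [lk fk]; apply: ae_on_Iab => c d Ec Ed.
have H := @primitive_unique R mu c d (fun x => h x + (-1) * k x).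
have : {ae mu, forall x, `[c, d[ x -> h x + (-1) * k x = 0}; first apply: H.
- by apply: loci_co => //; exact: loci_lin.
- move=> x cxd; have Ex := Iab_conv Ec Ed cxd.
  have /andP[cx _] := cxd.
  rewrite Rint_lin//; try exact: loci_co.
  have := fh _ _ Ec Ex cx; rewrite (fk _ _ Ec Ex cx) => /addrI ->; ring.
by apply: filterS => x h1 cxd; have := h1 cxd; rewrite mulN1r => /subr0_eq.
Qed.

Lemma RD_bounded f h c d : RD mu f h -> E c -> E d ->
  exists M, forall x, c <= x <= d -> `|f x| <= M.
Proof.
move=> [lh fh] Ec Ed; exists (`|f c| + \int[mu]_(y in `[c, d]) `|h y|) => x cxd.
have Ex := Iab_conv Ec Ed cxd; have /andP[cx xd] := cxd.
rewrite (fh _ _ Ec Ex cx) (le_trans (ler_normD _ _))// lerD2l.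
have s : (`[c, x[ : set R) `<=` `[c, d] by apply: subset_itvl; rewrite bnd_simp.
apply: le_trans (le_normr_Rintegral _ _) _ => //; first exact: loci_co.
apply: Rint0_setS => //.
by apply: integrable_norm; exact: lh.
Qed.

Lemma RD_meas f h : loc_finite a b mu -> RD mu f h -> measurable_fun E f.
Proof.
move=> fm [lh fh]; apply: measurable_on_Iab => c d Ec Ed.
have [cd|dc] := leP c d; last first.
  rewrite set_itv_ge ?bnd_simp -?ltNge//; exact: measurable_fun_set0.
have mp := @measurable_primitive R mu c d h.
have : measurable_fun `[c, d] (fun x : R => f c + \int[mu]_(y in (`]-oo, x[ : set R) `&` `[c, d[) h y).
  apply: measurable_funS (measurableT) _ _ => //.
  apply: measurable_funD => //; apply: mp; last exact: loci_co.
  apply: le_lt_trans (fm _ _ Ec Ed).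
  apply: le_measure; try exact/mem_set.
  by apply: subset_itvl; rewrite bnd_simp.
apply: eq_measurable_fun.
move=> x /set_mem /=; rewrite in_itv /= => cxd.
have Ex := Iab_conv Ec Ed cxd; have /andP[cx xd] := cxd.
rewrite (fh _ _ Ec Ex cx); congr (_ + _); congr (Rintegral mu _ _).
apply/seteqP; split => y; rewrite /= !in_itv /=; first by move=> [-> /andP[-> _]].
by move=> /andP[-> yx]; rewrite (lt_le_trans yx xd).
Qed.

(** These functions multiply locally integrable functions into locally integrable ones, whatever the
    measure; thus a function differentiable with respect to [sg] can be integrated against [chi] and
    [rp], [rn]. *)
Definition loc_bounded f := measurable_fun E f /\
  forall c d, E c -> E d -> exists M, forall x, c <= x <= d -> `|f x| <= M.

Lemma RD_loc_bounded f h : loc_finite a b mu -> RD mu f h -> loc_bounded f.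
Proof.
move=> fm fh; split; first exact: RD_meas fh.
by move=> c d Ec Ed; exact: RD_bounded fh Ec Ed.
Qed.

Lemma loci_mul (nu : {measure set R -> \bar R}) f h :
  loc_bounded f -> loci nu h -> loci nu (fun x => f x * h x).
Proof.
move=> [mf bf] lh c d Ec Ed; have [M fM] := bf _ _ Ec Ed.
have M0 : 0 <= `|M| by [].
apply: (@intg_le _ _ _ _ _ _ (fun x => `|M| * h x)) => //.
- apply: measurable_funM; last exact: intg_meas (lh _ _ Ec Ed).
  by apply: measurable_funS mf; [exact: measurable_Iab|exact: Iab_sub].
- move=> x; rewrite /= in_itv /= => cxd; rewrite !normrM normr_id.
  by apply: ler_wpM2r => //; exact: le_trans (fM _ cxd) (ler_norm _).
- by apply: intgZ => //; exact: lh.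
Qed.

Lemma loci_bounded (nu : {measure set R -> \bar R}) f :
  loc_finite a b nu -> loc_bounded f -> loci nu f.
Proof.
move=> fn bf; have : loci nu (cst 1).
  move=> c d Ec Ed; apply: measurable_bounded_integrable => //; first exact: fn.
  by exists 1; split => // y y1 x _ /=; rewrite normr1 ltW.
move=> /(loci_mul bf) h c d Ec Ed.
by apply: intg_eq (h _ _ Ec Ed) => // x _; rewrite mulr1.
Qed.

(** The intervals [s, x[ shrink to the empty set as s tends to x from below, so an atom at x does no
    harm: primitives are left continuous. *)
Lemma left_cont h x e : (a < x%:E)%E -> (x%:E < b)%E -> loci mu h -> 0 < e ->
  exists2 y, E y /\ y < x & forall z, y <= z <= x -> `|\int[mu]_(u in `[z, x[) h u| <= e.
Proof.
move=> ax xb lh e0; have Ex : E x by [].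
have [c [d [cdE cdx]]] := Iab_exhaust (lt_trans ax xb).
have [N /(_ N (leqnn N))/andP[cx xd]] := cdx _ Ex.
have [EcN EdN _] := cdE N.
pose s n := x - (x - c N) / n.+1%:R.
have sc n : c N <= s n < x.
  have q0 : 0 < (x - c N) / n.+1%:R by rewrite divr_gt0 ?subr_gt0.
  have q1 : (x - c N) / n.+1%:R <= x - c N.
    by rewrite ler_pdivrMr// ler_pMr ?subr_gt0// ler1n.
  by rewrite /s; move: q0 q1; set q := _ / _ => q0 q1; apply/andP; split; lra.
have Es n : E (s n).
  by apply: (Iab_conv EcN Ex); have /andP[-> /ltW] := sc n.
have := @vanishing_tail _ _ R mu `[c N, x[ h (fun n => `[s n, x[) e.
move=> /(_ (measurable_itv _) (loci_co lh EcN Ex) (fun n => measurable_itv _)) [||//|n sn].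
- move=> n y; rewrite /= !in_itv /= => /andP[sy ->]; rewrite andbT.
  by apply: le_trans sy; have /andP[] := sc n.
- move=> y; rewrite /= in_itv /= => /andP[cy yx].
  exists (Num.trunc ((x - c N) / (x - y))) => n Nn.
  rewrite /= in_itv /= => /andP[sy _].
  have : (x - c N) / (x - y) < n.+1%:R by apply: lt_le_trans (truncnS_gt _) _; rewrite ler_nat.
  rewrite ltr_pdivrMr ?subr_gt0// mulrC -ltr_pdivrMr//.
  by move: sy; rewrite /s lerBlDr -lerBlDl leNgt => /negbTE ->.
exists (s n); first by split => //; have /andP[] := sc n.
move=> z /andP[sz zx]; have Ez := Iab_conv (Es n) Ex (introT andP (conj sz zx)).
apply: le_trans (le_normr_Rintegral _ _) _ => //; first exact: loci_co.
apply: le_trans sn; apply: Rint0_setS => //.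
  by apply: subset_itvr; rewrite bnd_simp.
by apply: integrable_norm; exact: loci_co.
Qed.

End RD.

(** * The real Hilbert space H^1(a,b) *)

Section H1.
Variables (R : realType) (a b : \bar R) (sg chi : {measure set R -> \bar R}).
Local Notation E := (Iab a b).
Hypothesis fsg : loc_finite a b sg.
Hypothesis fchi : loc_finite a b chi.
Implicit Types f g h : R -> R.

(** An element of the real H^1 comes with a chosen version f1 of its derivative. *)
Definition RH1 f f1 := RD a b sg f f1 /\ L2 chi E f /\ L2 sg E f1.

Definition realip f f1 g g1 :=
  \int[chi]_(x in E) (f x * g x) + \int[sg]_(x in E) (f1 x * g1 x).

Definition sqnorm f f1 := \int[chi]_(x in E) (f x ^+ 2) + \int[sg]_(x in E) (f1 x ^+ 2).

Let mE : measurable E. Proof. exact: measurable_Iab. Qed.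

Lemma RH1_lin f f1 g g1 t : RH1 f f1 -> RH1 g g1 ->
  RH1 (fun x => f x + t * g x) (fun x => f1 x + t * g1 x).
Proof.
move=> [df [lf lf1]] [dg [lg lg1]]; split; first exact: RD_lin.
by split; apply: L2D => //; exact: L2Z.
Qed.

Lemma RH1_sub f f1 g g1 : RH1 f f1 -> RH1 g g1 ->
  RH1 (fun x => f x - g x) (fun x => f1 x - g1 x).
Proof.
move=> hf hg; have := RH1_lin (-1) hf hg.
by congr RH1; apply/funext => x; rewrite mulN1r.
Qed.

Lemma sqnorm_ge0 f f1 : 0 <= sqnorm f f1.
Proof. by rewrite addr_ge0// L2_sqr_ge0. Qed.

Lemma sqnorm_quadratic f f1 g g1 t : RH1 f f1 -> RH1 g g1 ->
  sqnorm (fun x => f x + t * g x) (fun x => f1 x + t * g1 x) =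
  sqnorm f f1 + 2 * t * realip f f1 g g1 + t ^+ 2 * sqnorm g g1.
Proof.
move=> [df [lf lf1]] [dg [lg lg1]].
by rewrite /sqnorm /realip !L2_quadratic//; ring.
Qed.

Lemma sqnorm_subC f f1 g g1 :
  sqnorm (fun x => f x - g x) (fun x => f1 x - g1 x) =
  sqnorm (fun x => g x - f x) (fun x => g1 x - f1 x).
Proof. by congr (_ + _); apply: eq_Rint => x _; rewrite -sqrrN opprB. Qed.

Lemma realip_cauchy_schwarz f f1 g g1 : RH1 f f1 -> RH1 g g1 ->
  realip f f1 g g1 ^+ 2 <= sqnorm f f1 * sqnorm g g1.
Proof.
move=> hf hg; apply: quadratic_discr; try exact: sqnorm_ge0.
by move=> t; rewrite -sqnorm_quadratic//; exact: sqnorm_ge0.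
Qed.

Lemma realipDl f f1 g g1 h h1 t : RH1 f f1 -> RH1 g g1 -> RH1 h h1 ->
  realip (fun x => f x + t * g x) (fun x => f1 x + t * g1 x) h h1 =
  realip f f1 h h1 + t * realip g g1 h h1.
Proof.
move=> [_ [lf lf1]] [_ [lg lg1]] [_ [lh lh1]]; rewrite /realip.
rewrite (@eq_Rint _ _ _ chi _ _ (fun x => f x * h x + t * (g x * h x))); last by move=> x _; ring.
rewrite (@eq_Rint _ _ _ sg _ _ (fun x => f1 x * h1 x + t * (g1 x * h1 x))); last by move=> x _; ring.
by rewrite !Rint_lin//; try exact: L2_prod; ring.
Qed.

Lemma realipC f f1 g g1 : realip f f1 g g1 = realip g g1 f f1.
Proof. by congr (_ + _); apply: eq_Rint => x _; rewrite mulrC. Qed.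

Lemma RD_osc f f1 c d x y : RD a b sg f f1 -> E c -> E d -> c <= x <= d -> c <= y <= d ->
  `|f x - f y| <= \int[sg]_(u in `[c, d[) `|f1 u|.
Proof.
move=> df Ec Ed; wlog xy : x y / y <= x => [H cxd cyd|].
  by have [/H|/ltW/H] := leP y x; [|rewrite distrC]; exact.
move=> cxd cyd; have Ex := Iab_conv Ec Ed cxd; have Ey := Iab_conv Ec Ed cyd.
have [l1 fE] := df.
rewrite (fE y x Ey Ex xy) addrAC subrr add0r.
apply: le_trans (le_normr_Rintegral _ _) _ => //; first exact: loci_co l1 Ey Ex.
apply: Rint0_setS => //.
- have /andP[cy _] := cyd; have /andP[_ xd] := cxd.
  by apply: subset_itv; rewrite bnd_simp.
- by apply: integrable_norm; exact: loci_co l1 Ec Ed.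
Qed.

(** Cauchy-Schwarz for |f1| against the constant 1 on [c, d[. *)
Lemma RD_osc_L2 f f1 c d x y : RD a b sg f f1 -> L2 sg E f1 -> E c -> E d ->
  c <= x <= d -> c <= y <= d ->
  (f x - f y) ^+ 2 <= fine (sg `[c, d[) * \int[sg]_(u in E) (f1 u ^+ 2).
Proof.
move=> df l1 Ec Ed cxd cyd.
have s : (`[c, d[ : set R) `<=` `[c, d] by apply: subset_itvl; rewrite bnd_simp.
have sE : (`[c, d[ : set R) `<=` E by apply: subset_trans s _; exact: Iab_sub.
have fin : (sg (`[c, d[ : set R) < +oo)%E.
  by apply: le_lt_trans (fsg Ec Ed); apply: le_measure; try exact/mem_set.
have l1' : L2 sg `[c, d[ f1 by apply: L2S l1.
have l1n : L2 sg `[c, d[ (fun x => `|f1 x|).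
  case: l1' => m1 i1; split; first exact: measurableT_comp.
  by apply: intg_eq i1 => // u _; rewrite real_normK// num_real.
have c1 : L2 sg `[c, d[ (cst 1) by apply: (@L2_bounded _ _ _ _ _ _ 1) => // u _; rewrite normr1.
have := cauchy_schwarz (measurable_itv _) l1n c1.
rewrite (@eq_Rint _ _ _ sg _ _ (fun u => `|f1 u|)); last by move=> u _; rewrite mulr1.
rewrite (@eq_Rint _ _ _ sg _ (fun u => `|f1 u| ^+ 2) (fun u => f1 u ^+ 2)); last first.
  by move=> u _; rewrite real_normK// num_real.
rewrite (@eq_Rint _ _ _ sg _ (fun u => cst 1 u ^+ 2) (fun u => 1)); last first.
  by move=> u _; rewrite expr1n.
rewrite Rintegral_cst// mul1r => cs.
apply: (@le_trans _ _ ((\int[sg]_(u in `[c, d[) `|f1 u|) ^+ 2)).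
  rewrite -[leLHS]real_normK ?num_real//.
  by rewrite lerXn2r ?nnegrE ?Rintegral_ge0//; exact: RD_osc.
apply: le_trans cs _; rewrite mulrC ler_wpM2l ?fine_ge0//.
by apply: Rint0_setS => //; [case: l1|move=> u _; exact: sqr_ge0].
Qed.

Hypothesis chiE : chi E <> 0%E.
Hypothesis ab : (a < b)%E.

(** If all intervals of an exhausting sequence were [chi]-null, so would be (a, b). *)
Lemma chi_charged : exists c d, [/\ E c, E d, c < d & 0 < fine (chi `[c, d[)].
Proof.
have [c [d [cdE cdx]]] := Iab_exhaust ab.
apply: contrapT => H; apply: chiE.
apply/negligibleP => //.
apply: (@negligibleS _ _ _ chi (\bigcup_n `[c n, d n[)).
  move=> x /cdx[N /(_ N (leqnn N))/andP[h1 h2]].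
  by exists N => //; rewrite /= in_itv /= h2 ltW.
apply: negligible_bigcup => n; apply/negligibleP => //.
have [Ec Ed cd] := cdE n.
have fin : (chi (`[c n, d n[ : set R) < +oo)%E.
  apply: le_lt_trans (fchi Ec Ed); apply: le_measure; try exact/mem_set.
  by apply: subset_itvl; rewrite bnd_simp.
apply/eqP; rewrite -measure_le0 -[leLHS]fineK ?ge0_fin_numE// lee_fin leNgt.
by apply/negP => k0; apply: H; exists (c n), (d n).
Qed.

(** The inequality f(x)^2 <= 2 f(y)^2 + 2 (f(x) - f(y))^2 is averaged over y in a [chi]-charged
    interval of mass k: the first term gives 2/k, and the oscillation over an interval containing x
    and y gives 2 m. *)
Lemma sup_bound c d : E c -> E d -> exists2 C, 0 <= C &
  forall f f1, RH1 f f1 -> forall x, c <= x <= d -> f x ^+ 2 <= C * sqnorm f f1.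
Proof.
move=> Ec Ed; have [c0 [d0 [Ec0 Ed0 cd0 k0]]] := chi_charged.
pose c' := Num.min c c0; pose d' := Num.max d d0.
have Ec' : E c' by rewrite /c'; case: ltP.
have Ed' : E d' by rewrite /d'; case: ltP.
set k := fine (chi `[c0, d0[) in k0.
pose m := fine (sg `[c', d'[).
have m0 : 0 <= m by rewrite fine_ge0.
exists (2 / k + 2 * m); first by rewrite addr_ge0 ?mulr_ge0 ?invr_ge0 ?(ltW k0).
move=> f f1 [df [lf lf1]] x /andP[cx xd].
have cxd' : c' <= x <= d' by rewrite /c' /d' ge_min cx/= le_max xd.
have fin : (chi (`[c0, d0[ : set R) < +oo)%E.
  apply: le_lt_trans (fchi Ec0 Ed0); apply: le_measure; try exact/mem_set.
  by apply: subset_itvl; rewrite bnd_simp.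
have sE : (`[c0, d0[ : set R) `<=` E.
  by apply: subset_trans (Iab_sub Ec0 Ed0); apply: subset_itvl; rewrite bnd_simp.
have lf' : intg chi `[c0, d0[ (fun x => f x ^+ 2) by apply: intgS (lf.2).
pose A := \int[sg]_(u in E) (f1 u ^+ 2).
have i1 : intg chi `[c0, d0[ (cst 1).
  by apply: L2_intg => //; apply: (@L2_bounded _ _ _ _ _ _ 1) => // u _; rewrite normr1.
have : \int[chi]_(y in `[c0, d0[) (f x ^+ 2 * cst 1 y) <=
       \int[chi]_(y in `[c0, d0[) (2 * f y ^+ 2 + 2 * m * A * cst 1 y).
  apply: le_Rintegral => //; first exact: intgZ.
    by apply: intgD => //; exact: intgZ.
  move=> y; rewrite /= in_itv /= => /andP[c0y yd0].
  have cyd' : c' <= y <= d' by rewrite /c' /d' ge_min c0y orbT/= le_max (ltW yd0) orbT.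
  have := RD_osc_L2 df lf1 Ec' Ed' cxd' cyd'; rewrite -/m -/A => o.
  (* This square is the difference of the two sides of f(x)^2 <= 2 f(y)^2 + 2 (f(x) - f(y))^2. *)
  have := sqr_ge0 (f x - 2 * f y); rewrite !mulr1 => ?.
  by nra.
rewrite RintegralZl// RintegralD//; try exact: intgZ.
rewrite !RintegralZl// Rintegral_cst// mul1r -/k.
have : \int[chi]_(y in `[c0, d0[) (f y ^+ 2) <= \int[chi]_(y in E) (f y ^+ 2).
  by apply: Rint0_setS => //; [case: lf|move=> u _; exact: sqr_ge0].
rewrite /sqnorm -/A; set B := \int[chi]_(y in E) _; set B' := \int[chi]_(y in _) _ => BB H.
have A0 : 0 <= A by exact: L2_sqr_ge0.
have B0 : 0 <= B by exact: L2_sqr_ge0.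
rewrite -(ler_pM2r k0) (le_trans H)//.
have -> : (2 / k + 2 * m) * (B + A) * k = 2 * B + 2 * A + 2 * m * (B + A) * k.
  by field; rewrite gt_eqF.
by have := mulr_ge0 (mulr_ge0 m0 B0) (ltW k0); nra.
Qed.

(** By [sup_bound] the functions converge at every point, while their derivatives converge almost
    everywhere and in L^2. On [c, x[ the latter implies convergence of the integrals, so the
    pointwise limit is a primitive of the limit of the derivatives. *)
Lemma H1_complete (F F1 : nat -> R -> R) :
  (forall n, RH1 (F n) (F1 n)) ->
  (forall n m, (n <= m)%N ->
     sqnorm (fun x => F m x - F n x) (fun x => F1 m x - F1 n x) <= 8^-1 ^+ n) ->
  exists w w1, RH1 w w1 /\
    forall n, sqnorm (fun x => w x - F n x) (fun x => w1 x - F1 n x) <= 2 * 8^-1 ^+ n.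
Proof.
move=> hF cF.
have e0 n : 0 <= 8^-1 ^+ n :> R by rewrite exprn_ge0.
have cchi n m : (n <= m)%N -> \int[chi]_(x in E) ((F m x - F n x) ^+ 2) <= 8^-1 ^+ n.
  by move=> nm; apply: le_trans (cF _ _ nm); rewrite lerDl L2_sqr_ge0.
have csg n m : (n <= m)%N -> \int[sg]_(x in E) ((F1 m x - F1 n x) ^+ 2) <= 8^-1 ^+ n.
  by move=> nm; apply: le_trans (cF _ _ nm); rewrite lerDr L2_sqr_ge0.
have lF n : L2 chi E (F n) by have [_ []] := hF n.
have lF1 n : L2 sg E (F1 n) by have [_ []] := hF n.
have [w1 mw1 w1F] := riesz_fischer_ae mE lF1 (fun n => csg n n.+1 (leqnSn n)).
have fw1 n := fatou_L2 mE lF1 mw1 w1F (csg n).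
have lw1 : L2 sg E w1.
  have -> : w1 = (fun x => (w1 x - F1 0%N x) + F1 0%N x) by apply/funext => x; rewrite subrK.
  by apply: L2D => //; exact: (fw1 0%N).1.
have cw x : E x -> cvgn (fun n => F n x).
  move=> Ex; have [C C0 HC] := sup_bound Ex Ex.
  apply: (@fast_cvg _ _ C) => // n.
  have := HC _ _ (RH1_sub (hF n.+1) (hF n)) x; rewrite !lexx => /(_ isT) h.
  apply: (@le_trans _ _ (4 ^+ n * (C * 8^-1 ^+ n))).
    by rewrite ler_wpM2l ?exprn_ge0// (le_trans h)// ler_wpM2l// cF.
  rewrite mulrCA -exprMn ler_piMr// exprn_ile1//; lra.
pose w x := limn (fun n => F n x).
have wF x : E x -> F n x @[n --> \oo] --> w x by exact: cw.
have dw : RD a b sg w w1.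
  have l1 : loci a b sg w1.
    move=> c d Ec Ed; apply: L2_intg => //; first exact: fsg.
    by apply: L2S lw1 => //; exact: Iab_sub.
  split => // c x Ec Ex cx.
  have l2 n : loci a b sg (F1 n) by have [[]] := hF n.
  pose V n := \int[sg]_(y in `[c, x[) F1 n y.
  have VE n : V n = F n x - F n c.
    have [[_ h] _] := hF n.
    by rewrite (h c x)// addrC addKr.
  have VF : V n @[n --> \oo] --> w x - w c.
    rewrite (_ : V = (fun n => F n x - F n c)); last exact/funext.
    by apply: cvgB; exact: wF.
  suff : V n @[n --> \oo] --> \int[sg]_(y in `[c, x[) w1 y.
    move=> /(cvg_unique _ VF) => /(_ (@norm_hausdorff _ _)) <-.
    by rewrite addrC subrK.
  pose m := fine (sg `[c, x[).
  have m0 : 0 <= m by rewrite fine_ge0.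
  have s : (`[c, x[ : set R) `<=` `[c, x] by apply: subset_itvl; rewrite bnd_simp.
  have sE : (`[c, x[ : set R) `<=` E by apply: subset_trans s _; exact: Iab_sub.
  have fin : (sg (`[c, x[ : set R) < +oo)%E.
    by apply: le_lt_trans (fsg Ec Ex); apply: le_measure; try exact/mem_set.
  have c1 : L2 sg `[c, x[ (cst 1) by apply: (@L2_bounded _ _ _ _ _ _ 1) => // u _; rewrite normr1.
  have key n : (\int[sg]_(y in `[c, x[) w1 y - V n) ^+ 2 <= m * 8^-1 ^+ n.
    rewrite /V -(RintegralB (measurable_itv _) (loci_co l1 Ec Ex) (loci_co (l2 n) Ec Ex)).
    have ln : L2 sg `[c, x[ (fun y => w1 y - F1 n y) by apply: L2S (fw1 n).1.
    have := cauchy_schwarz (measurable_itv _) ln c1.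
    rewrite (@eq_Rint _ _ _ sg _ _ (fun u => w1 u - F1 n u)); last by move=> u _; rewrite mulr1.
    rewrite (@eq_Rint _ _ _ sg _ (fun u => cst 1 u ^+ 2) (fun u => 1)); last first.
      by move=> u _; rewrite expr1n.
    rewrite Rintegral_cst// mul1r => /le_trans; apply; rewrite mulrC ler_wpM2l//.
    apply: le_trans (fw1 n).2; apply: Rint0_setS => //; first by have [] := (fw1 n).1.
    by move=> u _; exact: sqr_ge0.
  apply/cvgrPdist_le => e epos.
  have : (m * 8^-1 ^+ n) @[n --> \oo] --> m * 0.
    by apply: cvgM; [exact: cvg_cst|apply: cvg_expr; rewrite ger0_norm ?invf_lt1 ?ltr1n].
  rewrite mulr0 => /cvgrPdist_le /(_ (e ^+ 2)); rewrite exprn_gt0// => /(_ isT).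
  apply: filterS => n; rewrite sub0r normrN ger0_norm ?mulr_ge0// => h.
  rewrite -ler_sqr ?nnegrE ?(ltW epos)// real_normK ?num_real//.
  exact: le_trans (key n) h.
have fw n := fatou_L2 mE lF (RD_meas fsg dw) (aeW _ wF) (cchi n).
exists w, w1; split.
  split => //; split => //.
  have -> : w = (fun x => (w x - F 0%N x) + F 0%N x) by apply/funext => x; rewrite subrK.
  by apply: L2D => //; exact: (fw 0%N).1.
move=> n; rewrite /sqnorm mulr_natl mulr2n lerD//; [exact: (fw n).2|exact: (fw1 n).2].
Qed.

(** Boundedness is stated for squares, which avoids taking roots of [sqnorm]. *)
Definition bounded_functional (l : (R -> R) -> (R -> R) -> R) :=
  (forall f f1 g g1 t, RH1 f f1 -> RH1 g g1 ->
    l (fun x => f x + t * g x) (fun x => f1 x + t * g1 x) = l f f1 + t * l g g1) /\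
  exists2 M, 0 <= M & forall f f1, RH1 f f1 -> l f f1 ^+ 2 <= M * sqnorm f f1.

Lemma RH1_0 : RH1 (cst 0) (cst 0).
Proof.
have l0 (mu : {measure set R -> \bar R}) : L2 mu E (cst 0).
  split => //; apply: intg_eq (@integrable0 _ _ _ mu E) => // x _ /=.
  by rewrite expr0n.
split; last by split.
split=> [c d Ec Ed|c x _ _ _]; first exact: integrable0.
by rewrite Rintegral_cst// mul0r addr0.
Qed.

(* The representing element is the limit of a fast minimising sequence of |u|^2 - 2 l(u). *)
Lemma riesz_representation l : bounded_functional l ->
  exists w w1, RH1 w w1 /\ forall h h1, RH1 h h1 -> realip w w1 h h1 = l h h1.
Proof.
move=> [llin [M M0 lM]].
pose J f f1 := sqnorm f f1 - 2 * l f f1.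
pose S := [set r | exists f f1, RH1 f f1 /\ r = J f f1].
(* With n the squared norm, 4 l^2 <= 4 M n <= (M + n)^2, whence 2 l <= M + n. *)
have lbS : lbound S (- M).
  move=> _ [f [f1 [hf ->]]]; rewrite /J.
  have := lM _ _ hf; have := sqnorm_ge0 f f1; set n := sqnorm f f1; set k := l f f1 => n0 kM.
  have : (2 * k) ^+ 2 <= (M + n) ^+ 2 by have := sqr_ge0 (M - n); nra.
  have Mn : 0 <= M + n by exact: addr_ge0.
  rewrite -[leLHS]real_normK ?num_real// ler_sqr ?nnegrE// => h.
  have := ler_norm (2 * k); lra.
have S0 : S !=set0 by exists (J (cst 0) (cst 0)), (cst 0), (cst 0); split => //; exact: RH1_0.
have hS : has_inf S by split => //; exists (- M).
pose m := inf S.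
have mJ f f1 : RH1 f f1 -> m <= J f f1.
  by move=> hf; apply: ge_inf; [exists (- M)|exists f, f1].
have /choice[F /choice[F1 hF]] : forall n, exists f f1, RH1 f f1 /\ J f f1 < m + 8^-1 ^+ n / 4.
  move=> n; have e0 : 0 < 8^-1 ^+ n / 4 :> R by rewrite divr_gt0 ?exprn_gt0.
  by have [_ [f [f1 [hf ->]]] Jf] := inf_adherent e0 hS; exists f, f1.
have Q u u1 h h1 t : RH1 u u1 -> RH1 h h1 ->
    J (fun x => u x + t * h x) (fun x => u1 x + t * h1 x) =
    J u u1 + 2 * t * (realip u u1 h h1 - l h h1) + t ^+ 2 * sqnorm h h1.
  by move=> hu hh; rewrite /J sqnorm_quadratic// llin//; ring.
(* J(u + t h) >= m for all t, so the discriminant bounds the derivative of J at u in the direction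
   h. *)
have near_crit u u1 h h1 e : RH1 u u1 -> RH1 h h1 -> 0 <= e -> J u u1 <= m + e ->
    (realip u u1 h h1 - l h h1) ^+ 2 <= e * sqnorm h h1.
  move=> hu hh e0 Ju; apply: quadratic_discr => // [|t]; first exact: sqnorm_ge0.
  by have := mJ _ _ (RH1_lin t hu hh); rewrite Q//; lra.
have [||w [w1 [hw wF]]] := @H1_complete F F1.
- by move=> n; case: (hF n).
(* Since J at the midpoint is at least m, the expansions at t = 1/2 and t = 1 give N <= 2 (J(F p) +
   J(F n)) - 4 m; the tolerance 8^-n / 4 makes this at most 8^-n. *)
- move=> n p np.
  have [hn Jn] := hF n; have [hp Jp] := hF p.
  have hpn := RH1_sub hn hp.
  have Jh := mJ _ _ (RH1_lin (2^-1) hp hpn).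
  rewrite Q// in Jh.
  have e1 := Q _ _ _ _ 1 hp hpn.
  have eJ : J (fun x => F p x + 1 * (F n x - F p x)) (fun x => F1 p x + 1 * (F1 n x - F1 p x)) =
      J (F n) (F1 n).
    by congr J; apply/funext => x; ring.
  rewrite eJ in e1.
  rewrite sqnorm_subC.
  have : 8^-1 ^+ p <= 8^-1 ^+ n :> R by rewrite ler_wiXn2l ?invr_ge0 ?invf_le1 ?ler1n.
  move: Jh e1 Jn Jp; set N := sqnorm _ _; set I := realip _ _ _ _ - _.
  set en := 8^-1 ^+ n; set ep := 8^-1 ^+ p; set Jpp := J (F p) _; set Jnn := J (F n) _.
  by rewrite (_ : 2^-1 ^+ 2 = 4^-1 :> R); [lra|field].
exists w, w1; split => // h h1 hh.
apply/eqP; rewrite -subr_eq0 -sqrf_eq0; apply/eqP.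
pose N := sqnorm h h1.
have N0 : 0 <= N by exact: sqnorm_ge0.
(* Twice the error 1/4 from near criticality plus twice the error 2 from w - F n is at most 5. *)
have bnd n : (realip w w1 h h1 - l h h1) ^+ 2 <= 5 * N * 8^-1 ^+ n.
  have [hn Jn] := hF n.
  have e0 : 0 <= 8^-1 ^+ n / 4 :> R by rewrite divr_ge0 ?exprn_ge0.
  have k1 := near_crit _ _ _ _ _ hn hh e0 (ltW Jn).
  have hwn := RH1_sub hw hn.
  have k2 := realip_cauchy_schwarz hwn hh.
  have k3 : realip w w1 h h1 =
      realip (F n) (F1 n) h h1 + realip (fun x => w x - F n x) (fun x => w1 x - F1 n x) h h1.
    rewrite -[X in _ + X]mul1r -realipDl//.
    by congr realip; apply/funext => x; ring.
  have k4 := wF n.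
  rewrite k3; move: k1 k2 k4; rewrite -/N.
  set A := realip _ _ _ _; set B := realip _ _ _ _; set L := l h h1; set e := _ ^+ n; set W := sqnorm _ _.
  move=> k1 k2 k4.
  have k5 : W * N <= 2 * e * N by rewrite ler_wpM2r.
  have := sqr_ge0 (A - L - B); nra.
apply/eqP; rewrite eq_le sqr_ge0 andbT.
have : (5 * N * 8^-1 ^+ n) @[n --> \oo] --> 5 * N * 0.
  by apply: cvgM; [exact: cvg_cst|apply: cvg_expr; rewrite ger0_norm ?invf_lt1 ?ltr1n].
rewrite mulr0 => c0.
have cl := @cvg_lim _ (@norm_hausdorff _ _) _ _ _ _ _ c0.
rewrite -cl; apply: limr_ge; first by apply/cvg_ex; eexists; exact: c0.
exact: nearW.
Qed.

End H1.

(** * Supports, oriented primitives and local integration by parts *)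

Section primitives.
Variables (R : realType) (a b : \bar R).
Local Notation E := (Iab a b).
Implicit Types (mu nu : {measure set R -> \bar R}) (f g h q t : R -> R).

Lemma Rint_supp mu (D D' : set R) f : D' `<=` D -> (forall x, D x -> ~ D' x -> f x = 0) ->
  \int[mu]_(x in D) f x = \int[mu]_(x in D') f x.
Proof.
move=> DD f0; rewrite -[in RHS](setIidr DD) Rintegral_mkcondr.
apply: eq_Rint => x Dx; rewrite patchE; case: ifPn => // /negP nD.
by apply: f0 => // D'x; apply: nD; exact/mem_set.
Qed.

Lemma intg_supp mu (D D' : set R) f : measurable D -> measurable D' -> D' `<=` D ->
  (forall x, D x -> ~ D' x -> f x = 0) -> intg mu D' f -> intg mu D f.
Proof.
move=> mD mD' DD f0 fi; apply: (@intg_eq _ _ _ _ _ (f \_ D')) => //.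
  move=> x Dx; rewrite patchE; case: ifPn => // /negP nD.
  by apply/esym/f0 => // D'x; apply: nD; exact/mem_set.
rewrite /intg -restrict_EFin; apply/integrable_restrict => //.
by rewrite setIidr.
Qed.

Lemma L2_supp mu (D D' : set R) f : measurable D -> measurable D' -> D' `<=` D ->
  (forall x, D x -> ~ D' x -> f x = 0) -> L2 mu D' f -> L2 mu D f.
Proof.
move=> mD mD' DD f0 [mf fi]; split; last first.
  by apply: intg_supp fi => // x Dx nD; rewrite f0// expr0n.
apply: (@eq_measurable_fun _ _ _ _ _ (f \_ D')).
  move=> x /set_mem Dx; rewrite patchE; case: ifPn => // /negP nD.
  by apply/esym/f0 => // D'x; apply: nD; exact/mem_set.
by apply/(measurable_restrict _ mD' mD) => //; rewrite setIidr.
Qed.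

Definition prim mu q c x := if c <= x then \int[mu]_(y in `[c, x[) q y
  else - \int[mu]_(y in `[x, c[) q y.

Lemma prim0 mu q c : prim mu q c c = 0.
Proof. by rewrite /prim lexx set_itv_ge ?bnd_simp ?ltxx// Rintegral_set0. Qed.

Lemma prim_RD mu q c : E c -> loci a b mu q -> RD a b mu (prim mu q c) q.
Proof.
move=> Ec lq; split => // z x Ez Ex zx; rewrite /prim.
have [cz|zc] := leP c z.
  by rewrite (le_trans cz zx) (Rint_split lq Ec Ex (x:=z)) ?cz//; ring.
have [cx|xc] := leP c x.
  by rewrite (Rint_split lq Ez Ex (x:=c)) ?(ltW zc)//; ring.
by rewrite (Rint_split lq Ez Ec (x:=x)) ?zx ?ltW//; ring.
Qed.

Definition common_atom_free mu nu := forall x, E x -> (mu [set x] * nu [set x] = 0)%E.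

Lemma itv_fin mu c d : loc_finite a b mu -> E c -> E d -> (mu (`[c, d[ : set R) < +oo)%E.
Proof.
move=> fm Ec Ed; apply: le_lt_trans (fm _ _ Ec Ed); apply: le_measure; try exact/mem_set.
by apply: subset_itvl; rewrite bnd_simp.
Qed.

Lemma itv_sub c d : E c -> E d -> (`[c, d[ : set R) `<=` E.
Proof.
by move=> Ec Ed; apply: subset_trans (Iab_sub Ec Ed); apply: subset_itvl; rewrite bnd_simp.
Qed.

(** [integration_by_parts] deals with the primitive h - h(c) of h1; adding h(c) times the integral
    of q to both sides restores h. *)
Lemma ibp_RD mu nu h h1 q c d : loc_finite a b mu -> loc_finite a b nu ->
  common_atom_free mu nu -> RD a b mu h h1 -> loci a b nu q -> E c -> E d -> c <= d ->
  h d * \int[nu]_(x in `[c, d[) q x =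
  \int[nu]_(x in `[c, d[) (h x * q x) + \int[mu]_(x in `[c, d[) (prim nu q c x * h1 x).
Proof.
move=> fm fn mn dh lq Ec Ed cd; have [lh hE] := dh.
have := @integration_by_parts R mu nu c d h1 q (itv_fin fm Ec Ed) (itv_fin fn Ec Ed)
  (loci_co lh Ec Ed) (loci_co lq Ec Ed).
move=> /(_ (fun x cx => mn _ (itv_sub Ec Ed cx))) ibp.
rewrite (hE c d)// mulrDl ibp addrA; congr (_ + _); last first.
  apply: eq_Rint => x; rewrite /= in_itv /= => /andP[cx _].
  by rewrite /prim cx.
rewrite -(RintegralZl (h c) (measurable_itv _) (loci_co lq Ec Ed)).
rewrite -RintegralD//; last 2 first.
- by apply: intgZ => //; exact: loci_co lq Ec Ed.
- have bh : loc_bounded a b (fun x => h x - h c).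
    have [mh bh] := RD_loc_bounded fm dh; split; first exact: measurable_funB.
    move=> c' d' Ec' Ed'; have [M hM] := bh _ _ Ec' Ed'; exists (M + `|h c|) => x cxd.
    by apply: le_trans (ler_normB _ _) _; rewrite lerD2r hM.
  apply: intg_eq (loci_co (loci_mul bh lq) Ec Ed) => // x; rewrite /= in_itv /= => /andP[cx xd].
  by rewrite (hE c x)//; [rewrite addrAC subrr add0r|
    exact: (Iab_conv Ec Ed (introT andP (conj cx (ltW xd))))].
apply: eq_Rint => x; rewrite /= in_itv /= => /andP[cx xd].
rewrite (hE c x)//; last exact: (Iab_conv Ec Ed (introT andP (conj cx (ltW xd)))).
by rewrite mulrDl.
Qed.

End primitives.

(** * Quasi-derivatives and their weak characterization *)

Section strong.
Variables (R : realType) (a b : \bar R) (rp rn sg chi : {measure set R -> \bar R}).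
Local Notation E := (Iab a b).
Hypothesis frp : loc_finite a b rp.
Hypothesis frn : loc_finite a b rn.
Hypothesis fsg : loc_finite a b sg.
Hypothesis fchi : loc_finite a b chi.
Hypothesis sgchi : common_atom_free a b sg chi.
Hypothesis sgrp : common_atom_free a b sg rp.
Hypothesis sgrn : common_atom_free a b sg rn.
Implicit Types f g h t : R -> R.
Local Notation RH1 := (RH1 a b sg chi).
Local Notation RD := (RD a b).
Local Notation loci := (loci a b).
Let mE : measurable E. Proof. exact: measurable_Iab. Qed.

Definition rho_int D t := \int[rp]_(x in D) t x - \int[rn]_(x in D) t x.

Definition locs t := loci rp t /\ loci rn t.

(* [f1] is the quasi-derivative of [f] and [tau f = t]. *)
Definition RS f f1 t := [/\ loci chi f, locs t & forall c x, E c -> E x -> c <= x ->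
  f1 x = f1 c + \int[chi]_(y in `[c, x[) f y - rho_int `[c, x[ t].

Lemma rho_int_split t c x d : locs t -> E c -> E d -> c <= x <= d ->
  rho_int `[c, d[ t = rho_int `[c, x[ t + rho_int `[x, d[ t.
Proof.
move=> [lp ln] Ec Ed cxd.
by rewrite /rho_int (Rint_split lp Ec Ed cxd) (Rint_split ln Ec Ed cxd); ring.
Qed.

Lemma rho_int_eq D t t' : (forall x, D x -> t x = t' x) -> rho_int D t = rho_int D t'.
Proof. by move=> tt; congr (_ - _); exact: eq_Rint. Qed.

Lemma rho_int0 D t : (forall x, D x -> t x = 0) -> rho_int D t = 0.
Proof.
move=> t0; rewrite (rho_int_eq t0) /rho_int /Rintegral.
by rewrite !integral0 subrr.
Qed.

(** The solution of the equation for the quasi-derivative that vanishes at c; all others differ from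
    it by a constant. *)
Definition sprim f t c x := prim chi f c x - prim rp t c x + prim rn t c x.

Lemma sprim_RS f t c : E c -> loci chi f -> locs t -> RS f (sprim f t c) t.
Proof.
move=> Ec lf lt; split => // z x Ez Ex zx; have [lp ln] := lt.
have [_ h1] := prim_RD Ec lf; have [_ h2] := prim_RD Ec lp; have [_ h3] := prim_RD Ec ln.
by rewrite /sprim (h1 z x)// (h2 z x)// (h3 z x)// /rho_int; ring.
Qed.

Lemma RS_sprim f f1 t c x : RS f f1 t -> E c -> E x -> f1 x = f1 c + sprim f t c x.
Proof.
move=> [_ _ h] Ec Ex; rewrite /sprim /prim; case: (leP c x) => [cx|/ltW xc].
  by rewrite (h c x)// /rho_int; ring.
by rewrite (h x c)// /rho_int; ring.
Qed.

Lemma sprim_loc_bounded f t c : E c -> loci chi f -> locs t -> loc_bounded a b (sprim f t c).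
Proof.
move=> Ec lf [lp ln].
have [m1 b1] := RD_loc_bounded fchi (prim_RD Ec lf).
have [m2 b2] := RD_loc_bounded frp (prim_RD Ec lp).
have [m3 b3] := RD_loc_bounded frn (prim_RD Ec ln).
split; first by apply: measurable_funD => //; exact: measurable_funB.
move=> p q Ep Eq; have [M1 h1] := b1 _ _ Ep Eq; have [M2 h2] := b2 _ _ Ep Eq.
have [M3 h3] := b3 _ _ Ep Eq; exists (M1 + M2 + M3) => x pxq.
apply: le_trans (ler_normD _ _) _; apply: lerD; last exact: h3.
by apply: le_trans (ler_normB _ _) _; apply: lerD; [exact: h1|exact: h2].
Qed.

Lemma locs_mul h t : loc_bounded a b h -> locs t -> locs (fun x => h x * t x).
Proof. by move=> bh [lp ln]; split; exact: loci_mul. Qed.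

(** The product rule d(f1 h) = f h dchi + f1 h1 dsg - t h drho, integrated over [c, d[. It combines
    [ibp_RD] for [chi], [rp] and [rn], none of which shares an atom with [sg]. *)
Lemma ibp_RS f f1 t h h1 c d : RS f f1 t -> RD sg h h1 -> E c -> E d -> c <= d ->
  f1 d * h d - f1 c * h c =
  \int[chi]_(x in `[c, d[) (f x * h x) + \int[sg]_(x in `[c, d[) (f1 x * h1 x)
   - rho_int `[c, d[ (fun x => t x * h x).
Proof.
move=> rs dh Ec Ed cd; have [lf [lp ln] fE] := rs; have [lh hE] := dh.
have i1 := ibp_RD fsg fchi sgchi dh lf Ec Ed cd.
have i2 := ibp_RD fsg frp sgrp dh lp Ec Ed cd.
have i3 := ibp_RD fsg frn sgrn dh ln Ec Ed cd.
have ip (nu : {measure set R -> \bar R}) q : loc_finite a b nu -> loci nu q ->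
    intg sg `[c, d[ (fun x => prim nu q c x * h1 x).
  move=> fn lq; apply: (loci_co _ Ec Ed); apply: loci_mul => //.
  exact: RD_loc_bounded fn (prim_RD Ec lq).
have fl : \int[sg]_(x in `[c, d[) (f1 x * h1 x) = f1 c * (h d - h c) +
    (\int[sg]_(x in `[c, d[) (prim chi f c x * h1 x)
     - \int[sg]_(x in `[c, d[) (prim rp t c x * h1 x)
     + \int[sg]_(x in `[c, d[) (prim rn t c x * h1 x)).
  have -> : h d - h c = \int[sg]_(x in `[c, d[) h1 x by rewrite (hE c d)//; ring.
  have i0 := loci_co lh Ec Ed.
  rewrite -RintegralZl// -RintegralB//; try exact: ip.
  rewrite -RintegralD//; try exact: ip; last by apply: intgB => //; exact: ip.
  rewrite -RintegralD//; last 2 first.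
  - exact: intgZ.
  - by apply: intgD => //; [apply: intgB => //; exact: ip|exact: ip].
  apply: eq_Rint => x; rewrite /= in_itv /= => /andP[cx xd].
  rewrite (RS_sprim rs Ec); last exact: (Iab_conv Ec Ed (introT andP (conj cx (ltW xd)))).
  by rewrite /sprim; ring.
rewrite fl (fE c d)// /rho_int.
have e (nu : {measure set R -> \bar R}) q :
    \int[nu]_(x in `[c, d[) (q x * h x) = \int[nu]_(x in `[c, d[) (h x * q x).
  by apply: eq_Rint => x _; rewrite mulrC.
rewrite !e; move: i1 i2 i3.
set X1 := \int[chi]_(_ in _) f _; set X2 := \int[rp]_(_ in _) t _; set X3 := \int[rn]_(_ in _) t _.
move=> i1 i2 i3.
have -> : (f1 c + X1 - (X2 - X3)) * h d = f1 c * h d + h d * X1 - h d * X2 + h d * X3 by ring.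
by rewrite i1 i2 i3; ring.
Qed.

(* Test functions: the integrals of step functions with two steps and zero mean. *)
Definition test h h1 c d := [/\ RH1 h h1, forall x, E x -> x <= c -> h x = 0,
  forall x, E x -> d <= x -> h x = 0 & forall x, (x < c) || (d <= x) -> h1 x = 0].

Lemma test_ip f f1 h h1 c d : E c -> E d -> test h h1 c d ->
  realip a b sg chi f f1 h h1 =
  \int[chi]_(x in `[c, d[) (f x * h x) + \int[sg]_(x in `[c, d[) (f1 x * h1 x).
Proof.
move=> Ec Ed [_ hc hd h1cd]; rewrite /realip; congr (_ + _); apply: Rint_supp; try exact: itv_sub.
- move=> x Ex; rewrite /= in_itv /= => /negP; rewrite negb_and -leNgt -ltNge.
  by move=> /orP[/ltW xc|dx]; [rewrite hc// mulr0|rewrite hd// mulr0].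
- move=> x Ex; rewrite /= in_itv /= => /negP; rewrite negb_and -leNgt -ltNge => xcd.
  by rewrite h1cd// mulr0.
Qed.

Lemma RS_weak f f1 t h h1 c d : RS f f1 t -> E c -> E d -> c <= d -> test h h1 c d ->
  realip a b sg chi f f1 h h1 = rho_int `[c, d[ (fun x => t x * h x).
Proof.
move=> rs Ec Ed cd th; have [[dh _] hc hd h1cd] := th.
have := ibp_RS rs dh Ec Ed cd.
rewrite (hc c)// (hd d)// !mulr0 subrr (test_ip _ _ Ec Ed th) => /esym/eqP.
by rewrite subr_eq0 => /eqP.
Qed.

Lemma ind_int (mu : {measure set R -> \bar R}) (D P : set R) (phi : R -> R) : P `<=` D ->
  \int[mu]_(x in D) (phi x * \1_P x) = \int[mu]_(x in P) phi x :> R.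
Proof.
move=> PD; rewrite (Rint_supp mu PD); last first.
  by move=> x _ nP; rewrite indicE memNset// mulr0.
by apply: eq_Rint => x Px; rewrite indicE mem_set// mulr1.
Qed.

Hypothesis sg_supp : forall c d, E c -> E d -> c < d -> (0 < sg `]c, d[)%E.

Let S p q := fine (sg (`[p, q[ : set R)).

Let S_gt0 p q : E p -> E q -> p < q -> 0 < S p q.
Proof.
move=> Ep Eq pq; rewrite /S fine_gt0// (itv_fin fsg Ep Eq) andbT.
apply: lt_le_trans (sg_supp Ep Eq pq) _; apply: le_measure; try exact/mem_set.
by apply: subset_itvr; rewrite bnd_simp.
Qed.

Let loci_ind p q : E p -> E q -> loci sg (\1_(`[p, q[ : set R)).
Proof.
move=> Ep Eq; apply: loci_bounded => //; split; first exact: measurable_indic.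
move=> c d _ _; exists 1 => x _; rewrite indicE.
by case: (_ \in _); rewrite ?normr1 ?normr0.
Qed.

(** Each indicator is weighted by the mass of the other interval, so the total [sg]-integral is 0
    and the primitive vanishes again to the right. *)
Let stp r s p q x : R := S r s * \1_(`[p, q[ : set R) x - S p q * \1_(`[r, s[ : set R) x.

Lemma exists_test p q r s c d : E c -> E d -> c <= d -> c <= p -> p <= q -> q <= d ->
  c <= r -> r <= s -> s <= d ->
  exists h, test h (stp r s p q) c d.
Proof.
move=> Ec Ed cd cp pq qd cr rs sd.
have Ep : E p by apply: (Iab_conv Ec Ed); rewrite cp (le_trans pq).
have Eq : E q by apply: (Iab_conv Ec Ed); rewrite qd (le_trans cp).
have Er : E r by apply: (Iab_conv Ec Ed); rewrite cr (le_trans rs).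
have Es : E s by apply: (Iab_conv Ec Ed); rewrite sd (le_trans cr).
pose h1 := stp r s p q; rewrite -/h1.
have lh1 : loci sg h1.
  (* [loci_lin] forms h + t k, so a multiple s k is written as k + (s - 1) k. *)
  have := loci_lin (- 1) (loci_lin (S r s - 1) (loci_ind Ep Eq) (loci_ind Ep Eq))
    (loci_lin (S p q - 1) (loci_ind Er Es) (loci_ind Er Es)).
  by congr loci; apply/funext => x; rewrite /h1 /stp; ring.
have h1out x : (x < c) || (d <= x) -> h1 x = 0.
  move=> xcd; rewrite /h1 /stp !indicE !memNset ?mulr0 ?subrr//= in_itv /= => /andP[h2 h3].
    by case/orP: xcd => h4;
      [have := le_lt_trans (le_trans cr h2) h4|have := lt_le_trans h3 (le_trans sd h4)]; rewrite ltxx.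
  by case/orP: xcd => h4;
      [have := le_lt_trans (le_trans cp h2) h4|have := lt_le_trans h3 (le_trans qd h4)]; rewrite ltxx.
have sub (u v x : R) : c <= u -> v <= x -> (`[u, v[ : set R) `<=` `[c, x[.
  by move=> cu vx; apply: subset_itv; rewrite bnd_simp.
have int1 x : E x -> d <= x -> \int[sg]_(y in `[c, x[) h1 y = 0.
  move=> Ex dx; rewrite /h1 /stp.
  have ii u v : E u -> E v -> intg sg `[c, x[ (\1_(`[u, v[ : set R)).
    by move=> Eu Ev; exact: (loci_co (loci_ind Eu Ev) Ec Ex).
  have iv u v : E u -> E v -> c <= u -> v <= d ->
      \int[sg]_(y in `[c, x[) (\1_(`[u, v[ : set R) y) = S u v.
    move=> Eu Ev cu vd; transitivity (\int[sg]_(y in `[c, x[) (1 * \1_(`[u, v[ : set R) y)).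
      by apply: eq_Rint => y _; rewrite mul1r.
    rewrite (ind_int _ (fun=> 1)); last by apply: sub => //; exact: le_trans vd dx.
    by rewrite Rintegral_cst// mul1r.
  rewrite RintegralB//; try by apply: intgZ => //; exact: ii.
  by rewrite !RintegralZl//; try exact: ii; rewrite !iv//; ring.
have dh := prim_RD Ec lh1.
have hc x : E x -> x <= c -> prim sg h1 c x = 0.
  move=> Ex xc; rewrite /prim; case: ifPn => [cx|_].
    by rewrite set_itv_ge ?bnd_simp -?leNgt// Rintegral_set0.
  apply/eqP; rewrite oppr_eq0; apply/eqP.
  rewrite (@eq_Rint _ _ _ sg _ _ (cst 0)); first by rewrite Rintegral_cst// mul0r.
  by move=> y; rewrite /= in_itv /= => /andP[_ yc]; rewrite h1out// yc.
have hd x : E x -> d <= x -> prim sg h1 c x = 0.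
  by move=> Ex dx; rewrite /prim (le_trans cd dx) int1.
have cdE := itv_sub Ec Ed.
have out x : E x -> ~ (`[c, d[ : set R) x -> (x < c) || (d <= x).
  by move=> Ex; rewrite /= in_itv /= => /negP; rewrite negb_and -leNgt -ltNge.
exists (prim sg h1 c); split => //; split => //; split.
- have [mh bh] := RD_loc_bounded fsg dh; have [M hM] := bh _ _ Ec Ed.
  apply: (L2_supp mE _ cdE) => //.
    by move=> x Ex /(out _ Ex)/orP[/ltW xc|dx]; [exact: hc|exact: hd].
  apply: (@L2_bounded _ _ _ _ _ _ M) => //; first exact: (itv_fin fchi Ec Ed).
    exact: measurable_funS mh.
  by move=> x; rewrite /= in_itv /= => /andP[cx xd]; apply: hM; rewrite cx ltW.
- apply: (L2_supp mE _ cdE) => //; first by move=> x Ex /(out _ Ex)/h1out.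
  have mh1 := loci_meas lh1.
  apply: (@L2_bounded _ _ _ _ _ _ (`|S r s| + `|S p q|)) => //; first exact: (itv_fin fsg Ec Ed).
    exact: measurable_funS mh1.
  move=> x _; apply: le_trans (ler_normB _ _) _.
  by apply: lerD; rewrite normrM ler_piMr// indicE; case: (_ \in _); rewrite ?normr1 ?normr0.
Qed.

Lemma RD_ae f f1 g1 : RD sg f f1 -> loci sg g1 -> {ae sg, forall x, E x -> f1 x = g1 x} ->
  RD sg f g1.
Proof.
move=> [lf fE] lg fg; split => // c x Ec Ex cx; rewrite (fE c x)//; congr (_ + _).
apply: Rint_ae_eq => //; [exact: intg_meas (loci_co lf Ec Ex)|exact: intg_meas (loci_co lg Ec Ex)|].
by apply: filterS fg => y h /(itv_sub Ec Ex); exact: h.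
Qed.

Lemma RH1_ae f f1 g1 : RH1 f f1 -> RD sg f g1 -> RH1 f g1 /\
  forall h h1, RH1 h h1 -> realip a b sg chi f g1 h h1 = realip a b sg chi f f1 h h1.
Proof.
move=> [df [lf lf1]] dg; have fg := RD_unique df dg.
have lg1 : L2 sg E g1 by apply: L2_ae fg lf1 => //; case: dg => /loci_meas.
split=> // h h1 [_ [lh lh1]]; congr (_ + _).
apply: Rint_ae_eq => //.
- by apply: measurable_funM; [case: lg1|case: lh1].
- by apply: measurable_funM; [case: lf1|case: lh1].
- by apply: filterS fg => y H Ey; rewrite H.
Qed.

(** Fundamental lemma of the calculus of variations. The difference phi of f1 and a solution G of
    the equation is orthogonal to the two-step functions of zero mean, so its mean over any interval
    equals that over [c0, d0[; hence phi is a constant k almost everywhere, and k + G is the wanted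
    version of the derivative. One step is always [c0, d0[, so tests on intervals containing [c0,
    d0[ suffice. *)
Lemma weak_RS f f1 t c0 d0 : E c0 -> E d0 -> c0 < d0 -> RH1 f f1 -> locs t ->
  (forall c d h h1, E c -> E d -> c <= c0 -> d0 <= d -> test h h1 c d ->
    realip a b sg chi f f1 h h1 = rho_int `[c, d[ (fun x => t x * h x)) ->
  exists2 g1, RH1 f g1 /\ RS f g1 t &
    forall h h1, RH1 h h1 -> realip a b sg chi f g1 h h1 = realip a b sg chi f f1 h h1.
Proof.
move=> Ec0 Ed0 cd0 hf lt wk; have [df [lf lf1]] := hf; have [l1 fE] := df.
have lcf : loci chi f by apply: loci_bounded => //; exact: RD_loc_bounded fsg df.
pose G := sprim f t c0.
have bG : loc_bounded a b G by exact: sprim_loc_bounded.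
have lG : loci sg G by exact: loci_bounded.
pose phi x := f1 x + (-1) * G x.
have lphi : loci sg phi by exact: loci_lin.
have key p q : E p -> E q -> p <= q ->
    S c0 d0 * \int[sg]_(x in `[p, q[) phi x = S p q * \int[sg]_(x in `[c0, d0[) phi x.
  (* The interval [c, d[ contains both the reference interval and [p, q[. *)
  move=> Ep Eq pq; pose c := Num.min c0 p; pose d := Num.max d0 q.
  have Ec : E c by rewrite /c; case: ltP.
  have Ed : E d by rewrite /d; case: ltP.
  have cc0 : c <= c0 by rewrite ge_min lexx.
  have cp : c <= p by rewrite ge_min lexx orbT.
  have dd0 : d0 <= d by rewrite le_max lexx.
  have qd : q <= d by rewrite le_max lexx orbT.
  have cd : c <= d by rewrite (le_trans cp)// (le_trans pq).
  have [h th] := exists_test Ec Ed cd cp pq qd cc0 (ltW cd0) dd0.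
  have w := wk _ _ _ _ Ec Ed cc0 dd0 th.
  have rs := sprim_RS Ec0 lcf lt.
  have := RS_weak rs Ec Ed cd th; rewrite -w (test_ip _ _ Ec Ed th) (test_ip _ _ Ec Ed th).
  move=> /addrI; rewrite -/G; set h1 := stp _ _ _ _ => GE.
  have i (g : R -> R) u v : loci sg g -> E u -> E v ->
      intg sg `[c, d[ (fun x => g x * \1_(`[u, v[ : set R) x).
    move=> lg Eu Ev; apply: intg_eq (loci_co (loci_mul _ lg) Ec Ed) => //.
      by move=> x _; rewrite mulrC.
    split; first exact: measurable_indic.
    move=> z1 z2 _ _; exists 1 => x _; rewrite indicE.
    by case: (_ \in _); rewrite ?normr1 ?normr0.
  have split_int g : loci sg g -> \int[sg]_(x in `[c, d[) (g x * h1 x) =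
      S c0 d0 * \int[sg]_(x in `[p, q[) g x - S p q * \int[sg]_(x in `[c0, d0[) g x.
    move=> lg.
    rewrite (@eq_Rint _ _ _ sg _ _ (fun x => S c0 d0 * (g x * \1_(`[p, q[ : set R) x)
      - S p q * (g x * \1_(`[c0, d0[ : set R) x))); last by move=> x _; rewrite /h1 /stp; ring.
    rewrite RintegralB//; try by apply: intgZ => //; exact: i.
    rewrite !RintegralZl//; try exact: i.
    by rewrite !ind_int//; apply: subset_itv; rewrite bnd_simp.
  move: GE; rewrite !split_int// /phi !Rint_lin//; try by [exact: (loci_co lG)|exact: (loci_co l1)].
  by move=> GE; lra.
pose k := (\int[sg]_(x in `[c0, d0[) phi x) / S c0 d0.
have S0 := S_gt0 Ec0 Ed0 cd0.
have phik : {ae sg, forall x, E x -> phi x = k}.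
  apply: ae_on_Iab => p q Ep Eq.
  have lk : loci sg (cst k).
    apply: loci_bounded => //; split => // z1 z2 _ _.
    by exists `|k|.
  have H := @primitive_unique R sg p q (fun x => phi x + (-1) * cst k x).
  have : {ae sg, forall x, `[p, q[ x -> phi x + (-1) * cst k x = 0}; first apply: H.
  - exact: (loci_co (loci_lin _ lphi lk) Ep Eq).
  - move=> x pxq; have Ex := Iab_conv Ep Eq pxq; have /andP[px xq] := pxq.
    rewrite Rint_lin//; [|exact: (loci_co lphi)|exact: (loci_co lk)].
    rewrite Rintegral_cst//; have := key p x Ep Ex px.
    rewrite /k /S => e; apply: (mulfI (lt0r_neq0 S0)).
    by rewrite mulrDr e /S; field; exact: lt0r_neq0.
  apply: filterS => x h1 pxq; have := h1 pxq; rewrite mulN1r => /subr0_eq; exact.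
pose g1 x := k + G x.
have bg : loc_bounded a b g1.
  have [mG hG] := bG; split; first exact: measurable_funD.
  move=> p q Ep Eq; have [M hM] := hG _ _ Ep Eq; exists (`|k| + M) => x pxq.
  by apply: le_trans (ler_normD _ _) _; rewrite lerD2l hM.
have dg : RD sg f g1.
  apply: (RD_ae df); first exact: loci_bounded.
  by apply: filterS phik => x h Ex; have := h Ex; rewrite /phi /g1 => <-; ring.
have [hg ipg] := RH1_ae hf dg.
exists g1 => //; split => //; split => // c x Ec Ex cx.
have [_ _ h] := sprim_RS Ec0 lcf lt.
by rewrite /g1 /G (h c x)//; ring.
Qed.

End strong.

(** * The real relation and its adjoint *)

Section real_relation.
Variables (R : realType) (a b : \bar R) (rp rn sg chi : {measure set R -> \bar R}).
Local Notation E := (Iab a b).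
Hypothesis ab : (a < b)%E.
Hypothesis frp : loc_finite a b rp.
Hypothesis frn : loc_finite a b rn.
Hypothesis fsg : loc_finite a b sg.
Hypothesis fchi : loc_finite a b chi.
Hypothesis sgchi : common_atom_free a b sg chi.
Hypothesis sgrp : common_atom_free a b sg rp.
Hypothesis sgrn : common_atom_free a b sg rn.
Hypothesis sg_supp : forall c d, E c -> E d -> c < d -> (0 < sg `]c, d[)%E.
Hypothesis chiE : chi E <> 0%E.
Implicit Types f g h t u v : R -> R.
Local Notation RH1 := (RH1 a b sg chi).
Local Notation RD := (RD a b).
Local Notation loci := (loci a b).
Local Notation locs := (locs a b rp rn).
Local Notation RS := (RS a b rp rn chi).
Local Notation Srho := (rho_int rp rn).
Local Notation ip := (realip a b sg chi).
Local Notation n2 := (sqnorm a b sg chi).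
Local Notation test := (test a b sg chi).
Local Notation bounded_functional := (bounded_functional a b sg chi).
Let mE : measurable E. Proof. exact: measurable_Iab. Qed.

Lemma RH1_bounded u u1 : RH1 u u1 -> loc_bounded a b u.
Proof. by move=> [du _]; exact: RD_loc_bounded fsg du. Qed.

Lemma RH1_loci u u1 (nu : {measure set R -> \bar R}) : loc_finite a b nu -> RH1 u u1 -> loci nu u.
Proof. by move=> fn hu; apply: loci_bounded => //; exact: RH1_bounded hu. Qed.

Lemma RH1_locs u u1 : RH1 u u1 -> locs u.
Proof. by move=> hu; split; exact: RH1_loci hu. Qed.

Lemma bounded_functional_add l k : bounded_functional l -> bounded_functional k ->
  bounded_functional (fun u u1 => l u u1 + k u u1).
Proof.
move=> [ll [M M0 lM]] [kl [N N0 kN]]; split.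
  by move=> f f1 g g1 t hf hg; rewrite ll// kl//; ring.
exists (2 * M + 2 * N) => [|f f1 hf]; first by rewrite addr_ge0// mulr_ge0.
have := lM _ _ hf; have := kN _ _ hf; have := sqr_ge0 (l f f1 - k f f1); nra.
Qed.

Lemma bounded_functional_scale l (k : R) : bounded_functional l -> bounded_functional (fun u u1 => k * l u u1).
Proof.
move=> [ll [M M0 lM]]; split.
  by move=> f f1 g g1 t hf hg; rewrite ll//; ring.
exists (k ^+ 2 * M) => [|f f1 hf]; first by rewrite mulr_ge0// sqr_ge0.
rewrite exprMn -(mulrA (k ^+ 2)); apply: ler_wpM2l; first exact: sqr_ge0.
exact: lM.
Qed.

Lemma bounded_functional_eval c : E c -> bounded_functional (fun u u1 => u c).
Proof.
move=> Ec; split => //; have [C C0 HC] := sup_bound fsg fchi chiE ab Ec Ec.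
by exists C => // f f1 hf; apply: (HC _ _ hf); rewrite !lexx.
Qed.

(** The integral is at most that of |p| times the supremum of |u| over [c, d], which [sup_bound]
    controls by the norm. *)
Lemma bounded_functional_int (nu : {measure set R -> \bar R}) p c d :
  loc_finite a b nu -> loci nu p -> E c -> E d ->
  bounded_functional (fun u u1 => \int[nu]_(x in `[c, d[) (p x * u x)).
Proof.
move=> fn lp Ec Ed.
have ipu u u1 : RH1 u u1 -> intg nu `[c, d[ (fun x => p x * u x).
  move=> hu; apply: intg_eq (loci_co (loci_mul (RH1_bounded hu) lp) Ec Ed) => // x _.
  by rewrite mulrC.
split.
  move=> f f1 g g1 t hf hg.
  rewrite -(Rint_lin t (measurable_itv _) (ipu _ _ hf) (ipu _ _ hg)).
  by apply: eq_Rint => x _; ring.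
have [C C0 HC] := sup_bound fsg fchi chiE ab Ec Ed.
pose P := \int[nu]_(x in `[c, d[) `|p x|.
have P0 : 0 <= P by exact: Rintegral_ge0.
exists (P ^+ 2 * C) => [|f f1 hf]; first by rewrite mulr_ge0// sqr_ge0.
pose m := Num.sqrt (C * n2 f f1).
have Cn : 0 <= C * n2 f f1 by rewrite mulr_ge0// sqnorm_ge0.
have fm x : c <= x <= d -> `|f x| <= m.
  move=> cxd; rewrite -ler_sqr ?nnegrE ?sqrtr_ge0// real_normK ?num_real// sqr_sqrtr//.
  exact: HC.
have ipn : intg nu `[c, d[ (fun x => `|p x|).
  by apply: integrable_norm; exact: (loci_co lp Ec Ed).
have : `|\int[nu]_(x in `[c, d[) (p x * f x)| <= P * m.
  apply: le_trans (le_normr_Rintegral _ (ipu _ _ hf)) _ => //.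
  rewrite mulrC -RintegralZl//; apply: le_Rintegral => //.
  - by apply: integrable_norm; exact: ipu hf.
  - exact: intgZ.
  - move=> x; rewrite /= in_itv /= => /andP[cx xd]; rewrite normrM mulrC ler_wpM2r//.
    by apply: fm; rewrite cx ltW.
rewrite -ler_sqr ?nnegrE ?mulr_ge0 ?sqrtr_ge0// real_normK ?num_real// => /le_trans; apply.
by rewrite exprMn sqr_sqrtr// mulrA.
Qed.

Lemma bounded_functional_rho_int p c d : locs p -> E c -> E d ->
  bounded_functional (fun u u1 => Srho `[c, d[ (fun x => p x * u x)).
Proof.
move=> [lp ln] Ec Ed; have := bounded_functional_add (bounded_functional_int frp lp Ec Ed)
  (bounded_functional_scale (-1) (bounded_functional_int frn ln Ec Ed)).
by congr bounded_functional; apply/funext => u; apply/funext => u1; rewrite mulN1r.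
Qed.

Lemma bounded_functional_realip D f f1 : measurable D -> D `<=` E -> RH1 f f1 ->
  bounded_functional (fun u u1 => \int[chi]_(x in D) (f x * u x) + \int[sg]_(x in D) (f1 x * u1 x)).
Proof.
move=> mD DE [_ [lf lf1]].
have piece (nu : {measure set R -> \bar R}) p : L2 nu E p ->
  (forall v w (s : R), L2 nu E v -> L2 nu E w -> \int[nu]_(x in D) (p x * (v x + s * w x)) =
    \int[nu]_(x in D) (p x * v x) + s * \int[nu]_(x in D) (p x * w x)) /\
  (forall v, L2 nu E v -> (\int[nu]_(x in D) (p x * v x)) ^+ 2 <=
     \int[nu]_(x in D) (p x ^+ 2) * \int[nu]_(x in E) (v x ^+ 2)).
  move=> lp; have lpD : L2 nu D p by exact: L2S lp.
  split=> [v w s lv lw|v lv].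
    have lvD : L2 nu D v by exact: L2S lv.
    have lwD : L2 nu D w by exact: L2S lw.
    rewrite -Rint_lin//; try exact: L2_prod.
    by apply: eq_Rint => x _; ring.
  have lvD : L2 nu D v by exact: L2S lv.
  apply: le_trans (cauchy_schwarz mD lpD lvD) _; rewrite ler_wpM2l ?L2_sqr_ge0//.
  by apply: Rint0_setS => //; [case: lv|move=> x _; exact: sqr_ge0].
have [l1 b1] := piece _ _ lf; have [l2 b2] := piece _ _ lf1.
split.
  by move=> g g1 h h1 t [_ [lg lg1]] [_ [lh lh1]]; rewrite l1// l2//; ring.
exists (2 * \int[chi]_(x in D) (f x ^+ 2) + 2 * \int[sg]_(x in D) (f1 x ^+ 2)).
  by rewrite addr_ge0// mulr_ge0// L2_sqr_ge0.
move=> g g1 [_ [lg lg1]]; have := b1 _ lg; have := b2 _ lg1; rewrite /sqnorm.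
set A1 := \int[chi]_(x in D) (f x ^+ 2); set A2 := \int[sg]_(x in D) (f1 x ^+ 2).
set B1 := \int[chi]_(x in E) (g x ^+ 2); set B2 := \int[sg]_(x in E) (g1 x ^+ 2).
have : 0 <= A1 * B2 by rewrite mulr_ge0// L2_sqr_ge0.
have : 0 <= A2 * B1 by rewrite mulr_ge0// L2_sqr_ge0.
set X := \int[chi]_(x in D) _; set Y := \int[sg]_(x in D) _.
have := sqr_ge0 (X - Y); nra.
Qed.

(* The real part of [Tmax]: with [rp, rn, sg, chi] real, real and imaginary parts decouple. *)
Definition RT f ft := exists f1 ft1, [/\ RH1 f f1, RH1 ft ft1 & RS f f1 ft].

Lemma RT_closed (F T : nat -> R -> R) (F1 T1 : nat -> R -> R) f f1 t t1 :
  (forall n, RT (F n) (T n)) -> (forall n, RH1 (F n) (F1 n)) -> (forall n, RH1 (T n) (T1 n)) ->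
  RH1 f f1 -> RH1 t t1 ->
  (forall e, 0 < e -> exists n,
    n2 (fun x => F n x - f x) (fun x => F1 n x - f1 x) <= e /\
    n2 (fun x => T n x - t x) (fun x => T1 n x - t1 x) <= e) ->
  RT f t.
Proof.
move=> hFT hF hT hf ht cv.
have [c0 [d0 [c0d0E _]]] := Iab_exhaust ab; have [Ec0 Ed0 cd0] := c0d0E 0%N.
have [|g1 [hg rs] _] := weak_RS frp frn fsg fchi sgchi sgrp sgrn sg_supp Ec0 Ed0 cd0 hf (RH1_locs ht);
  last by exists g1, t1; split.
move=> c d h h1 Ec Ed cc0 d0d th; have [hh _ _ _] := th.
have cd : c <= d by rewrite (le_trans cc0)// (le_trans (ltW cd0)).
have [Ll [M M0 LM]] := bounded_functional_rho_int (RH1_locs hh) Ec Ed.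
have eqn n : ip (F n) (F1 n) h h1 = Srho `[c, d[ (fun x => h x * T n x).
  have [g1 [gt1 [hg _ rs]]] := hFT n.
  rewrite ((RH1_ae hg (hF n).1).2 _ _ hh).
  rewrite (RS_weak frp frn fsg fchi sgchi sgrp sgrn rs Ec Ed cd th).
  by apply: rho_int_eq => x _; rewrite mulrC.
rewrite (rho_int_eq _ _ (fun x _ => mulrC (t x) (h x))).
pose D := ip f f1 h h1 - Srho `[c, d[ (fun x => h x * t x).
suff D0 : D = 0 by apply/eqP; rewrite -subr_eq0; apply/eqP.
pose N := n2 h h1.
have N0 : 0 <= N by exact: sqnorm_ge0.
apply/eqP; apply: contrapT => /negP Dn0.
have D2 : 0 < D ^+ 2 by rewrite lt_def sqr_ge0 sqrf_eq0 Dn0.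
(* Continuity of both sides of the weak equation gives D^2 <= 2 e (N + M), whereas this e satisfies
   D^2 = 4 e (N + M + 1). *)
have e0 : 0 < D ^+ 2 / (4 * (N + M + 1)) by rewrite divr_gt0// mulr_gt0// ltr_wpDl// addr_ge0.
have [n [nF nT]] := cv _ e0; set e := _ / _ in e0 nF nT.
have lin1 (p q : R -> R) : (fun x => p x - q x) = (fun x => p x + (-1) * q x).
  by apply/funext => x; rewrite mulN1r.
rewrite !lin1 in nF nT.
have hF' := RH1_lin (-1) (hF n) hf; have hT' := RH1_lin (-1) (hT n) ht.
have k1 := realip_cauchy_schwarz hF' hh; have k2 := LM _ _ hT'.
rewrite (realipDl (-1) (hF n) hf hh) eqn in k1.
rewrite (Ll _ _ _ _ (-1) (hT n) ht) in k2.
move: k1 k2; rewrite -/N.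
set A := Srho _ (fun x => h x * T n x); set B := Srho _ (fun x => h x * t x) in D Dn0 D2 e e0 nF nT *.
set C := ip f f1 h h1 in D Dn0 D2 e e0 nF nT *.
set n1 := n2 _ _ in nF *; set n2' := n2 _ _ in nT *.
move=> k1 k2.
have : D ^+ 2 <= 2 * (e * N) + 2 * (M * e).
  have h1' : n1 * N <= e * N by rewrite ler_wpM2r.
  have h2' : M * n2' <= M * e by rewrite ler_wpM2l.
  have := sqr_ge0 (A + -1 * C + (A + -1 * B)); rewrite /D; nra.
have -> : 2 * (e * N) + 2 * (M * e) = 2 * e * (N + M) by ring.
have eE : D ^+ 2 = 4 * e * (N + M + 1).
  by rewrite /e; field; rewrite gt_eqF// ltr_wpDl// addr_ge0.
rewrite eE; have := mulr_ge0 (ltW e0) N0; have := mulr_ge0 (ltW e0) M0; nra.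
Qed.

Lemma rho_int_supp (D D' : set R) f : D' `<=` D -> (forall x, D x -> ~ D' x -> f x = 0) ->
  Srho D f = Srho D' f.
Proof. by move=> DD f0; rewrite /rho_int !(Rint_supp _ DD f0). Qed.

(** As h vanishes off [c, d[, the representing identity is the weak equation on every interval
    containing [c, d[, and [weak_RS] asks for no others. The identity persists for all u in H^1, as
    is needed for pairing with elements of the adjoint. *)
Lemma green h h1 c d : E c -> E d -> c < d -> test h h1 c d ->
  exists w w1, [/\ RH1 w w1, RS w w1 h & forall u u1, RH1 u u1 ->
    ip w w1 u u1 = Srho `[c, d[ (fun x => h x * u x)].
Proof.
move=> Ec Ed cd [hh hc hd _].
have [w [w1 [hw wl]]] := riesz_representation fsg fchi chiE ab (bounded_functional_rho_int (RH1_locs hh) Ec Ed).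
have [|w1' [hw' rs] ipw] := weak_RS frp frn fsg fchi sgchi sgrp sgrn sg_supp Ec Ed cd hw (RH1_locs hh).
  move=> c' d' k k1 Ec' Ed' c'c dd' [hk _ _ _]; rewrite wl//; apply/esym/rho_int_supp.
    by apply: subset_itv; rewrite bnd_simp.
  move=> x /(itv_sub Ec' Ed') Ex; rewrite /= in_itv /= => /negP; rewrite negb_and -leNgt -ltNge.
  by move=> /orP[/ltW xc|dx]; [rewrite hc// mul0r|rewrite hd// mul0r].
exists w, w1'; split => // u u1 hu.
by rewrite ipw// wl.
Qed.

Definition adjoint_pair g g1 gt gt1 := forall f f1 ft ft1,
  RH1 f f1 -> RH1 ft ft1 -> RS f f1 ft -> ip ft ft1 g g1 = ip f f1 gt gt1.

Lemma adjoint_RT g g1 gt gt1 : RH1 g g1 -> RH1 gt gt1 -> adjoint_pair g g1 gt gt1 -> RT g gt.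
Proof.
move=> hg hgt adj.
have [c0 [d0 [c0d0E _]]] := Iab_exhaust ab; have [Ec0 Ed0 cd0] := c0d0E 0%N.
have [|g1' [hg' rs] _] := weak_RS frp frn fsg fchi sgchi sgrp sgrn sg_supp Ec0 Ed0 cd0 hg (RH1_locs hgt);
  last by exists g1', gt1; split.
move=> c d h h1 Ec Ed cc0 d0d th; have [hh _ _ _] := th.
have cd : c < d by rewrite (le_lt_trans cc0)// (lt_le_trans cd0).
have [w [w1 [hw rs wl]]] := green Ec Ed cd th.
rewrite realipC (adj _ _ _ _ hw hh rs) wl//.
by apply: rho_int_eq => x _; rewrite mulrC.
Qed.

(** * Cut-offs in H^1 *)

Lemma L2_ind (nu : {measure set R -> \bar R}) p (P : set R) : measurable P ->
  L2 nu E p -> L2 nu E (fun x => \1_P x * p x).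
Proof.
move=> mP [mp pi].
have mq : measurable_fun E (fun x => \1_P x * p x).
  by apply: measurable_funM => //; exact: measurable_indic.
split => //; apply: (@intg_le _ _ _ _ _ _ (fun x => p x ^+ 2)) => //.
  exact: measurable_funX.
move=> x _; rewrite indicE; case: (_ \in _); rewrite ?mul1r// mul0r expr0n normr0.
exact: normr_ge0.
Qed.

Lemma L2_itv (nu : {measure set R -> \bar R}) p c d : loc_finite a b nu -> E c -> E d ->
  loc_bounded a b p -> L2 nu E (fun x => \1_(`[c, d[ : set R) x * p x).
Proof.
move=> fn Ec Ed [mp bp]; have [M hM] := bp _ _ Ec Ed.
have mq : measurable_fun E (fun x => \1_(`[c, d[ : set R) x * p x).
  by apply: measurable_funM => //; exact: measurable_indic.
apply: (L2_supp mE _ (itv_sub Ec Ed)) => //.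
  by move=> x _ nx; rewrite indicE memNset// mul0r.
apply: (@L2_bounded _ _ _ _ _ _ M) => //; first exact: (itv_fin fn Ec Ed).
  by apply: measurable_funS mq => //; exact: itv_sub.
move=> x cxd; rewrite indicE mem_set// mul1r; apply: hM.
by move: cxd; rewrite /= in_itv /= => /andP[-> /ltW].
Qed.

(** Instead of multiplying u, the derivative is replaced by 0 before c and by a constant k on [c,
    d[. Since [sg] has positive mass S there, k = u(d)/S makes the primitive reach u(d) at d.
    Subtracting v from u gives the cut-off towards the other end. *)
Lemma cutR u u1 c d : RH1 u u1 -> E c -> E d -> c < d -> exists v v1,
  [/\ RH1 v v1, forall x, E x -> x <= c -> v x = 0, forall x, x < c -> v1 x = 0,
    forall x, E x -> d <= x -> v x = u x & forall x, d <= x -> v1 x = u1 x].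
Proof.
move=> hu Ec Ed cd; have [[l1 uE] [lu lu1]] := hu.
pose S := fine (sg (`[c, d[ : set R)).
have S0 : 0 < S.
  rewrite /S fine_gt0// (itv_fin fsg Ec Ed) andbT.
  apply: lt_le_trans (sg_supp Ec Ed cd) _; apply: le_measure; try exact/mem_set.
  by apply: subset_itvr; rewrite bnd_simp.
pose k := u d / S.
pose i1 : R -> R := \1_(`[c, d[ : set R); pose i2 : R -> R := \1_(`[d, +oo[ : set R).
pose v1 x := k * i1 x + i2 x * u1 x.
have bind (P : set R) : measurable P -> loc_bounded a b (\1_P : R -> R).
  move=> mP; split; first exact: measurable_indic.
  by move=> p q _ _; exists 1 => x _; rewrite indicE; case: (_ \in _); rewrite ?normr1 ?normr0.
have lv1 : loci sg v1.
  have := loci_lin k (loci_mul (bind _ (measurable_itv (Interval (BLeft d) +oo%O))) l1)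
    (loci_bounded fsg (bind _ (measurable_itv (Interval (BLeft c) (BLeft d))))).
  by congr loci; apply/funext => x; rewrite /v1 addrC.
have v1c x : x < c -> v1 x = 0.
  move=> xc; rewrite /v1 /i1 /i2 !indicE !memNset ?mulr0 ?mul0r ?addr0//= in_itv /=.
    by rewrite andbT => /(lt_le_trans (lt_trans xc cd)); rewrite ltxx.
  by move=> /andP[/(lt_le_trans xc)]; rewrite ltxx.
have v1d x : d <= x -> v1 x = u1 x.
  move=> dx; rewrite /v1 /i1 /i2 !indicE memNset; last first.
    by rewrite /= in_itv /= => /andP[_ /(le_lt_trans dx)]; rewrite ltxx.
  by rewrite mem_set/= ?in_itv/= ?dx// mulr0 add0r mul1r.
have v1cd x : c <= x < d -> v1 x = k.
  move=> cxd; rewrite /v1 /i1 /i2 !indicE mem_set; last by rewrite /= in_itv.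
  rewrite memNset ?mul0r ?addr0 ?mulr1//= in_itv /= andbT => dx.
  by have /andP[_ /(le_lt_trans dx)] := cxd; rewrite ltxx.
have dv := prim_RD Ec lv1; have [_ vE] := dv.
pose v := prim sg v1 c.
have vd : v d = u d.
  rewrite /v (vE c d)// ?ltW// prim0 add0r (@eq_Rint _ _ _ sg _ _ (cst k)).
    by rewrite Rintegral_cst// -/S /k divfK// gt_eqF.
  by move=> x; rewrite /= in_itv /=; exact: v1cd.
have vx x : E x -> d <= x -> v x = u x.
  move=> Ex dx; rewrite (uE d x)// /v (vE d x)// -/v vd; congr (_ + _).
  by apply: eq_Rint => y; rewrite /= in_itv /= => /andP[dy _]; exact: v1d.
have vc x : E x -> x <= c -> v x = 0.
  move=> Ex xc; have := vE x c Ex Ec xc; rewrite prim0 (@eq_Rint _ _ _ sg _ _ (cst 0)).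
    by rewrite Rintegral_cst// mul0r addr0 => /esym.
  by move=> y; rewrite /= in_itv /= => /andP[_ yc]; exact: v1c.
exists v, v1; split => //; split => //; split.
- have lb := RD_loc_bounded fsg dv.
  have := L2D mE (L2_itv fchi Ec Ed lb) (L2_ind (measurable_itv (Interval (BLeft d) +oo%O)) lu).
  apply: L2_ae => //; first by case: lb.
  apply: aeW => x Ex; have [dx|xd] := leP d x.
    rewrite !indicE memNset; last by rewrite /= in_itv /= => /andP[_ /(le_lt_trans dx)]; rewrite ltxx.
    by rewrite mem_set/= ?in_itv/= ?dx// mul0r add0r mul1r -vx.
  rewrite !indicE (@memNset _ `[d, +oo[); last first.
    by rewrite /= in_itv /= andbT => /(lt_le_trans xd); rewrite ltxx.
  rewrite mul0r addr0; have [cx|xc] := leP c x.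
    by rewrite mem_set ?mul1r//= in_itv /= cx xd.
  rewrite memNset ?mul0r -/v ?vc ?ltW//= in_itv /= => /andP[/(lt_le_trans xc)].
  by rewrite ltxx.
- have l1' := L2_itv fsg Ec Ed (bind _ measurableT).
  have := L2D mE (L2Z k mE l1') (L2_ind (measurable_itv (Interval (BLeft d) +oo%O)) lu1).
  apply: L2_ae => //; first exact: loci_meas lv1.
  by apply: aeW => x Ex; rewrite /v1 indicT mulr1.
Qed.

(** * Tails of the inner product and limits at the end points *)

Definition EL x : set R := E `&` `]-oo, x[.
Definition ER x : set R := E `&` `[x, +oo[.
(** For P = f g and Q = f1 g1 this is the part of the inner product carried by D. *)
Definition dbl (D : set R) (P Q : R -> R) := \int[chi]_(x in D) P x + \int[sg]_(x in D) Q x.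

Let mEL x : measurable (EL x).
Proof. by apply: measurableI => //; exact: measurable_itv. Qed.
Let mER x : measurable (ER x).
Proof. by apply: measurableI => //; exact: measurable_itv. Qed.

Lemma EL_ER_disj x : [disjoint EL x & ER x].
Proof.
apply/disj_setPS => y [[_] + [_]]; rewrite /= !in_itv /= andbT => h1 h2.
by have := lt_le_trans h1 h2; rewrite ltxx.
Qed.

Lemma Rint_EL_ER (nu : {measure set R -> \bar R}) phi x : intg nu E phi ->
  \int[nu]_(y in E) phi y = \int[nu]_(y in EL x) phi y + \int[nu]_(y in ER x) phi y.
Proof.
move=> ip; have e : E = EL x `|` ER x.
  rewrite /EL /ER -setIUr; apply/esym/setIidl => y _ /=.
  by rewrite !in_itv /= andbT; case: (ltP y x); [left|right].
rewrite [in LHS]e Rintegral_setU//; last exact: EL_ER_disj.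
by rewrite -e.
Qed.

Lemma Rint_ER_split (nu : {measure set R -> \bar R}) phi x y : intg nu E phi -> E x -> E y -> x <= y ->
  \int[nu]_(z in ER x) phi z = \int[nu]_(z in `[x, y[) phi z + \int[nu]_(z in ER y) phi z.
Proof.
move=> ip Ex Ey xy; have e : ER x = `[x, y[ `|` ER y.
  apply/seteqP; split=> z; rewrite /ER /= !in_itv /= !andbT.
    by move=> [Ez xz]; case: (ltP z y) => zy; [left; rewrite xz|right].
  move=> [/andP[xz zy]|[Ez yz]].
    by split => //; apply: (Iab_conv Ex Ey); rewrite xz ltW.
  by split => //; exact: le_trans yz.
rewrite [in LHS]e Rintegral_setU//.
  by rewrite -e; apply: intgS ip => // z [].
apply/disj_setPS => z [] /=; rewrite in_itv /= => /andP[_ h1] [_]; rewrite /= in_itv /= andbT => h2.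
by have := lt_le_trans h1 h2; rewrite ltxx.
Qed.

Lemma tailR (nu : {measure set R -> \bar R}) phi e : intg nu E phi -> 0 < e ->
  exists2 d, E d & forall x, E x -> d <= x -> `|\int[nu]_(y in ER x) phi y| <= e.
Proof.
move=> ip e0; have [c [d [cdE cdx]]] := Iab_exhaust ab.
have [||n hn] := vanishing_tail mE ip (fun n => mER (d n)) _ _ e0.
- by move=> n x [].
- move=> x Ex; have [N hN] := cdx _ Ex; exists N => n /hN/andP[_ xd] [_].
  by rewrite /= in_itv /= andbT leNgt xd.
have [_ Ed _] := cdE n.
exists (d n) => // x Ex dx; have ix : intg nu (ER x) phi by apply: intgS ip => // z [].
apply: le_trans (le_normr_Rintegral (mER x) ix) _.
apply: le_trans hn; apply: Rint0_setS => //.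
  by move=> z [Ez]; rewrite /= !in_itv /= !andbT => xz; split => //=; rewrite in_itv /= andbT (le_trans dx).
by apply: integrable_norm; apply: intgS ip => // z [].
Qed.

Lemma tailL (nu : {measure set R -> \bar R}) phi e : intg nu E phi -> 0 < e ->
  exists2 c, E c & forall x, E x -> x <= c -> `|\int[nu]_(y in EL x) phi y| <= e.
Proof.
move=> ip e0; have [c [d [cdE cdx]]] := Iab_exhaust ab.
have [||n hn] := vanishing_tail mE ip (fun n => mEL (c n)) _ _ e0.
- by move=> n x [].
- move=> x Ex; have [N hN] := cdx _ Ex; exists N => n /hN/andP[cx _] [_].
  by rewrite /= in_itv /= ltNge ltW.
have [Ec _ _] := cdE n.
exists (c n) => // x Ex xc; have ix : intg nu (EL x) phi by apply: intgS ip => // z [].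
apply: le_trans (le_normr_Rintegral (mEL x) ix) _.
apply: le_trans hn; apply: Rint0_setS => //.
  by move=> z [Ez]; rewrite /= !in_itv /= => xz; split => //=; rewrite in_itv /= (lt_le_trans xz).
by apply: integrable_norm; apply: intgS ip => // z [].
Qed.

Lemma dbl_split P Q x y : intg chi E P -> intg sg E Q -> E x -> E y -> x <= y ->
  dbl E P Q = dbl (EL x) P Q + dbl `[x, y[ P Q + dbl (ER y) P Q.
Proof.
move=> iP iQ Ex Ey xy; rewrite /dbl (Rint_EL_ER x iP) (Rint_EL_ER x iQ).
by rewrite (Rint_ER_split iP Ex Ey xy) (Rint_ER_split iQ Ex Ey xy); ring.
Qed.

Lemma dbl_ER_split P Q x y : intg chi E P -> intg sg E Q -> E x -> E y -> x <= y ->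
  dbl (ER x) P Q = dbl `[x, y[ P Q + dbl (ER y) P Q.
Proof.
move=> iP iQ Ex Ey xy; rewrite /dbl.
by rewrite (Rint_ER_split iP Ex Ey xy) (Rint_ER_split iQ Ex Ey xy); ring.
Qed.

Lemma dbl_tailR P Q e : intg chi E P -> intg sg E Q -> 0 < e ->
  exists2 d, E d & forall x, E x -> d <= x -> `|dbl (ER x) P Q| <= e.
Proof.
move=> iP iQ e0; have e20 : 0 < e / 2 by rewrite divr_gt0.
have [d1 E1 h1] := tailR iP e20; have [d2 E2 h2] := tailR iQ e20.
exists (Num.max d1 d2) => [|x Ex]; first by case: ltP.
rewrite ge_max => /andP[x1 x2]; apply: le_trans (ler_normD _ _) _.
by have := h1 _ Ex x1; have := h2 _ Ex x2; lra.
Qed.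

Lemma dbl_tailL P Q e : intg chi E P -> intg sg E Q -> 0 < e ->
  exists2 c, E c & forall x, E x -> x <= c -> `|dbl (EL x) P Q| <= e.
Proof.
move=> iP iQ e0; have e20 : 0 < e / 2 by rewrite divr_gt0.
have [d1 E1 h1] := tailL iP e20; have [d2 E2 h2] := tailL iQ e20.
exists (Num.min d1 d2) => [|x Ex]; first by case: ltP.
rewrite le_min => /andP[x1 x2]; apply: le_trans (ler_normD _ _) _.
by have := h1 _ Ex x1; have := h2 _ Ex x2; lra.
Qed.

(** Convergence to 0 at a, phrased alike for finite and infinite end points; [lim_left_end] relates
    it to the filters. *)
Definition lim0L (F : R -> R) := forall e, 0 < e ->
  exists2 c, E c & forall x, E x -> x <= c -> `|F x| <= e.
Definition lim0R (F : R -> R) := forall e, 0 < e ->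
  exists2 d, E d & forall x, E x -> d <= x -> `|F x| <= e.

Lemma lim0L_near F G : lim0L F -> (exists2 c, E c & forall x, E x -> x <= c -> G x = F x) -> lim0L G.
Proof.
move=> lF [c0 Ec0 GF] e /lF[c Ec h]; exists (Num.min c0 c); first by case: ltP.
by move=> x Ex; rewrite le_min => /andP[x0 xc]; rewrite GF// h.
Qed.

Lemma lim0R_near F G : lim0R F -> (exists2 c, E c & forall x, E x -> c <= x -> G x = F x) -> lim0R G.
Proof.
move=> lF [c0 Ec0 GF] e /lF[c Ec h]; exists (Num.max c0 c); first by case: ltP.
by move=> x Ex; rewrite ge_max => /andP[x0 xc]; rewrite GF// h.
Qed.

Lemma lim0R_lin F G (k : R) : lim0R F -> lim0R G -> lim0R (fun x => F x + k * G x).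
Proof.
move=> lF lG e e0; have e1 : 0 < e / 2 by rewrite divr_gt0.
have k0 : 0 < `|k| + 1 by rewrite ltr_wpDl.
have e2 : 0 < e / 2 / (`|k| + 1) by rewrite divr_gt0.
have [c1 E1 h1] := lF _ e1; have [c2 E2 h2] := lG _ e2.
exists (Num.max c1 c2) => [|x Ex]; first by case: ltP.
rewrite ge_max => /andP[x1 x2]; apply: le_trans (ler_normD _ _) _.
have := h1 _ Ex x1; have := h2 _ Ex x2; rewrite normrM ler_pdivlMr// => g2 g1.
by have := normr_ge0 (G x); have := normr_ge0 k; nra.
Qed.

Lemma lim0L_lin F G (k : R) : lim0L F -> lim0L G -> lim0L (fun x => F x + k * G x).
Proof.
move=> lF lG e e0; have e1 : 0 < e / 2 by rewrite divr_gt0.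
have k0 : 0 < `|k| + 1 by rewrite ltr_wpDl.
have e2 : 0 < e / 2 / (`|k| + 1) by rewrite divr_gt0.
have [c1 E1 h1] := lF _ e1; have [c2 E2 h2] := lG _ e2.
exists (Num.min c1 c2) => [|x Ex]; first by case: ltP.
rewrite le_min => /andP[x1 x2]; apply: le_trans (ler_normD _ _) _.
have := h1 _ Ex x1; have := h2 _ Ex x2; rewrite normrM ler_pdivlMr// => g2 g1.
by have := normr_ge0 (G x); have := normr_ge0 k; nra.
Qed.

(** * Lagrange's identity and the boundary form *)

Definition wronskian f1 ft g1 gt x := ft x * g1 x - f1 x * gt x : R.

(** The product rule is applied to g1 ft and to f1 gt; the integrals of ft gt with respect to rho
    cancel in the difference. *)
Lemma lagrange_identity f f1 ft ft1 g g1 gt gt1 x y :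
  RH1 ft ft1 -> RH1 gt gt1 -> RS f f1 ft -> RS g g1 gt -> E x -> E y -> x <= y ->
  wronskian f1 ft g1 gt y - wronskian f1 ft g1 gt x =
  dbl `[x, y[ (fun z => ft z * g z) (fun z => ft1 z * g1 z) -
  dbl `[x, y[ (fun z => f z * gt z) (fun z => f1 z * gt1 z).
Proof.
move=> [dft _] [dgt _] rf rg Ex Ey xy.
have i1 := ibp_RS frp frn fsg fchi sgchi sgrp sgrn rg dft Ex Ey xy.
have i2 := ibp_RS frp frn fsg fchi sgchi sgrp sgrn rf dgt Ex Ey xy.
rewrite (rho_int_eq _ _ (fun z _ => mulrC (gt z) (ft z))) in i1.
rewrite /dbl (@eq_Rint _ _ _ chi _ _ (fun z => g z * ft z)); last by move=> z _; rewrite mulrC.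
rewrite (@eq_Rint _ _ _ sg _ _ (fun z => g1 z * ft1 z)); last by move=> z _; rewrite mulrC.
by rewrite /wronskian !(mulrC (ft _)); lra.
Qed.

Lemma lagrange_limit f f1 ft ft1 g g1 gt gt1 e :
  RH1 f f1 -> RH1 ft ft1 -> RH1 g g1 -> RH1 gt gt1 -> RS f f1 ft -> RS g g1 gt -> 0 < e ->
  exists c d, [/\ E c, E d & forall x y, E x -> E y -> x <= c -> d <= y -> x <= y ->
    `|wronskian f1 ft g1 gt y - wronskian f1 ft g1 gt x - (ip ft ft1 g g1 - ip f f1 gt gt1)| <= e].
Proof.
move=> hf hft hg hgt rf rg e0.
have [_ [lf lf1]] := hf; have [_ [lft lft1]] := hft.
have [_ [lg lg1]] := hg; have [_ [lgt lgt1]] := hgt.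
have i1 := L2_prod mE lft lg; have i2 := L2_prod mE lft1 lg1.
have i3 := L2_prod mE lf lgt; have i4 := L2_prod mE lf1 lgt1.
have e40 : 0 < e / 4 by rewrite divr_gt0.
have [c1 Ec1 hc1] := dbl_tailL i1 i2 e40; have [d1 Ed1 hd1] := dbl_tailR i1 i2 e40.
have [c2 Ec2 hc2] := dbl_tailL i3 i4 e40; have [d2 Ed2 hd2] := dbl_tailR i3 i4 e40.
exists (Num.min c1 c2), (Num.max d1 d2); split; [by case: ltP|by case: ltP|].
move=> x y Ex Ey; rewrite le_min ge_max => /andP[xc1 xc2] /andP[yd1 yd2] xy.
rewrite (lagrange_identity hft hgt rf rg Ex Ey xy).
have -> : ip ft ft1 g g1 = dbl E (fun z => ft z * g z) (fun z => ft1 z * g1 z) by [].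
have -> : ip f f1 gt gt1 = dbl E (fun z => f z * gt z) (fun z => f1 z * gt1 z) by [].
rewrite (dbl_split i1 i2 Ex Ey xy) (dbl_split i3 i4 Ex Ey xy).
have := hc1 _ Ex xc1; have := hc2 _ Ex xc2; have := hd1 _ Ey yd1; have := hd2 _ Ey yd2.
rewrite !ler_norml => /andP[? ?] /andP[? ?] /andP[? ?] /andP[? ?].
by apply/andP; split; lra.
Qed.

(* Riesz' theorem produces (F, T) in the relation, with T = 0 near a and T = ft near b, such that
   the natural boundary conditions F^[1] u -> 0 at a and (F^[1] - f^[1]) u -> 0 at b hold for all
   u in H^1. *)
Lemma cutoff_pair f f1 ft ft1 : RH1 f f1 -> RH1 ft ft1 -> RS f f1 ft ->
  exists F F1 T T1, [/\ RH1 F F1, RH1 T T1, RS F F1 T &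
    (exists2 c, E c & forall x, E x -> x <= c -> T x = 0) /\
    (exists2 d, E d & forall x, E x -> d <= x -> T x = ft x) /\
    forall u u1, RH1 u u1 -> lim0L (fun x => F1 x * u x) /\ lim0R (fun x => (F1 x - f1 x) * u x)].
Proof.
move=> hf hft rs.
have [cn [dn [cdE cdx]]] := Iab_exhaust ab; have [Ec Ed cd] := cdE 0%N.
set c := cn 0%N in Ec cd; set d := dn 0%N in Ed cd.
have [T [T1 [hT Tc T1c Td T1d]]] := cutR hft Ec Ed cd.
have ERE : ER d `<=` E by move=> x [].
(* For a test function h, the product rule for f1 h to the right of d turns f1(d) h(d) plus the form
   of f into the integral of ft h drho, so L encodes tau F = T. For general u that integral over [d,
   b) need not converge, as rho is only locally finite, while the form of f does. *)
pose L u u1 := (Srho `[c, d[ (fun x => T x * u x) + f1 d * u d) +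
   (\int[chi]_(x in ER d) (f x * u x) + \int[sg]_(x in ER d) (f1 x * u1 x)).
have bL : bounded_functional L.
  apply: bounded_functional_add; last exact: bounded_functional_realip.
  by apply: bounded_functional_add; [exact: bounded_functional_rho_int (RH1_locs hT) Ec Ed|
    exact/bounded_functional_scale/bounded_functional_eval].
have [F [F0 [hF0 FL]]] := riesz_representation fsg fchi chiE ab bL.
have Lsupp h h1 c' d' : E c' -> E d' -> c' <= c -> d <= d' -> test h h1 c' d' ->
    L h h1 = Srho `[c', d'[ (fun x => T x * h x).
  move=> Ec' Ed' c'c dd' th; have [[dh _] hc hd h1cd] := th.
  have lTh : locs (fun x => T x * h x).
    have [bh _ _ _] := th; exact: (locs_mul (RH1_bounded hT) (RH1_locs bh)).
  have c'd : c' <= d by rewrite (le_trans c'c)// ltW.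
  rewrite (rho_int_split lTh Ec' Ed' (x:=d)) ?c'd//.
  rewrite (rho_int_split lTh Ec' Ed (x:=c)) ?c'c ?(ltW cd)//.
  rewrite (@rho_int0 _ rp rn `[c', c[); last first.
    move=> x; rewrite /= in_itv /= => /andP[c'x xc]; rewrite Tc ?mul0r ?(ltW xc)//.
    by apply: (Iab_conv Ec' Ec); rewrite c'x ltW.
  rewrite (@rho_int_eq _ rp rn `[d, d'[ _ (fun x => ft x * h x)); last first.
    move=> x; rewrite /= in_itv /= => /andP[dx xd]; rewrite Td//.
    by apply: (Iab_conv Ed Ed'); rewrite dx ltW.
  have := ibp_RS frp frn fsg fchi sgchi sgrp sgrn rs dh Ed Ed' dd'; rewrite (hd d')// mulr0.
  have sub : (`[d, d'[ : set R) `<=` ER d.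
    by move=> x xd; split; [exact: itv_sub xd|move: xd; rewrite /= !in_itv /= andbT => /andP[]].
  have out x : ER d x -> ~ (`[d, d'[ : set R) x -> d' <= x.
    by move=> [_]; rewrite /= !in_itv /= andbT => -> /negP /=; rewrite -leNgt.
  rewrite /L (Rint_supp chi sub); last first.
    by move=> x xd /(out _ xd) dx; rewrite hd ?mulr0//; case: xd.
  rewrite (Rint_supp sg sub); last first.
    by move=> x xd /(out _ xd) dx; rewrite h1cd ?mulr0// dx orbT.
  by lra.
have [|F1 [hF rF] ipF] := weak_RS frp frn fsg fchi sgchi sgrp sgrn sg_supp Ec Ed cd hF0 (RH1_locs hT).
  by move=> c' d' h h1 Ec' Ed' c'c dd' th; rewrite FL ?(Lsupp _ _ c' d')//; case: th.
have {}FL u u1 : RH1 u u1 -> ip F F1 u u1 = L u u1 by move=> hu; rewrite ipF// FL.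
have [_ [lF lF1]] := hF; have [_ [lf lf1]] := hf.
exists F, F1, T, T1; split => //; split; first by exists c.
split=> [|u u1 hu]; first by exists d.
split=> e e0.
(* v agrees with u near a and vanishes from c on, where T starts, so L(v) = 0 and the form of (F, v)
   vanishes. The product rule on [x, c[ then identifies F1(x) u(x) with the form over the part left
   of x, a tail. *)
- have [c' [Ec' c'c]] : exists c', E c' /\ c' < c.
    have [N /(_ N (leqnn N))/andP[h _]] := cdx _ Ec.
    by exists (cn N); split => //; case: (cdE N).
  have [w [w1 [hw wc' w1c' wc w1c]]] := cutR hu Ec' Ec c'c.
  have hv := RH1_sub hu hw; set v := fun x => u x - w x in hv; set v1 := fun x => u1 x - w1 x in hv.
  have vc x : E x -> c <= x -> v x = 0 by move=> Ex cx; rewrite /v wc// subrr.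
  have v1c x : c <= x -> v1 x = 0 by move=> cx; rewrite /v1 w1c// subrr.
  have vE x : E x -> x <= c' -> v x = u x by move=> Ex cx; rewrite /v wc'// subr0.
  have [dv [lv lv1]] := hv.
  have i1 := L2_prod mE lF lv; have i2 := L2_prod mE lF1 lv1.
  have Lv : L v v1 = 0.
    rewrite /L vc ?(ltW cd)// mulr0 addr0 rho_int0; last first.
      by move=> x xcd; rewrite vc ?mulr0//; [exact: itv_sub xcd|move: xcd; rewrite /= in_itv /= => /andP[]].
    rewrite (Rint_supp chi (sub0set _)) ?Rintegral_set0; last first.
      move=> x [Ex]; rewrite /= in_itv /= andbT => dx _.
      by rewrite vc ?mulr0// (le_trans (ltW cd)).
    rewrite (Rint_supp sg (sub0set _)) ?Rintegral_set0 ?addr0// => x [Ex].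
    by rewrite /= in_itv /= andbT => dx _; rewrite v1c ?mulr0// (le_trans (ltW cd)).
  have [c1 Ec1 hc1] := dbl_tailL i1 i2 e0.
  exists (Num.min c1 c'); first by case: ltP.
  move=> x Ex; rewrite le_min => /andP[xc1 xc'].
  have xc : x <= c by rewrite (le_trans xc')// ltW.
  have := hc1 _ Ex xc1.
  have tot : dbl E (fun z => F z * v z) (fun z => F1 z * v1 z) = 0 by rewrite -Lv -FL.
  rewrite (dbl_split i1 i2 Ex Ec xc) in tot.
  have ERc : dbl (ER c) (fun z => F z * v z) (fun z => F1 z * v1 z) = 0.
    rewrite /dbl (Rint_supp chi (sub0set _)) ?Rintegral_set0; last first.
      by move=> z [Ez]; rewrite /= in_itv /= andbT => dz _; rewrite vc ?mulr0.
    rewrite (Rint_supp sg (sub0set _)) ?Rintegral_set0 ?addr0// => z [Ez].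
    by rewrite /= in_itv /= andbT => dz _; rewrite v1c ?mulr0.
  have := ibp_RS frp frn fsg fchi sgchi sgrp sgrn rF dv Ex Ec xc.
  rewrite (vc c)// mulr0 (vE x)// rho_int0; last first.
    move=> z xzc; have Ez := itv_sub Ex Ec xzc; rewrite Tc ?mul0r//.
    by move: xzc; rewrite /= in_itv /= => /andP[_ /ltW].
  rewrite ERc addr0 in tot; rewrite subr0 sub0r -/(dbl `[x, c[ _ _) => ib h.
  by rewrite -normrN ib
    (_ : dbl `[x, c[ _ _ = - dbl (EL x) (fun z => F z * v z) (fun z => F1 z * v1 z)) ?normrN//; lra.
(* Now v vanishes up to d and agrees with u from d' on, so L(v) is the form of (f, v) and the form
   of (F - f, v) over [d, b) vanishes. Up to sign, (F1 - f1)(x) u(x) is its tail beyond x. *)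
- have [d' [Ed' dd']] : exists d', E d' /\ d < d'.
    have [N /(_ N (leqnn N))/andP[_ h]] := cdx _ Ed.
    by exists (dn N); split => //; case: (cdE N).
  have [v [v1 [hv vd v1d vd' v1d']]] := cutR hu Ed Ed' dd'.
  have [dv [lv lv1]] := hv.
  have i1 := L2_prod mE (L2B mE lF lf) lv; have i2 := L2_prod mE (L2B mE lF1 lf1) lv1.
  have Lv : L v v1 = \int[chi]_(x in ER d) (f x * v x) + \int[sg]_(x in ER d) (f1 x * v1 x).
    rewrite /L vd// mulr0 addr0 rho_int0 ?add0r// => x xcd.
    by rewrite vd ?mulr0//; [exact: itv_sub xcd|move: xcd; rewrite /= in_itv /= => /andP[_ /ltW]].
  have tot : dbl (ER d) (fun x => (F x - f x) * v x) (fun x => (F1 x - f1 x) * v1 x) = 0.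
    have iS (nu : {measure set R -> \bar R}) p : intg nu E p -> intg nu (ER d) p by apply: intgS.
    have ipv : ip F F1 v v1 = \int[chi]_(x in ER d) (F x * v x) + \int[sg]_(x in ER d) (F1 x * v1 x).
      rewrite /realip; congr (_ + _); apply: Rint_supp => // x Ex nx.
        have xd : x < d by rewrite ltNge; apply/negP => dx; apply: nx; split => //=; rewrite in_itv /= dx.
        by rewrite vd ?mulr0 ?ltW.
      have xd : x < d by rewrite ltNge; apply/negP => dx; apply: nx; split => //=; rewrite in_itv /= dx.
      by rewrite v1d ?mulr0.
    have : ip F F1 v v1 - L v v1 = 0 by rewrite FL// subrr.
    rewrite ipv Lv => <-; rewrite /dbl.
    rewrite (@eq_Rint _ _ _ chi _ _ (fun x => F x * v x - f x * v x)); last by move=> x _; rewrite mulrBl.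
    rewrite (@eq_Rint _ _ _ sg _ _ (fun x => F1 x * v1 x - f1 x * v1 x)); last by move=> x _; rewrite mulrBl.
    by rewrite !RintegralB//; try exact/iS/L2_prod; ring.
  have [d1 Ed1 hd1] := dbl_tailR i1 i2 e0.
  exists (Num.max d1 d'); first by case: ltP.
  move=> x Ex; rewrite ge_max => /andP[xd1 xd'].
  have dx : d <= x by rewrite (le_trans (ltW dd')).
  have := hd1 _ Ex xd1.
  rewrite (dbl_ER_split i1 i2 Ed Ex dx) in tot.
  have j1 := ibp_RS frp frn fsg fchi sgchi sgrp sgrn rF dv Ed Ex dx.
  have j2 := ibp_RS frp frn fsg fchi sgchi sgrp sgrn rs dv Ed Ex dx.
  rewrite (vd d)// mulr0 subr0 (vd' x)// in j1; rewrite (vd d)// mulr0 subr0 (vd' x)// in j2.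
  have TE : Srho `[d, x[ (fun z => T z * v z) = Srho `[d, x[ (fun z => ft z * v z).
    apply: rho_int_eq => z dzx; rewrite Td//; first exact: itv_sub dzx.
    by move: dzx; rewrite /= in_itv /= => /andP[].
  have bE : dbl `[d, x[ (fun x => (F x - f x) * v x) (fun x => (F1 x - f1 x) * v1 x) =
      (F1 x - f1 x) * u x.
    have iS (nu : {measure set R -> \bar R}) p : intg nu E p -> intg nu `[d, x[ p.
      by apply: intgS => //; exact: itv_sub.
    rewrite mulrBl j1 j2 TE /dbl.
    rewrite (@eq_Rint _ _ _ chi _ _ (fun x => F x * v x - f x * v x)); last by move=> z _; rewrite mulrBl.
    rewrite (@eq_Rint _ _ _ sg _ _ (fun x => F1 x * v1 x - f1 x * v1 x)); last by move=> z _; rewrite mulrBl.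
    by rewrite !RintegralB//; try exact/iS/L2_prod; ring.
  rewrite bE in tot; move=> h.
  by rewrite (_ : (F1 x - f1 x) * u x =
      - dbl (ER x) (fun z => (F z - f z) * v z) (fun z => (F1 z - f1 z) * v1 z)) ?normrN//; lra.
Qed.

(** Equal inner products mean that V(y) - V(x) tends to 0 as x and y approach a and b. *)
Lemma lagrange_lim0R f f1 ft ft1 g g1 gt gt1 :
  RH1 f f1 -> RH1 ft ft1 -> RH1 g g1 -> RH1 gt gt1 -> RS f f1 ft -> RS g g1 gt ->
  ip ft ft1 g g1 = ip f f1 gt gt1 -> lim0L (wronskian f1 ft g1 gt) -> lim0R (wronskian f1 ft g1 gt).
Proof.
move=> hf hft hg hgt rf rg tot lL e e0; have e20 : 0 < e / 2 by rewrite divr_gt0.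
have [c [d [Ec Ed h]]] := lagrange_limit hf hft hg hgt rf rg e20.
have [c' Ec' h'] := lL _ e20.
pose x := Num.min c c'; have Ex : E x by rewrite /x; case: ltP.
exists (Num.max d x) => [|y Ey]; first by case: ltP.
rewrite ge_max => /andP[dy xy].
have xc : x <= c by rewrite ge_min lexx.
have xc' : x <= c' by rewrite ge_min lexx orbT.
have := h _ _ Ex Ey xc dy xy; have := h' _ Ex xc'.
by rewrite tot subrr subr0 !ler_norml => /andP[? ?] /andP[? ?]; apply/andP; split; lra.
Qed.

Lemma lagrange_lim0L f f1 ft ft1 g g1 gt gt1 :
  RH1 f f1 -> RH1 ft ft1 -> RH1 g g1 -> RH1 gt gt1 -> RS f f1 ft -> RS g g1 gt ->
  ip ft ft1 g g1 = ip f f1 gt gt1 -> lim0R (wronskian f1 ft g1 gt) -> lim0L (wronskian f1 ft g1 gt).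
Proof.
move=> hf hft hg hgt rf rg tot lR e e0; have e20 : 0 < e / 2 by rewrite divr_gt0.
have [c [d [Ec Ed h]]] := lagrange_limit hf hft hg hgt rf rg e20.
have [d' Ed' h'] := lR _ e20.
pose y := Num.max d d'; have Ey : E y by rewrite /y; case: ltP.
exists (Num.min c y) => [|x Ex]; first by case: ltP.
rewrite le_min => /andP[xc xy].
have yd : d <= y by rewrite le_max lexx.
have yd' : d' <= y by rewrite le_max lexx orbT.
have := h _ _ Ex Ey xc yd xy; have := h' _ Ey yd'.
by rewrite tot subrr subr0 !ler_norml => /andP[? ?] /andP[? ?]; apply/andP; split; lra.
Qed.

Lemma lagrange_total f f1 ft ft1 g g1 gt gt1 :
  RH1 f f1 -> RH1 ft ft1 -> RH1 g g1 -> RH1 gt gt1 -> RS f f1 ft -> RS g g1 gt ->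
  lim0L (wronskian f1 ft g1 gt) -> lim0R (wronskian f1 ft g1 gt) ->
  ip ft ft1 g g1 = ip f f1 gt gt1.
Proof.
move=> hf hft hg hgt rf rg lL lR; apply/eqP; rewrite -subr_eq0 -normr_eq0.
apply: contrapT => /negP n0; set I := _ - _ in n0.
have I0 : 0 < `|I| by rewrite lt_def n0 normr_ge0.
have e0 : 0 < `|I| / 4 by rewrite divr_gt0.
have [c [d [Ec Ed h]]] := lagrange_limit hf hft hg hgt rf rg e0.
have [c' Ec' hc'] := lL _ e0; have [d' Ed' hd'] := lR _ e0.
pose x := Num.min c c'; have Ex : E x by rewrite /x; case: ltP.
pose y := Num.max (Num.max d d') x; have Ey : E y by rewrite /y; case: ltP => // _; case: ltP.
have xc : x <= c by rewrite ge_min lexx.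
have xc' : x <= c' by rewrite ge_min lexx orbT.
have yd : d <= y by rewrite !le_max lexx.
have yd' : d' <= y by rewrite !le_max lexx orbT.
have xy : x <= y by rewrite !le_max lexx !orbT.
have := h _ _ Ex Ey xc yd xy; have := hc' _ Ex xc'; have := hd' _ Ey yd'.
set V := wronskian f1 ft g1 gt => h1 h2 h3.
have : `|I| <= `|V y - V x - I| + `|V y| + `|V x|.
  have -> : I = - (V y - V x - I) + V y - V x by ring.
  rewrite (le_trans (ler_normB _ _))// lerD2r (le_trans (ler_normD _ _))// normrN.
  by have -> : V y - V x - (- (V y - V x - I) + V y - V x) = V y - V x - I by ring.
by lra.
Qed.

(** For the pair (F, T) of [cutoff_pair], V reduces to -F1 gt near a and hence tends to 0 there, so
    also at b by the adjoint identity. Near b it differs from V(f, g) by (F1 - f1) gt, which tends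
    to 0. The identity for f itself then settles a. *)
Lemma adjoint_boundary f f1 ft ft1 g g1 gt gt1 :
  RH1 g g1 -> RH1 gt gt1 -> RS g g1 gt -> adjoint_pair g g1 gt gt1 ->
  RH1 f f1 -> RH1 ft ft1 -> RS f f1 ft ->
  lim0L (wronskian f1 ft g1 gt) /\ lim0R (wronskian f1 ft g1 gt).
Proof.
move=> hg hgt rg adj hf hft rf.
have [F [F1 [T [T1 [hF hT rF [[c Ec Tc] [[d Ed Td] bc]]]]]]] := cutoff_pair hf hft rf.
have [bL bR] := bc _ _ hgt.
have tot := adj _ _ _ _ hf hft rf.
suff lR : lim0R (wronskian f1 ft g1 gt).
  by split=> //; exact: (lagrange_lim0L hf hft hg hgt rf rg tot lR).
have lL : lim0L (wronskian F1 T g1 gt).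
  (* A negative is obtained as X - 2 X. *)
  have := lim0L_lin (-2) bL bL; move/lim0L_near; apply; exists c => // x Ex xc.
  by rewrite /wronskian Tc//; ring.
have lR := lagrange_lim0R hF hT hg hgt rF rg (adj _ _ _ _ hF hT rF) lL.
have := lim0R_lin 1 lR bR; move/lim0R_near; apply; exists d => // x Ex dx.
by rewrite /wronskian Td//; ring.
Qed.

Lemma wronskian_adjoint g g1 gt gt1 : RH1 g g1 -> RH1 gt gt1 -> RS g g1 gt ->
  (forall f f1 ft ft1, RH1 f f1 -> RH1 ft ft1 -> RS f f1 ft ->
    lim0L (wronskian f1 ft g1 gt) /\ lim0R (wronskian f1 ft g1 gt)) ->
  adjoint_pair g g1 gt gt1.
Proof.
move=> hg hgt rg bc f f1 ft ft1 hf hft rf; have [lL lR] := bc _ _ _ _ hf hft rf.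
exact: (lagrange_total hf hft hg hgt rf rg).
Qed.

(* Two quasi-derivatives of f differ by a left continuous function vanishing sg-almost everywhere. *)
Lemma RS_unique f f1 g1 t s : RD sg f f1 -> RD sg f g1 -> RS f f1 t -> RS f g1 s ->
  forall x, E x -> f1 x = g1 x.
Proof.
move=> df dg [lf [lp ln] h1] [_ [mp mn] h2] x Ex.
have fg := RD_unique df dg.
apply/eqP; rewrite -subr_eq0; apply: contrapT => /negP n0.
set D := f1 x - g1 x in n0.
(* If f1 and g1 agreed at some z close to x on the left, D would be a signed sum of four integrals
   over [z, x[, hence at most |D|/2 in modulus. So they differ on an interval of positive
   [sg]-mass. *)
have D0 : 0 < `|D| / 8 by rewrite divr_gt0// normr_gt0.
have [ax xb] := Ex.
have [y1 [E1 y1x] k1] := left_cont ax xb lp D0.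
have [y2 [E2 y2x] k2] := left_cont ax xb ln D0.
have [y3 [E3 y3x] k3] := left_cont ax xb mp D0.
have [y4 [E4 y4x] k4] := left_cont ax xb mn D0.
pose y := Num.max (Num.max y1 y2) (Num.max y3 y4).
have Emax p q : E p -> E q -> E (Num.max p q) by case: ltP.
have Ey : E y by apply: (Emax); exact: Emax.
have yx : y < x by rewrite !gt_max y1x y2x y3x y4x.
have far z : y <= z <= x -> f1 z <> g1 z.
  move=> /andP[yz zx] e; have Ez : E z by apply: (Iab_conv Ey Ex); rewrite yz.
  have := yz; rewrite !ge_max => /andP[/andP[z1 z2] /andP[z3 z4]].
  have := k1 z; have := k2 z; have := k3 z; have := k4 z.
  rewrite z1 z2 z3 z4 zx => /(_ isT) g4 /(_ isT) g3 /(_ isT) g2 /(_ isT) g1'.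
  have := h1 _ _ Ez Ex zx; have := h2 _ _ Ez Ex zx; rewrite e /rho_int => e2 e1.
  have : `|D| <= `|\int[rp]_(u in `[z, x[) t u| + `|\int[rn]_(u in `[z, x[) t u| +
     (`|\int[rp]_(u in `[z, x[) s u| + `|\int[rn]_(u in `[z, x[) s u|).
    rewrite /D e1 e2; set A := \int[rp]_(_ in _) t _; set B := \int[rn]_(_ in _) t _.
    set A' := \int[rp]_(_ in _) s _; set B' := \int[rn]_(_ in _) s _; set X := \int[chi]_(_ in _) _.
    have -> : g1 z + X - (A - B) - (g1 z + X - (A' - B')) = (A' - B') - (A - B) by ring.
    by rewrite [leRHS]addrC (le_trans (ler_normB _ _))// lerD//; exact: ler_normB.
  have : 0 < `|D| by rewrite normr_gt0.
  by lra.
have := sg_supp Ey Ex yx; rewrite lt_neqAle => /andP[/negP + _]; apply; rewrite eq_sym.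
apply/eqP/negligibleP; first exact: measurable_itv.
move: fg => [N [mN N0 subN]]; exists N; split => // z; rewrite /= in_itv /= => /andP[yz zx].
apply: subN => /= H; apply: (far z); first by rewrite !ltW.
by apply: H; apply: (Iab_conv Ey Ex); rewrite !ltW.
Qed.

End real_relation.

Lemma cvg0_near_le (R : realType) (u : nat -> \bar R) (e : R) :
  u n @[n --> \oo] --> 0%E -> 0 < e -> \forall n \near \oo, (u n <= e%:E)%E.
Proof.
move=> /fine_cvgP[fu /cvgrPdist_le u0] e0; have u1 := u0 _ e0.
near=> n; have fn : u n \is a fin_num by near: n.
rewrite -(fineK fn) lee_fin (le_trans (ler_norm _))//.
by rewrite -normrN -sub0r; near: n.
Unshelve. all: by end_near. Qed.

(** * Real and imaginary parts *)

Section complex_parts.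
Variable R : realType.
Implicit Types z w : R[i].

Lemma ceqP z w : cre z = cre w -> cim z = cim w -> z = w.
Proof. by case: z w => [x y] [x' y'] /= -> ->. Qed.

Lemma creD z w : cre (z + w) = cre z + cre w. Proof. by case: z w => [x y] [x' y']. Qed.
Lemma cimD z w : cim (z + w) = cim z + cim w. Proof. by case: z w => [x y] [x' y']. Qed.
Lemma creN z : cre (- z) = - cre z. Proof. by case: z. Qed.
Lemma cimN z : cim (- z) = - cim z. Proof. by case: z. Qed.
Lemma creM z w : cre (z * w) = cre z * cre w - cim z * cim w.
Proof. by case: z w => [x y] [x' y']. Qed.
Lemma cimM z w : cim (z * w) = cre z * cim w + cim z * cre w.
Proof. by case: z w => [x y] [x' y']. Qed.
Lemma cre_conj z : cre (cconj z) = cre z. Proof. by case: z. Qed.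
Lemma cim_conj z : cim (cconj z) = - cim z. Proof. by case: z. Qed.

Definition cpx (x y : R) : R[i] := Complex x y.
Lemma cre_cpx x y : cre (cpx x y) = x. Proof. by []. Qed.
Lemma cim_cpx x y : cim (cpx x y) = y. Proof. by []. Qed.

Lemma cre_Cint (mu : {measure set R -> \bar R}) D h :
  cre (Cint mu D h) = \int[mu]_(x in D) cre (h x).
Proof. by rewrite /Cint creD creM /= mul0r mulr0 subrr addr0. Qed.

Lemma cim_Cint (mu : {measure set R -> \bar R}) D h :
  cim (Cint mu D h) = \int[mu]_(x in D) cim (h x).
Proof. by rewrite /Cint cimD cimM /= mul0r add0r mul1r add0r. Qed.

Lemma cre_dint (mu : {measure set R -> \bar R}) h c x :
  cre (dint (fun D => Cint mu D h) c x) = prim mu (fun y => cre (h y)) c x.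
Proof.
rewrite /dint /prim; case: (ltgtP c x) => [cx|xc|<-].
- exact: cre_Cint.
- by rewrite creN cre_Cint.
- by rewrite set_itv_ge ?bnd_simp ?ltxx// Rintegral_set0.
Qed.

Lemma cim_dint (mu : {measure set R -> \bar R}) h c x :
  cim (dint (fun D => Cint mu D h) c x) = prim mu (fun y => cim (h y)) c x.
Proof.
rewrite /dint /prim; case: (ltgtP c x) => [cx|xc|<-].
- exact: cim_Cint.
- by rewrite cimN cim_Cint.
- by rewrite set_itv_ge ?bnd_simp ?ltxx// Rintegral_set0.
Qed.

Lemma dint_Sint (rp rn : {measure set R -> \bar R}) h c x :
  dint (fun D => Sint rp rn D h) c x =
  dint (fun D => Cint rp D h) c x - dint (fun D => Cint rn D h) c x.
Proof.
rewrite /dint /Sint; case: ifP => // _; case: ifP => // _; last by rewrite subrr.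
by rewrite opprB addrC opprK.
Qed.

End complex_parts.

(** * Limits at the end points as filter convergence *)

Section endpoint_limits.
Variables (R : realType) (a b : \bar R).
Hypothesis ab : (a < b)%E.
Local Notation E := (Iab a b).

Lemma lim0L_cvg (r : R) (F : R -> R) : a = r%:E ->
  lim0L a b F <-> F @ r^'+ --> (0 : R^o).
Proof.
move=> ar; split.
  move=> lF; apply/cvgrPdist_le => e e0; have [c [ac cb] h] := lF e e0.
  near=> x; rewrite sub0r normrN; apply: h; last by near: x; apply: nbhs_right_le; rewrite -lte_fin -ar.
  split; first by rewrite ar lte_fin; near: x; exact: nbhs_right_gt.
  apply: le_lt_trans cb; rewrite lee_fin; near: x; apply: nbhs_right_le; by rewrite -lte_fin -ar.
move=> /cvgrPdist_le H e e0; have := H e e0; rewrite near_withinE => /nbhs_ballP[d /= d0 hd].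
have [m [am mb]] := Iab_mid ab.
have rm : r < m by rewrite -lte_fin -ar.
(* m keeps the threshold inside (a, b), and d/2 keeps it strictly inside the ball of radius d. *)
exists (Num.min m (r + d / 2)).
  split; first by rewrite ar lte_fin lt_min rm ltrDl divr_gt0.
  by apply: le_lt_trans mb; rewrite lee_fin ge_min lexx.
move=> x [ax xb]; rewrite le_min => /andP[_ xd].
have rx : r < x by rewrite -lte_fin -ar.
have := hd x; rewrite sub0r normrN; apply => //.
rewrite /ball /= distrC gtr0_norm ?subr_gt0// ltrBlDl (le_lt_trans xd)// ltrD2l.
by rewrite ltr_pdivrMr// ltr_pMr// ltr1n.
Unshelve. all: by end_near. Qed.

Lemma lim0R_cvg (r : R) (F : R -> R) : b = r%:E ->
  lim0R a b F <-> F @ r^'- --> (0 : R^o).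
Proof.
move=> br; split.
  move=> lF; apply/cvgrPdist_le => e e0; have [c [ac cb] h] := lF e e0.
  near=> x; rewrite sub0r normrN; apply: h; last by near: x; apply: nbhs_left_ge; rewrite -lte_fin -br.
  split; last by rewrite br lte_fin; near: x; exact: nbhs_left_lt.
  apply: lt_le_trans ac _; rewrite lee_fin; near: x; apply: nbhs_left_ge; by rewrite -lte_fin -br.
move=> /cvgrPdist_le H e e0; have := H e e0; rewrite near_withinE => /nbhs_ballP[d /= d0 hd].
have [m [am mb]] := Iab_mid ab.
have rm : m < r by rewrite -lte_fin -br.
exists (Num.max m (r - d / 2)).
  split; last by rewrite br lte_fin gt_max rm gtrBl divr_gt0.
  by apply: lt_le_trans am _; rewrite lee_fin le_max lexx.
move=> x [ax xb]; rewrite ge_max => /andP[_ xd].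
have rx : x < r by rewrite -lte_fin -br.
have := hd x; rewrite sub0r normrN; apply => //.
rewrite /ball /= gtr0_norm ?subr_gt0// ltrBlDl -ltrBlDr (lt_le_trans _ xd)// ltrD2l ltrN2.
by rewrite ltr_pdivrMr// ltr_pMr// ltr1n.
Unshelve. all: by end_near. Qed.

Lemma lim0L_cvgNy (F : R -> R) : a = -oo%E -> lim0L a b F <-> F @ -oo --> (0 : R^o).
Proof.
move=> aE; split.
  move=> lF; apply/cvgrPdist_le => e e0; have [c [ac cb] h] := lF e e0.
  near=> x; rewrite sub0r normrN.
  have xc : x <= c by near: x; apply: nbhs_ninfty_le; exact: num_real.
  apply: h => //; split; first by rewrite aE ltNyr.
  by apply: le_lt_trans cb; rewrite lee_fin.
move=> /cvgrPdist_le H e e0; have [M [_ hM]] := H e e0.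
have [m [am mb]] := Iab_mid ab.
exists (Num.min m (M - 1)).
  split; first by rewrite aE ltNyr.
  by apply: le_lt_trans mb; rewrite lee_fin ge_min lexx.
move=> x [ax xb]; rewrite le_min => /andP[_ xd].
by have := hM x; rewrite /= sub0r normrN; apply; lra.
Unshelve. all: by end_near. Qed.

Lemma lim0R_cvgy (F : R -> R) : b = +oo%E -> lim0R a b F <-> F @ +oo --> (0 : R^o).
Proof.
move=> bE; split.
  move=> lF; apply/cvgrPdist_le => e e0; have [c [ac cb] h] := lF e e0.
  near=> x; rewrite sub0r normrN.
  have xc : c <= x by near: x; apply: nbhs_pinfty_ge; exact: num_real.
  apply: h => //; split; last by rewrite bE ltry.
  by apply: lt_le_trans ac _; rewrite lee_fin.
move=> /cvgrPdist_le H e e0; have [M [_ hM]] := H e e0.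
have [m [am mb]] := Iab_mid ab.
exists (Num.max m (M + 1)).
  split; last by rewrite bE ltry.
  by apply: lt_le_trans am _; rewrite lee_fin le_max lexx.
move=> x [ax xb]; rewrite ge_max => /andP[_ xd].
by have := hM x; rewrite /= sub0r normrN; apply; lra.
Unshelve. all: by end_near. Qed.

Lemma lim_left_end (V : R -> R[i]) :
  lim_at_left_end a V 0 <-> lim0L a b (fun x => cre (V x)) /\ lim0L a b (fun x => cim (V x)).
Proof.
rewrite /lim_at_left_end; case aE : a => [r||].
- by rewrite -aE !(lim0L_cvg _ aE).
- by move: ab; rewrite aE ltNge leey.
- by rewrite -aE !(lim0L_cvgNy _ aE).
Qed.

Lemma lim_right_end (V : R -> R[i]) :
  lim_at_right_end b V 0 <-> lim0R a b (fun x => cre (V x)) /\ lim0R a b (fun x => cim (V x)).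
Proof.
rewrite /lim_at_right_end; case bE : b => [r||].
- by rewrite -bE !(lim0R_cvg _ bE).
- by rewrite -bE !(lim0R_cvgy _ bE).
- by move: ab; rewrite bE ltNge leNye.
Qed.

End endpoint_limits.

(** * Decoupling into real and imaginary parts *)

Section splitting.
Variables (R : realType) (a b : \bar R) (rp rn sg chi : {measure set R -> \bar R}).
Local Notation E := (Iab a b).
Hypothesis ab : (a < b)%E.
Hypothesis fsg : loc_finite a b sg.
Hypothesis fchi : loc_finite a b chi.
Local Notation RH1 := (RH1 a b sg chi).
Local Notation RS := (RS a b rp rn chi).
Local Notation RT := (RT a b rp rn sg chi).
Local Notation Re f := (fun x => cre (f x)).
Local Notation Im f := (fun x => cim (f x)).
Implicit Types f g h : R -> R[i].
Let mE : measurable E. Proof. exact: measurable_Iab. Qed.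

Lemma RD_primE (mu : {measure set R -> \bar R}) (f h : R -> R) :
  RD a b mu f h <-> loci a b mu h /\ forall c x, E c -> E x -> f x = f c + prim mu h c x.
Proof.
split=> -[lh fE]; split=> // c x Ec Ex.
  rewrite /prim; case: ifPn => [cx|]; first exact: fE.
  by rewrite -ltNge => /ltW xc; rewrite (fE x c)//; ring.
by move=> cx; rewrite (fE c x)// /prim cx.
Qed.

Lemma is_deriv_split mu f h :
  is_deriv a b mu f h <-> RD a b mu (Re f) (Re h) /\ RD a b mu (Im f) (Im h).
Proof.
rewrite !RD_primE; split=> [[lh fE]|[[lr fr] [li fi]]].
  split; split.
  - by move=> c d Ec Ed; exact: (lh c d Ec Ed).1.
  - by move=> c x Ec Ex; rewrite (fE c x)// creD cre_dint.
  - by move=> c d Ec Ed; exact: (lh c d Ec Ed).2.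
  - by move=> c x Ec Ex; rewrite (fE c x)// cimD cim_dint.
split=> [c d Ec Ed|c x Ec Ex]; first by split; [exact: lr|exact: li].
by apply: ceqP; rewrite ?creD ?cimD ?cre_dint ?cim_dint; [exact: fr|exact: fi].
Qed.

Lemma RD_loci_chi (f f1 : R -> R) : RD a b sg f f1 -> loci a b chi f.
Proof. by move=> df; apply: loci_bounded => //; exact: RD_loc_bounded fsg df. Qed.

(** A change of base point in [QD] adds a constant to the function considered there, so its
    increments can be compared with [RS], which speaks of increments only. *)
Lemma QD_split f f1 t : QD a b rp rn sg chi f f1 t <->
  [/\ RD a b sg (Re f) (Re f1), RD a b sg (Im f) (Im f1), RS (Re f) (Re f1) (Re t) &
    RS (Im f) (Im f1) (Im t)].
Proof.
split.
  move=> [/is_deriv_split[dr di] [c [Ec [[lp ln] fE]]]].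
  have lr := RD_loci_chi dr; have li := RD_loci_chi di.
  have [_ pr] := (RD_primE _ _ _).1 (prim_RD Ec lr).
  have [_ pi] := (RD_primE _ _ _).1 (prim_RD Ec li).
  have lpr : loci a b rp (Re t) by move=> u v Eu Ev; exact: (lp u v Eu Ev).1.
  have lpi : loci a b rp (Im t) by move=> u v Eu Ev; exact: (lp u v Eu Ev).2.
  have lnr : loci a b rn (Re t) by move=> u v Eu Ev; exact: (ln u v Eu Ev).1.
  have lni : loci a b rn (Im t) by move=> u v Eu Ev; exact: (ln u v Eu Ev).2.
  split => //; split => // u x Eu Ex ux; have := fE u x Eu Ex; rewrite dint_Sint.
    move=> /(congr1 cre); rewrite !(creD, creN, cre_dint) (pr u x)// /prim ux /rho_int.
    by lra.
  move=> /(congr1 cim); rewrite !(cimD, cimN, cim_dint) (pi u x)// /prim ux /rho_int.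
  by lra.
move=> [dr di [lr [lpr lnr] sr] [li [lpi lni] si]].
split; first exact/is_deriv_split.
have [c Ec] := Iab_mid ab; exists c; split => //; split.
  by split=> u v Eu Ev; split; [exact: lpr|exact: lpi|exact: lnr|exact: lni].
have [_ pr] := (RD_primE _ _ _).1 (prim_RD Ec lr).
have [_ pi] := (RD_primE _ _ _).1 (prim_RD Ec li).
have full (f0 f10 t0 : R -> R) : RS f0 f10 t0 -> forall u x, E u -> E x ->
    f10 x = f10 u + prim chi f0 u x - (prim rp t0 u x - prim rn t0 u x).
  move=> [_ _ h] u x Eu Ex; rewrite /prim; case: ifPn => [ux|]; first exact: h.
  by rewrite -ltNge => /ltW xu; rewrite (h x u)// /rho_int; ring.
have fr := full _ _ _ (And3 lr (conj lpr lnr) sr).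
have fi := full _ _ _ (And3 li (conj lpi lni) si).
move=> u x Eu Ex; rewrite dint_Sint; apply: ceqP.
  by rewrite !(creD, creN, cre_dint) (pr u x)// (fr u x)//; ring.
by rewrite !(cimD, cimN, cim_dint) (pi u x)// (fi u x)//; ring.
Qed.

Lemma csq_L2 (mu : {measure set R -> \bar R}) f :
  measurable_fun E (Re f) -> measurable_fun E (Im f) ->
  (\int[mu]_(x in E) (csq (f x))%:E < +oo)%E <-> L2 mu E (Re f) /\ L2 mu E (Im f).
Proof.
move=> mr mi; have mc : measurable_fun E (fun x => csq (f x)).
  by apply: measurable_funD; exact: measurable_funX.
split=> [h|[[_ ir] [_ ii]]].
  have ic : intg mu E (fun x => csq (f x)).
    by apply: intg_fin => // x _; rewrite addr_ge0// sqr_ge0.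
  split; split => //; apply: intg_le ic => //; try exact: measurable_funX.
    by move=> x _; rewrite !ger0_norm ?addr_ge0 ?sqr_ge0// lerDl sqr_ge0.
  by move=> x _; rewrite !ger0_norm ?addr_ge0 ?sqr_ge0// lerDr sqr_ge0.
by apply: integrable_lty => //; exact: (intgD mE ir ii).
Qed.

(** [inH1] asserts square integrability for some version of the derivative; [RH1_ae] transfers it to
    the given f1. *)
Lemma inH1_split f f1 : is_deriv a b sg f f1 ->
  inH1 a b sg chi f <-> RH1 (Re f) (Re f1) /\ RH1 (Im f) (Im f1).
Proof.
have key g1 : RD a b sg (Re f) (Re g1) -> RD a b sg (Im f) (Im g1) ->
    ((\int[chi]_(x in E) (csq (f x))%:E < +oo)%E /\ (\int[sg]_(x in E) (csq (g1 x))%:E < +oo)%E) <->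
    RH1 (Re f) (Re g1) /\ RH1 (Im f) (Im g1).
  move=> dr di.
  have c1 := csq_L2 chi (RD_meas fsg dr) (RD_meas fsg di).
  have c2 := csq_L2 sg (loci_meas dr.1) (loci_meas di.1).
  split=> [[/c1[? ?] /c2[? ?]]|[[_ [? ?]] [_ [? ?]]]]; first by [].
  by split; [exact/c1|exact/c2].
move=> df; have /is_deriv_split[dr di] := df; split.
  move=> [g1 [/is_deriv_split[er ei] h]]; have [hr hi] := (key _ er ei).1 h.
  by split; [exact: (RH1_ae hr dr).1|exact: (RH1_ae hi di).1].
by move=> h; exists f1; split => //; exact/key.
Qed.

Lemma RS_ae (f f1 t s : R -> R) : RS f f1 t -> locs a b rp rn s ->
  {ae rp, forall x, E x -> t x = s x} -> {ae rn, forall x, E x -> t x = s x} -> RS f f1 s.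
Proof.
move=> [lf [lp ln] h] [mp mn] ep en; split => // c x Ec Ex cx; rewrite (h c x)//.
have sub := itv_sub Ec Ex.
congr (_ - (_ - _)); apply: Rint_ae_eq => //.
- exact: intg_meas (loci_co lp Ec Ex).
- exact: intg_meas (loci_co mp Ec Ex).
- by apply: filterS ep => y H /sub; exact: H.
- exact: intg_meas (loci_co ln Ec Ex).
- exact: intg_meas (loci_co mn Ec Ex).
- by apply: filterS en => y H /sub; exact: H.
Qed.

(** tau f is a class for |rho| and enters [RS] through integrals alone, so ft itself can serve as
    its representative. *)
Lemma Tmax_split f ft : Tmax a b rp rn sg chi f ft <-> RT (Re f) (Re ft) /\ RT (Im f) (Im ft).
Proof.
split.
  move=> [[_ [[ft1 dft] [f1 [t [/QD_split[dr di sr si] [[lp ln] [ep en]]]]]]] [hf hft]].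
  have df : is_deriv a b sg f f1 by exact/is_deriv_split.
  have [hr hi] := (inH1_split df).1 hf; have [htr hti] := (inH1_split dft).1 hft.
  have lr : locs a b rp rn (Re ft).
    by split=> u v Eu Ev; [exact: (lp u v Eu Ev).1|exact: (ln u v Eu Ev).1].
  have li : locs a b rp rn (Im ft).
    by split=> u v Eu Ev; [exact: (lp u v Eu Ev).2|exact: (ln u v Eu Ev).2].
  split; [exists (Re f1), (Re ft1)|exists (Im f1), (Im ft1)]; split => //.
  - apply: RS_ae sr lr _ _.
      by apply: filterS ep => x H Ex; rewrite H.
    by apply: filterS en => x H Ex; rewrite H.
  - apply: RS_ae si li _ _.
      by apply: filterS ep => x H Ex; rewrite H.
    by apply: filterS en => x H Ex; rewrite H.
move=> [[fr [tr [hr htr sr]]] [fi [ti [hi hti si]]]].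
pose f1 x := cpx (fr x) (fi x); pose t1 x := cpx (tr x) (ti x).
have df : is_deriv a b sg f f1 by apply/is_deriv_split; split; [case: hr|case: hi].
have dt : is_deriv a b sg ft t1 by apply/is_deriv_split; split; [case: htr|case: hti].
have [lr [lpr lnr] _] := sr; have [li [lpi lni] _] := si.
split; last by split; [exact/(inH1_split df)|exact/(inH1_split dt)].
split; first by exists f1.
split; first by exists t1.
exists f1, ft; split.
  by apply/QD_split; split => //; [case: hr|case: hi].
split; last by split; apply: aeW.
by split=> u v Eu Ev; split; [exact: lpr|exact: lpi|exact: lnr|exact: lni].
Qed.

Lemma RT_lin (f ft g gt : R -> R) (k : R) : RT f ft -> RT g gt ->
  RT (fun x => f x + k * g x) (fun x => ft x + k * gt x).
Proof.
move=> [f1 [ft1 [hf hft [lf [lp ln] h]]]] [g1 [gt1 [hg hgt [lg [mp mn] h']]]].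
exists (fun x => f1 x + k * g1 x), (fun x => ft1 x + k * gt1 x); split; try exact: RH1_lin.
split; first exact: loci_lin.
  by split; exact: loci_lin.
move=> c x Ec Ex cx; rewrite (h c x)// (h' c x)// /rho_int !Rint_lin//;
  try by [exact: (loci_co lf Ec Ex)|exact: (loci_co lg Ec Ex)|exact: (loci_co lp Ec Ex)|
    exact: (loci_co ln Ec Ex)|exact: (loci_co mp Ec Ex)|exact: (loci_co mn Ec Ex)].
by ring.
Qed.

Lemma RT_0 : RT (cst 0) (cst 0).
Proof.
have l0 (mu : {measure set R -> \bar R}) : loci a b mu (cst 0) by move=> c d _ _; exact: integrable0.
exists (cst 0), (cst 0); split; try exact: RH1_0.
split => // c x _ _ _; rewrite /rho_int /Rintegral !integral0 /=; ring.
Qed.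

Lemma ipH1_split f f1 g g1 : RH1 (Re f) (Re f1) -> RH1 (Im f) (Im f1) ->
  RH1 (Re g) (Re g1) -> RH1 (Im g) (Im g1) ->
  ipH1 a b sg chi f f1 g g1 =
  cpx (realip a b sg chi (Re f) (Re f1) (Re g) (Re g1) + realip a b sg chi (Im f) (Im f1) (Im g) (Im g1))
      (realip a b sg chi (Im f) (Im f1) (Re g) (Re g1) - realip a b sg chi (Re f) (Re f1) (Im g) (Im g1)).
Proof.
move=> [_ [fr fr1]] [_ [fi fi1]] [_ [gr gr1]] [_ [gi gi1]].
have key (mu : {measure set R -> \bar R}) p q :
    L2 mu E (Re p) -> L2 mu E (Im p) -> L2 mu E (Re q) -> L2 mu E (Im q) ->
    cre (Cint mu E (fun x => p x * cconj (q x))) =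
      \int[mu]_(x in E) (cre (p x) * cre (q x)) + \int[mu]_(x in E) (cim (p x) * cim (q x)) /\
    cim (Cint mu E (fun x => p x * cconj (q x))) =
      \int[mu]_(x in E) (cim (p x) * cre (q x)) - \int[mu]_(x in E) (cre (p x) * cim (q x)).
  move=> pr pi qr qi; rewrite cre_Cint cim_Cint; split.
    rewrite -RintegralD//; try exact: L2_prod.
    by apply: eq_Rint => x _; rewrite creM cre_conj cim_conj; ring.
  rewrite -RintegralB//; try exact: L2_prod.
  by apply: eq_Rint => x _; rewrite cimM cre_conj cim_conj; ring.
have [k1 k2] := key _ _ _ fr fi gr gi; have [k3 k4] := key _ _ _ fr1 fi1 gr1 gi1.
rewrite /ipH1; apply: ceqP.
  by rewrite creD k1 k3 cre_cpx /realip; ring.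
by rewrite cimD k2 k4 cim_cpx /realip; ring.
Qed.

Lemma realip0f p p1 : realip a b sg chi (cst 0) (cst 0) p p1 = 0.
Proof.
rewrite /realip !(@eq_Rint _ _ _ _ _ _ (cst 0)) => [|x _|x _]; last 2 first.
- exact: mul0r.
- exact: mul0r.
by rewrite /Rintegral !integral0 addr0.
Qed.

(** Pairing with a real element separates the real and imaginary parts of g; thus one complex
    adjoint identity yields two real ones. *)
Lemma ipH1_real p p1 g g1 : RH1 p p1 -> RH1 (Re g) (Re g1) -> RH1 (Im g) (Im g1) ->
  ipH1 a b sg chi (fun x => cpx (p x) 0) (fun x => cpx (p1 x) 0) g g1 =
  cpx (realip a b sg chi p p1 (Re g) (Re g1)) (- realip a b sg chi p p1 (Im g) (Im g1)).
Proof.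
move=> hp hr hi.
have := @ipH1_split (fun x => cpx (p x) 0) (fun x => cpx (p1 x) 0) g g1 hp (RH1_0 a b sg chi) hr hi.
by rewrite !realip0f addr0 sub0r.
Qed.

Lemma csq_sub_integral (mu : {measure set R -> \bar R}) f g :
  L2 mu E (fun x => cre (f x) - cre (g x)) -> L2 mu E (fun x => cim (f x) - cim (g x)) ->
  (\int[mu]_(x in E) (csq (f x - g x))%:E)%E =
  (\int[mu]_(x in E) ((cre (f x) - cre (g x)) ^+ 2) +
   \int[mu]_(x in E) ((cim (f x) - cim (g x)) ^+ 2))%:E.
Proof.
move=> [_ lr] [_ li]; rewrite -RintegralD// EFin_Rint//; last exact: intgD.
by apply: eq_integral => x _; rewrite /csq creD cimD creN cimN.
Qed.

Lemma dist2H1_parts f f1 g g1 e : RH1 (Re f) (Re f1) -> RH1 (Im f) (Im f1) ->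
  RH1 (Re g) (Re g1) -> RH1 (Im g) (Im g1) -> (dist2H1 a b sg chi f f1 g g1 <= e%:E)%E ->
  sqnorm a b sg chi (fun x => cre (f x) - cre (g x)) (fun x => cre (f1 x) - cre (g1 x)) <= e /\
  sqnorm a b sg chi (fun x => cim (f x) - cim (g x)) (fun x => cim (f1 x) - cim (g1 x)) <= e.
Proof.
move=> fr fi gr gi; have [_ [r1 r2]] := RH1_sub fr gr; have [_ [i1 i2]] := RH1_sub fi gi.
rewrite /dist2H1 (csq_sub_integral r1 i1) (csq_sub_integral r2 i2) -EFinD lee_fin /sqnorm => h.
have := L2_sqr_ge0 chi E (fun x => cre (f x) - cre (g x)).
have := L2_sqr_ge0 chi E (fun x => cim (f x) - cim (g x)).
have := L2_sqr_ge0 sg E (fun x => cre (f1 x) - cre (g1 x)).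
have := L2_sqr_ge0 sg E (fun x => cim (f1 x) - cim (g1 x)).
by move=> ? ? ? ?; split; lra.
Qed.

End splitting.

Theorem theorem3p1 (R : realType) (a b : \bar R)
  (rp rn sg chi : {measure set R -> \bar R}) :
  (a < b)%E ->
  (* varrho = rp - rn : real-valued, finite on compact subintervals,
     (rp, rn) mutually singular on (a,b) (Jordan decomposition) *)
  loc_finite a b rp -> loc_finite a b rn ->
  (exists S : set R, measurable S /\
      rp (Iab a b `\` S) = 0%E /\ rn (Iab a b `&` S) = 0%E) ->
  (* varsigma positive, finite on compact subintervals, support all of (a,b) *)
  loc_finite a b sg ->
  (forall c d, Iab a b c -> Iab a b d -> c < d -> (0 < sg `]c, d[)%E) ->
  (* chi positive, finite on compact subintervals, not identically zero *)
  loc_finite a b chi -> chi (Iab a b) <> 0%E ->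
  (* no common atoms *)
  (forall x, Iab a b x -> (sg [set x] * chi [set x] = 0)%E) ->
  (forall x, Iab a b x -> (sg [set x] * (rp [set x] - rn [set x]) = 0)%E) ->
  (* T_max is a linear relation in H^1(a,b) ... *)
  ((forall f ft g gt (k : R[i]),
      Tmax a b rp rn sg chi f ft -> Tmax a b rp rn sg chi g gt ->
      Tmax a b rp rn sg chi (fun x => f x + k * g x) (fun x => ft x + k * gt x))
   /\ Tmax a b rp rn sg chi (fun=> 0) (fun=> 0))
  (* ... which is closed in H^1(a,b) x H^1(a,b) ... *)
  /\ (forall (fn ftn : nat -> R -> R[i]) (f ft : R -> R[i]),
        (forall n, Tmax a b rp rn sg chi (fn n) (ftn n)) ->
        inH1 a b sg chi f -> inH1 a b sg chi ft ->
        cvgH1 a b sg chi fn f -> cvgH1 a b sg chi ftn ft ->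
        Tmax a b rp rn sg chi f ft)
  (* ... and whose adjoint is the restriction by the boundary conditions *)
  /\ (forall g gt : R -> R[i],
        inH1 a b sg chi g -> inH1 a b sg chi gt ->
        (Tmax_adj a b rp rn sg chi g gt <->
         (Tmax a b rp rn sg chi g gt /\
          forall f ft, Tmax a b rp rn sg chi f ft ->
            forall g1 tg f1 tf,
              QD a b rp rn sg chi g g1 tg -> QD a b rp rn sg chi f f1 tf ->
              lim_at_left_end a (Vw g gt g1 f ft f1) 0 /\
              lim_at_right_end b (Vw g gt g1 f ft f1) 0))).
Proof.
move=> ab frp frn [S [mS [rpS rnS]]] fsg sg_supp fchi chiE sgchi sgrho.
have mE : measurable (Iab a b) by exact: measurable_Iab.
have atom0 (mu : {measure set R -> \bar R}) (D : set R) x :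
    measurable D -> mu D = 0%E -> D x -> mu [set x] = 0%E.
  by move=> mD D0 Dx; apply: subset_measure0 D0 => // y ->.
(* By mutual singularity an atom of rho belongs to only one of [rp] and [rn], so nothing cancels in
   their difference and the hypothesis on common atoms passes to each of them. *)
have dich x : Iab a b x -> rp [set x] = 0%E \/ rn [set x] = 0%E.
  move=> Ex; have [Sx|nSx] := pselect (S x); [right|left].
    by apply: (atom0 _ _ _ _ rnS) => //; exact: measurableI.
  by apply: (atom0 _ _ _ _ rpS) => //; exact: measurableD.
have sgrp : common_atom_free a b sg rp.
  move=> x Ex; have [->|n0] := dich _ Ex; first by rewrite mule0.
  by have := sgrho _ Ex; rewrite n0 sube0.
have sgrn : common_atom_free a b sg rn.
  move=> x Ex; have [p0|->] := dich _ Ex; last by rewrite mule0.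
  have := sgrho _ Ex; rewrite p0 sub0e muleN => /eqP.
  by rewrite oppe_eq0 => /eqP.
have split_ab := @Tmax_split R a b rp rn sg chi ab fsg fchi.
have splitH1 := @inH1_split R a b sg chi fsg.
have splitQD := @QD_split R a b rp rn sg chi ab fsg fchi.
split; [split|split].
- move=> f ft g gt k /split_ab[fr fi] /split_ab[gr gi]; apply/split_ab; split.
    have := RT_lin (- cim k) (RT_lin (cre k) fr gr) gi.
    by congr RT; apply/funext => x; rewrite creD creM; ring.
  have := RT_lin (cre k) (RT_lin (cim k) fi gr) gi.
  by congr RT; apply/funext => x; rewrite cimD cimM; ring.
- by apply/split_ab; split; exact: RT_0.
- move=> fn ftn f ft hn hf hft cf cft.
  have [f1 [df _]] := hf; have [ft1 [dft _]] := hft.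
  have /choice[fn1 dfn] : forall n, exists g, is_deriv a b sg (fn n) g.
    by move=> n; have [[[g ?] _] _] := hn n; exists g.
  have /choice[ftn1 dftn] : forall n, exists g, is_deriv a b sg (ftn n) g.
    by move=> n; have [[_ [[g ?] _]] _] := hn n; exists g.
  have hfn n : inH1 a b sg chi (fn n) by have [_ []] := hn n.
  have hftn n : inH1 a b sg chi (ftn n) by have [_ []] := hn n.
  have [fr fi] := (splitH1 _ _ df).1 hf; have [tr ti] := (splitH1 _ _ dft).1 hft.
  have F n := (splitH1 _ _ (dfn n)).1 (hfn n).
  have T n := (splitH1 _ _ (dftn n)).1 (hftn n).
  have small e : 0 < e -> exists n,
      (dist2H1 a b sg chi (fn n) (fn1 n) f f1 <= e%:E)%E /\
      (dist2H1 a b sg chi (ftn n) (ftn1 n) ft ft1 <= e%:E)%E.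
    move=> e0; have c1 := cvg0_near_le (cf _ _ dfn df) e0; have c2 := cvg0_near_le (cft _ _ dftn dft) e0.
    by near \oo => n; exists n; split; near: n.
  apply/split_ab; split.
  + apply: (RT_closed ab frp frn fsg fchi sgchi sgrp sgrn sg_supp chiE
      (fun n => ((split_ab _ _).1 (hn n)).1) (fun n => (F n).1) (fun n => (T n).1) fr tr).
    move=> e /small[n [h1 h2]]; exists n; split.
      by have [] := dist2H1_parts (F n).1 (F n).2 fr fi h1.
    by have [] := dist2H1_parts (T n).1 (T n).2 tr ti h2.
  + apply: (RT_closed ab frp frn fsg fchi sgchi sgrp sgrn sg_supp chiE
      (fun n => ((split_ab _ _).1 (hn n)).2) (fun n => (F n).2) (fun n => (T n).2) fi ti).
    move=> e /small[n [h1 h2]]; exists n; split.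
      by have [] := dist2H1_parts (F n).1 (F n).2 fr fi h1.
    by have [] := dist2H1_parts (T n).1 (T n).2 tr ti h2.
- move=> g gt hg hgt.
  have [g0 [dg0 _]] := hg; have [gt0 [dgt0 _]] := hgt.
  have Tmax_real (f ft : R -> R) : RT a b rp rn sg chi f ft ->
      Tmax a b rp rn sg chi (fun x => cpx (f x) 0) (fun x => cpx (ft x) 0).
    by move=> h; apply/split_ab; split => //; exact: RT_0.
  have deriv_real (f f1 : R -> R) : RD a b sg f f1 ->
      is_deriv a b sg (fun x => cpx (f x) 0) (fun x => cpx (f1 x) 0).
    by move=> h; apply/is_deriv_split; split => //; case: (RH1_0 a b sg chi).
  have h0 := RH1_0 a b sg chi.
  (* The derivative supplied by [RT] and the quasi-derivative supplied by [QD] agree at every point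
     by [RS_unique]; an almost everywhere identity would not suffice for the boundary limits. *)
  have canon (p p1 q s : R -> R) : RT a b rp rn sg chi p q -> RD a b sg p p1 -> RS a b rp rn chi p p1 s ->
      RH1 a b sg chi p p1 /\ RS a b rp rn chi p p1 q.
    move=> [p2 [q2 [hp hq rp2]]] dp rp1; have [hp1 _] := RH1_ae hp dp; split => //.
    have e := RS_unique sg_supp hp.1 dp rp2 rp1.
    have [l1 l2 h] := rp2; split => // c x Ec Ex cx.
    by rewrite -(e x)// -(e c)//; exact: h.
  split.
    move=> [_ [_ adj]].
    have adjR g1 gt1 : is_deriv a b sg g g1 -> is_deriv a b sg gt gt1 ->
        adjoint_pair a b rp rn sg chi (fun x => cre (g x)) (fun x => cre (g1 x))
          (fun x => cre (gt x)) (fun x => cre (gt1 x)) /\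
        adjoint_pair a b rp rn sg chi (fun x => cim (g x)) (fun x => cim (g1 x))
          (fun x => cim (gt x)) (fun x => cim (gt1 x)).
      move=> dg dgt; have [gr gi] := (splitH1 _ _ dg).1 hg; have [tr ti] := (splitH1 _ _ dgt).1 hgt.
      suff key f f1 ft ft1 : RH1 a b sg chi f f1 -> RH1 a b sg chi ft ft1 -> RS a b rp rn chi f f1 ft ->
        realip a b sg chi ft ft1 (fun x => cre (g x)) (fun x => cre (g1 x)) =
        realip a b sg chi f f1 (fun x => cre (gt x)) (fun x => cre (gt1 x)) /\
        realip a b sg chi ft ft1 (fun x => cim (g x)) (fun x => cim (g1 x)) =
        realip a b sg chi f f1 (fun x => cim (gt x)) (fun x => cim (gt1 x)).
        by split=> f f1 ft ft1 hf hft rf; have [] := key _ _ _ _ hf hft rf.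
      move=> hf hft rf.
      have rt : RT a b rp rn sg chi f ft by exists f1, ft1.
      have := adj _ _ (Tmax_real _ _ rt) _ _ _ _ (deriv_real _ _ hf.1) (deriv_real _ _ hft.1) dg dgt.
      rewrite (ipH1_real hft gr gi) (ipH1_real hf tr ti).
      by move=> e; split; [exact: (congr1 (@cre R) e)|apply: oppr_inj; exact: (congr1 (@cim R) e)].
    have [ar0 ai0] := adjR _ _ dg0 dgt0.
    have [gr gi] := (splitH1 _ _ dg0).1 hg; have [tr ti] := (splitH1 _ _ dgt0).1 hgt.
    have rtr := adjoint_RT ab frp frn fsg fchi sgchi sgrp sgrn sg_supp chiE gr tr ar0.
    have rti := adjoint_RT ab frp frn fsg fchi sgchi sgrp sgrn sg_supp chiE gi ti ai0.
    split; first exact/split_ab.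
    move=> f ft /split_ab[fr fi] g1 tg f1 tf /splitQD[dgr dgi sgr sgi] /splitQD[dfr dfi sfr sfi].
    have dg : is_deriv a b sg g g1 by exact/is_deriv_split.
    have [ar ai] := adjR _ _ dg dgt0.
    have [hgr rgr] := canon _ _ _ _ rtr dgr sgr; have [hgi rgi] := canon _ _ _ _ rti dgi sgi.
    have [hfr rfr] := canon _ _ _ _ fr dfr sfr; have [hfi rfi] := canon _ _ _ _ fi dfi sfi.
    have [_ [tr1 [_ htr _]]] := fr; have [_ [ti1 [_ hti _]]] := fi.
    have bd := adjoint_boundary ab frp frn fsg fchi sgchi sgrp sgrn sg_supp chiE.
    (* The complex V is assembled from the four wronskians of real and imaginary parts of g and
       f. *)
    have [Lrr Rrr] := bd _ _ _ _ _ _ _ _ hgr tr rgr ar hfr htr rfr.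
    have [Lri Rri] := bd _ _ _ _ _ _ _ _ hgr tr rgr ar hfi hti rfi.
    have [Lir Rir] := bd _ _ _ _ _ _ _ _ hgi ti rgi ai hfr htr rfr.
    have [Lii Rii] := bd _ _ _ _ _ _ _ _ hgi ti rgi ai hfi hti rfi.
    have [m Em] := Iab_mid ab.
    split; [apply/(lim_left_end ab); split|apply/(lim_right_end ab); split].
    (* [Vw] has g first here, which reverses the sign of [wronskian]; X - 2 X provides the
       negative. *)
    - have := lim0L_lin (-2) (lim0L_lin (-1) Lrr Lii) (lim0L_lin (-1) Lrr Lii).
      move/lim0L_near; apply; exists m => // x _ _.
      by rewrite /Vw /wronskian creD creN !creM; ring.
    - have := lim0L_lin (-2) (lim0L_lin 1 Lri Lir) (lim0L_lin 1 Lri Lir).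
      move/lim0L_near; apply; exists m => // x _ _.
      by rewrite /Vw /wronskian cimD cimN !cimM; ring.
    - have := lim0R_lin (-2) (lim0R_lin (-1) Rrr Rii) (lim0R_lin (-1) Rrr Rii).
      move/lim0R_near; apply; exists m => // x _ _.
      by rewrite /Vw /wronskian creD creN !creM; ring.
    - have := lim0R_lin (-2) (lim0R_lin 1 Rri Rir) (lim0R_lin 1 Rri Rir).
      move/lim0R_near; apply; exists m => // x _ _.
      by rewrite /Vw /wronskian cimD cimN !cimM; ring.
  move=> [tg bc]; split => //; split => //.
  move=> f ft tf f1 ft1 g1 gt1 df dft dg dgt.
  have hf : inH1 a b sg chi f by case: tf => _ [].
  have hft : inH1 a b sg chi ft by case: tf => _ [].
  have [fr fi] := (splitH1 _ _ df).1 hf; have [ftr fti] := (splitH1 _ _ dft).1 hft.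
  have [gr gi] := (splitH1 _ _ dg).1 hg; have [gtr gti] := (splitH1 _ _ dgt).1 hgt.
  have /split_ab[[k1 [kt1 [hk1 hkt1 rk1]]] [k2 [kt2 [hk2 hkt2 rk2]]]] := tg.
  pose k x := cpx (k1 x) (k2 x).
  have QDk : QD a b rp rn sg chi g k gt by apply/splitQD; split => //; [case: hk1|case: hk2].
  (* Testing the boundary conditions with real pairs separates them into conditions on the real and
     on the imaginary part of g. *)
  have lims p p1 pt pt1 : RH1 a b sg chi p p1 -> RH1 a b sg chi pt pt1 -> RS a b rp rn chi p p1 pt ->
      (lim0L a b (wronskian p1 pt k1 (fun x => cre (gt x))) /\
       lim0R a b (wronskian p1 pt k1 (fun x => cre (gt x)))) /\
      (lim0L a b (wronskian p1 pt k2 (fun x => cim (gt x))) /\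
       lim0R a b (wronskian p1 pt k2 (fun x => cim (gt x)))).
    move=> hp hpt rp1; have rt : RT a b rp rn sg chi p pt by exists p1, pt1.
    have QDp : QD a b rp rn sg chi (fun x => cpx (p x) 0) (fun x => cpx (p1 x) 0) (fun x => cpx (pt x) 0).
      apply/splitQD; split => //; [by case: hp|by case: h0|].
      have [z1 [z2 [hz _ rz]]] := RT_0 a b rp rn sg chi.
      have [] := canon (cst 0) (cst 0) (cst 0) (cst 0) (RT_0 a b rp rn sg chi) h0.1 _ => //.
      have l0 (mu : {measure set R -> \bar R}) : loci a b mu (cst 0) by move=> c d _ _; exact: integrable0.
      by split => // c x _ _ _; rewrite /rho_int /Rintegral !integral0 /=; ring.
    have [/(lim_left_end ab)[lr li] /(lim_right_end ab)[rr ri]] := bc _ _ (Tmax_real _ _ rt) _ _ _ _ QDk QDp.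
    have [m Em] := Iab_mid ab.
    split; split.
    - have := lim0L_lin (-2) lr lr; move/lim0L_near; apply; exists m => // x _ _.
      by rewrite /Vw /wronskian creD creN !creM !cre_cpx !cim_cpx; ring.
    - have := lim0R_lin (-2) rr rr; move/lim0R_near; apply; exists m => // x _ _.
      by rewrite /Vw /wronskian creD creN !creM !cre_cpx !cim_cpx; ring.
    - have := lim0L_lin (-2) li li; move/lim0L_near; apply; exists m => // x _ _.
      by rewrite /Vw /wronskian cimD cimN !cimM !cre_cpx !cim_cpx; ring.
    - have := lim0R_lin (-2) ri ri; move/lim0R_near; apply; exists m => // x _ _.
      by rewrite /Vw /wronskian cimD cimN !cimM !cre_cpx !cim_cpx; ring.
  have wa := wronskian_adjoint ab frp frn fsg fchi sgchi sgrp sgrn.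
  have ar := wa _ _ _ _ hk1 gtr rk1 (fun p p1 pt pt1 hp hpt rp1 => (lims p p1 pt pt1 hp hpt rp1).1).
  have ai := wa _ _ _ _ hk2 gti rk2 (fun p p1 pt pt1 hp hpt rp1 => (lims p p1 pt pt1 hp hpt rp1).2).
  (* The real adjoint identities hold for the quasi-derivative k of g, whereas the goal has an
     arbitrary version g1; inner products do not distinguish them. The same applies to f. *)
  have [_ er] := RH1_ae hk1 gr.1; have [_ ei] := RH1_ae hk2 gi.1.
  have /split_ab[[p1 [pt1 [hp1 hpt1 rp1]]] [p2 [pt2 [hp2 hpt2 rp2]]]] := tf.
  have [_ fr1] := RH1_ae hp1 fr.1; have [_ fi1] := RH1_ae hp2 fi.1.
  have e1 := ar _ _ _ _ hp1 ftr rp1; have e2 := ar _ _ _ _ hp2 fti rp2.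
  have e3 := ai _ _ _ _ hp1 ftr rp1; have e4 := ai _ _ _ _ hp2 fti rp2.
  rewrite (ipH1_split ftr fti gr gi) (ipH1_split fr fi gtr gti).
  rewrite !(fr1 _ _ gtr) !(fr1 _ _ gti) !(fi1 _ _ gtr) !(fi1 _ _ gti) -e1 -e2 -e3 -e4.
  by congr cpx; rewrite ![realip _ _ _ _ _ _ (fun x => cre (g x)) _]realipC
    ![realip _ _ _ _ _ _ (fun x => cim (g x)) _]realipC
    ?(er _ _ ftr) ?(er _ _ fti) ?(ei _ _ ftr) ?(ei _ _ fti)
    ![realip _ _ _ _ _ _ (fun x => cre (ft x)) _]realipC
    ![realip _ _ _ _ _ _ (fun x => cim (ft x)) _]realipC.
Unshelve. all: by end_near.
Qed.
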